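(* Let $X_1,\dots,X_n$ be independent symmetric real random variables with logarithmically concave tails such that $\mathbf{E}X_i^2=1$ for all $i$, and let $a_1,\dots,a_n$ be real numbers with $|a_1|\ge|a_2|\ge\dots\ge|a_n|$. Then for any real $p\ge3$, $$\max\bigg\{\gamma_p\Big(\sum_{i\ge\lceil p/2\rceil}a_i^2\Big)^{1/2},\ \Big\|\sum_{i<p}a_iX_i\Big\|_p\bigg\}\ \le\ \Big\|\sum_{i=1}^n a_iX_i\Big\|_p\ \le\ \gamma_p\Big(\sum_{i\ge\lceil p/2\rceil}a_i^2\Big)^{1/2}+\Big\|\sum_{i<p}a_iX_i\Big\|_p,$$ where all sums are over indices $i\in\{1,\dots,n\}$ satisfying the indicated condition.
   Context: For a random variable $X$, $\|X\|_p=(\mathbf{E}|X|^p)^{1/p}$. A random variable $X$ has logarithmically concave tails if the function $t\mapsto\ln\mathbf{P}(|X|\ge t)$ is concave from $[0,\infty)$ to $[-\infty,0]$. $\gamma_p=\|\mathcal{N}(0,1)\|_p=(\mathbf{E}|G|^p)^{1/p}$ for a standard Gaussian $G$, so $\gamma_p^p=2^{p/2}\Gamma(\frac{p+1}{2})/\sqrt\pi$. $\lceil\cdot\rceil$ is the ceiling function; an empty sum equals $0$. *)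

(* Defs.v *)
From HB Require Import structures.
From mathcomp Require Import all_boot all_order all_algebra.
From mathcomp Require Import all_classical all_reals all_analysis.

Set Implicit Arguments.
Unset Strict Implicit.
Unset Printing Implicit Defensive.

Import Order.TTheory GRing.Theory Num.Theory.
Import numFieldNormedType.Exports.

Local Open Scope classical_set_scope.
Local Open Scope ring_scope.
Local Open Scope ereal_scope.

Section random_variables.
Context d (T : measurableType d) (R : realType) (P : probability T R).

Definition independent_RVs (I : finType) (X : I -> {RV P >-> R}) : Prop :=
  forall (J : {set I}) (A : I -> set R),
    (forall i, i \in J -> measurable (A i)) ->
    P (\bigcap_(i in [set` J]) (X i @^-1` A i)) =
    \prod_(i in J) P (X i @^-1` A i).

(* Equality in distribution is only required on measurable sets, since the
   values of a measure on other sets are unspecified. *)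
Definition symmetric_RV (X : {RV P >-> R}) : Prop :=
  forall A : set R, measurable A ->
    P (X @^-1` A) = P ((fun w => - X w)%R @^-1` A).

Definition log_tail (X : {RV P >-> R}) (t : R) : \bar R :=
  lne (P [set w | (t <= `|X w|)%R]).

(* lne 0 = -oo, and log_tail X <= 0, so +oo - oo never occurs. In the endpoint
   cases l = 0 and l = 1, the convention 0 * -oo = 0 makes the inequality
   trivial. *)
Definition log_concave_tails (X : {RV P >-> R}) : Prop :=
  forall s t l : R, (0 <= s)%R -> (0 <= t)%R -> (0 <= l <= 1)%R ->
    l%:E * log_tail X s + (1 - l)%:E * log_tail X t
    <= log_tail X (l * s + (1 - l) * t)%R.

End random_variables.

Definition gaussian_norm (R : realType) (p : R) : \bar R :=
  'N[normal_prob (0 : R) 1]_p%:E[(fun x : measurableTypeR R => (x : R)%:E)].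

(* Main.v *)
(* By [dsymp_ratio], for p >= 3 the derivative in t of the symmetrization of
   |y + b t|^p, divided by t, increases. Hence, for laws with the same second moment
   whose tails cross once, E|y + b X|^p is larger for the law with the heavier tail.
   Replacing the summands one at a time, E|y + sum_i a_i X_i|^p is at least its
   value for random signs and, by log-concavity of the tails, at most its value
   for Laplace variables of any variance greater than 1.

   Gaussian bounds for sign sums and for Laplace sums go by induction from
   p - 2 to p, along gamma_p^p = (p - 1) gamma_{p-2}^{p-2}. For signs,
   E|S|^p >= (p - 1) sum_i a_i^2 E|S - a_i e_i|^{p-2}; for Laplace variables,
   E|S|^p <= E|S - a_i L_i|^p + (p (p - 1) / 2) Var(a_i L_i) E|S|^{p-2}. In the
   base case 2 < p < 4, |z|^p is a positive mixture of the functions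
   cos(t z) - 1 + (t z)^2 / 2, so that characteristic functions can be compared
   pointwise.

   The lower Gaussian bound follows from the sign case, the bound by the head
   from Jensen's inequality; for the upper bound, Minkowski's inequality splits
   off the tail i >= p, to which the Laplace case applies. The coefficients with
   p/2 <= i < p pay for the error term of that case. *)

Require Import Defs.
From HB Require Import structures.
From mathcomp Require Import all_boot all_order all_algebra.
From mathcomp Require Import all_classical all_reals all_analysis.
From mathcomp Require Import measurable_realfun ring lra.

Set Implicit Arguments.
Unset Strict Implicit.
Unset Printing Implicit Defensive.

Import Order.TTheory GRing.Theory Num.Theory.
Import numFieldNormedType.Exports.

Local Open Scope classical_set_scope.
Local Open Scope ring_scope.

(** * Powers and their symmetrizations *)

Section absolute_powers.
Context {R : realType}.
Implicit Types p r x y z : R.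

(** The Gaussian norm carries the exact constant [gamma_p], so no step may lose a factor; what the
    argument gives away is variance instead. For signs, each descent from [p] to [p - 2] deletes one
    coefficient, chosen by the sum over [i] and hence arbitrary, and the base case [2 < p < 4]
    deletes the largest one. For Laplace variables each descent, and the base case, adds one copy of
    the largest variance. About [p / 2] such losses occur, and this produces the threshold
    [ceil (p / 2)].

    The descent has to stop in [[2, 4)]: at [p = 2] both sides are variances, and [2 < p < 4] is
    exactly the range in which [cos (t z) - 1 + (t z)^2 / 2] is integrable against [t^(-p-1) dt].

    The restriction [p >= 3] comes from the crossing argument, which needs [|x|^(p-2)] to be convex.
    The Laplace variance has to exceed 1 strictly, since with equal variances the tails may coincide
    and no crossing point exists; the exact constant is recovered in a final limit. *)

Definition apow p x := `|x| `^ p.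
Definition spow p x := Num.sg x * `|x| `^ p.

Lemma apow_ge0 p x : 0 <= apow p x.
Proof. exact: powR_ge0. Qed.

Lemma apowN p x : apow p (- x) = apow p x.
Proof. by rewrite /apow normrN. Qed.

Lemma apowM p x y : apow p (x * y) = apow p x * apow p y.
Proof. by rewrite /apow normrM powRM. Qed.

Lemma apow2 x : apow 2 x = x ^+ 2.
Proof. by rewrite /apow (powR_mulrn 2)// real_normK// num_real. Qed.

Lemma mulr_spow p x : 1 < p -> x * spow (p - 1) x = apow p x.
Proof.
move=> p1; have [->|x0] := eqVneq x 0.
  by rewrite mul0r /apow normr0 powR0// gt_eqF// (lt_trans _ p1).
rewrite /spow /apow {1}[x]numEsg mulrACA -expr2 sqr_sg x0 mul1r mulr_powRB1//.
by rewrite (lt_trans _ p1).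
Qed.

Lemma apow_continuous0 p : 0 < p -> {for 0, continuous (apow p)}.
Proof.
move=> p0; rewrite /prop_for /continuous_at /apow normr0 powR0 ?gt_eqF//.
apply/cvgr0Pnorm_lt => e e0; near=> x.
rewrite ger0_norm ?powR_ge0//.
have -> : e = (e `^ p^-1) `^ p.
  by rewrite -powRrM mulVf ?gt_eqF// powRr1// ltW.
apply: gt0_ltr_powR => //; rewrite ?nnegrE ?powR_ge0//.
near: x; have /cvgr0Pnorm_lt : (fun x : R => x) @ 0 --> (0 : R) by exact: cvg_id.
by apply; exact: powR_gt0.
Unshelve. all: by end_near. Qed.

Lemma spow_continuous0 p : 0 < p -> {for 0, continuous (spow p)}.
Proof.
move=> p0; rewrite /prop_for /continuous_at /spow sgr0 mul0r.
have := apow_continuous0 p0; rewrite /prop_for /continuous_at.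
rewrite {2}/apow normr0 powR0 ?gt_eqF// => ap0.
apply: norm_cvg0; apply: squeeze_cvgr (cvg_cst 0) ap0; near=> x.
rewrite normr_ge0/= normrM (ger0_norm (powR_ge0 _ _)).
by apply: ler_piMl; rewrite ?powR_ge0// normr_sg; case: eqP.
Unshelve. all: by end_near. Qed.

Lemma is_derive_near (f g : R -> R) x (df : R) : (\near x, f x = g x) ->
  is_derive x 1 f df -> is_derive x 1 g df.
Proof. exact: near_eq_is_derive. Qed.

Lemma is_derive_powRN p x : x < 0 ->
  is_derive x 1 (fun z : R => (- z) `^ p) (- (p * (- x) `^ (p - 1))).
Proof.
move=> x0.
have h : is_derive (- x) 1 (fun z : R => z `^ p) (p * (- x) `^ (p - 1)).
  by apply: is_derive1_powR; rewrite oppr_gt0.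
have k : is_derive x 1 (fun z : R => - z) (-1) by apply: is_deriveNid.
by have := is_derive1_comp h k; rewrite mulrN1.
Qed.

Lemma is_derive_apow p x : 1 < p -> is_derive x 1 (apow p) (p * spow (p - 1) x).
Proof.
move=> p1; have p0 : 0 < p by rewrite (lt_trans _ p1).
have [x0|x0|x0] := ltgtP x 0.
- have -> : p * spow (p - 1) x = - (p * (- x) `^ (p - 1)).
    by rewrite /spow ltr0_sg// mulN1r mulrN ltr0_norm.
  apply: (@is_derive_near (fun z : R => (- z) `^ p)).
    near=> z; rewrite /apow/= ltr0_norm//.
    by near: z; exact: lt_nbhsl.
  exact: is_derive_powRN.
- have -> : p * spow (p - 1) x = p * x `^ (p - 1).
    by rewrite /spow gtr0_sg// mul1r gtr0_norm.
  apply: (@is_derive_near (fun z : R => z `^ p)).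
    near=> z; rewrite /apow/= gtr0_norm//.
    by near: z; exact: lt_nbhsr.
  exact: is_derive1_powR.
(* At 0 the difference quotient of [apow p] is [spow (p - 1)] itself, continuous there because
   [p > 1]. *)
- subst x; apply/is_derive1_caratheodory; exists (spow (p - 1)); split.
  + move=> z; rewrite subr0 [spow _ _ * _]mulrC mulr_spow//.
    by rewrite {2}/apow normr0 powR0 ?subr0// gt_eqF.
  + by apply: spow_continuous0; rewrite subr_gt0.
  + by rewrite /spow sgr0 mul0r mulr0.
Unshelve. all: by end_near. Qed.

Lemma is_derive_spow p x : 1 < p -> is_derive x 1 (spow p) (p * apow (p - 1) x).
Proof.
move=> p1; have p0 : 0 < p by rewrite (lt_trans _ p1).
have [x0|x0|x0] := ltgtP x 0.
- have -> : p * apow (p - 1) x = - - (p * (- x) `^ (p - 1)).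
    by rewrite /apow ltr0_norm// opprK.
  apply: (@is_derive_near (fun z : R => - ((- z) `^ p))).
    near=> z; rewrite /spow/= ltr0_norm ?ltr0_sg ?mulN1r//.
      by near: z; exact: lt_nbhsl.
    by near: z; exact: lt_nbhsl.
  apply: is_deriveN.
  exact: is_derive_powRN.
- have -> : p * apow (p - 1) x = p * x `^ (p - 1).
    by rewrite /apow gtr0_norm.
  apply: (@is_derive_near (fun z : R => z `^ p)).
    near=> z; rewrite /spow/= gtr0_norm ?gtr0_sg ?mul1r//.
      by near: z; exact: lt_nbhsr.
    by near: z; exact: lt_nbhsr.
  exact: is_derive1_powR.
- subst x; apply/is_derive1_caratheodory; exists (apow (p - 1)); split.
  + move=> z; rewrite subr0 /apow /spow sgr0 mul0r subr0.
    rewrite {4}[z]numEsg.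
    by rewrite mulrCA mulrC [_ * `|z|]mulrC mulr_powRB1// mulrC.
  + by apply: apow_continuous0; rewrite subr_gt0.
  + by rewrite /apow normr0 powR0 ?mulr0// subr_eq0 gt_eqF.
Unshelve. all: by end_near. Qed.

Lemma continuous_apow p : 1 < p -> continuous (apow p).
Proof.
move=> p1 x; apply/differentiable_continuous/derivable1_diffP.
by have [] := is_derive_apow x p1.
Qed.

Lemma measurable_apow p : measurable_fun setT (apow p).
Proof. by apply: (measurableT_comp (measurable_powR p)); exact: normr_measurable. Qed.

Lemma apow_convex p (l x y : R) : 1 <= p -> 0 <= l <= 1 ->
  apow p (l * x + (1 - l) * y) <= l * apow p x + (1 - l) * apow p y.
Proof.
move=> p1 l01; case/andP: (l01) => l0 l1.
have l1' : 0 <= 1 - l by rewrite subr_ge0.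
apply: (@le_trans _ _ ((l * `|x| + (1 - l) * `|y|) `^ p)).
  apply: ge0_ler_powR; rewrite ?nnegrE ?(le_trans _ p1)//.
    by rewrite addr_ge0// mulr_ge0.
  by rewrite (le_trans (ler_normD _ _))// !normrM (ger0_norm l0) (ger0_norm l1').
by apply: (convex_powR p1 (Itv01 l0 l1)); rewrite inE/= in_itv/= normr_ge0.
Qed.

(** Convexity: [y + u] and [y - u] are convex combinations of [y + v] and [y - v] with the weights
    [l], [1 - l] interchanged, so the weights add up to 1 at each endpoint. *)
Lemma apow_sum_monotone p y u v : 1 <= p -> 0 <= u <= v ->
  apow p (y + u) + apow p (y - u) <= apow p (y + v) + apow p (y - v).
Proof.
move=> p1 /andP[u0 uv]; have [v0|v0] := eqVneq v 0.
  by have -> : u = v by apply/eqP; rewrite eq_le uv v0 u0.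
have {}v0 : 0 < v by rewrite lt_neqAle eq_sym v0 (le_trans u0).
pose l := (v + u) / (2 * v).
have l01 : 0 <= l <= 1.
  rewrite /l divr_ge0 ?addr_ge0 ?mulr_ge0 ?(ltW v0)//= ler_pdivrMr ?mulr_gt0//.
  by rewrite mul1r mulr_natl mulr2n lerD2l.
have E1 : y + u = l * (y + v) + (1 - l) * (y - v).
  by rewrite /l; field; rewrite gt_eqF.
have E2 : y - u = l * (y - v) + (1 - l) * (y + v).
  by rewrite /l; field; rewrite gt_eqF.
rewrite E1 E2; have := apow_convex (y + v) (y - v) p1 l01.
have := apow_convex (y - v) (y + v) p1 l01; lra.
Qed.

End absolute_powers.

Section symmetrized_powers.
Context {R : realType}.
Implicit Types p q y b s t : R.

Lemma MVT_line (f df : R -> R) (a b : R) : (forall x : R, is_derive x 1 f (df x)) ->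
  a < b -> exists2 c, a < c < b & f b - f a = df c * (b - a).
Proof.
move=> fdf ab.
have fcont : {within `[a, b], continuous f}.
  by apply: derivable_within_continuous => x _; exact: ex_derive.
have [c cab ->] := MVT ab (fun x _ => fdf x) fcont.
by exists c => //; rewrite in_itv in cab.
Qed.

Definition symp p y b t := 2^-1 * (apow p (y + b * t) + apow p (y - b * t)).

(** The [t]-derivative of [symp]. It vanishes at 0, and its own derivative is a multiple of
    [symp (p - 2)]: this is how the exponent drops by 2. *)
Definition dsymp p y b t :=
  2^-1 * (p * b * spow (p - 1) (y + b * t) - p * b * spow (p - 1) (y - b * t)).

Lemma symp_ge0 p y b t : 0 <= symp p y b t.
Proof. by rewrite mulr_ge0// addr_ge0// apow_ge0. Qed.

Lemma sympN p y b t : symp p y b (- t) = symp p y b t.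
Proof. by rewrite /symp mulrN opprK addrC. Qed.

Lemma symp_norm p y b t : symp p y b `|t| = symp p y b t.
Proof. by have [_|_] := ger0P t => //; rewrite sympN. Qed.

Lemma symp_normb p y b t : symp p y `|b| t = symp p y b t.
Proof.
by have [_|_] := ger0P b => //; rewrite /symp mulNr opprK addrC.
Qed.

Lemma symp0 p y b : symp p y b 0 = apow p y.
Proof. by rewrite /symp mulr0 addr0 subr0; field. Qed.

Lemma dsymp0 p y b : dsymp p y b 0 = 0.
Proof. by rewrite /dsymp mulr0 addr0 subr0 subrr mulr0. Qed.

Lemma is_derive_affine y b t : is_derive t 1 (fun u : R => y + b * u) b.
Proof.
have h := is_deriveD (is_derive_cst y t 1) (is_deriveZ b (is_derive_id t (1 : R))).
by rewrite add0r /GRing.scale/= mulr1 in h.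
Qed.

Lemma is_derive_comp_affine (f : R -> R) (df y b t : R) :
  is_derive (y + b * t) 1 f df ->
  is_derive t 1 (fun u => f (y + b * u)) (b * df).
Proof.
move=> h; rewrite mulrC.
exact: (@is_derive1_comp R f (fun u : R => y + b * u) t df b h (is_derive_affine y b t)).
Qed.

Lemma is_derive_symp p y b t : 1 < p ->
  is_derive t 1 (symp p y b) (dsymp p y b t).
Proof.
move=> p1.
have h1 := is_derive_comp_affine (is_derive_apow (y + b * t) p1).
have h2 := @is_derive_comp_affine (apow p) _ y (- b) t
  (is_derive_apow (y + (- b) * t) p1).
have := is_deriveZ 2^-1 (is_deriveD h1 h2).
have -> : 2^-1 *: (b * (p * spow (p - 1) (y + b * t)) +
     - b * (p * spow (p - 1) (y + - b * t))) = dsymp p y b t.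
  by rewrite /GRing.scale/= /dsymp !mulNr !mulrA (mulrC p).
move=> h; apply: is_derive_near h.
by near=> z; rewrite /symp -mulNr.
Unshelve. all: by end_near. Qed.

Lemma is_derive_dsymp p y b t : 2 < p ->
  is_derive t 1 (dsymp p y b) (p * (p - 1) * b ^+ 2 * symp (p - 2) y b t).
Proof.
move=> p2; have p1 : 1 < p - 1 by lra.
have h1 := is_derive_comp_affine (is_derive_spow (y + b * t) p1).
have h2 := @is_derive_comp_affine (spow (p - 1)) _ y (- b) t
  (is_derive_spow (y + (- b) * t) p1).
have := is_deriveZ 2^-1 (is_deriveZ (p * b) (is_deriveB h1 h2)).
set x := (X in is_derive _ _ _ X).
have -> : x = p * (p - 1) * b ^+ 2 * symp (p - 2) y b t.
  rewrite /x /GRing.scale/= /symp !mulNr.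
  have -> : p - 1 - 1 = p - 2 by ring.
  by ring.
move=> h; apply: is_derive_near h; near=> z.
by rewrite /dsymp -mulrBr -[- (b * z)]mulNr.
Unshelve. all: by end_near. Qed.

Lemma continuous_symp p y b : 1 < p -> continuous (symp p y b).
Proof.
move=> p1 x; apply/differentiable_continuous/derivable1_diffP.
by have [] := is_derive_symp y b x p1.
Qed.

Lemma continuous_dsymp p y b : 2 < p -> continuous (dsymp p y b).
Proof.
move=> p1 x; apply/differentiable_continuous/derivable1_diffP.
by have [] := is_derive_dsymp y b x p1.
Qed.

Lemma symp_monotone p y b s t : 1 <= p -> 0 <= s <= t ->
  symp p y b s <= symp p y b t.
Proof.
move=> p1 /andP[s0 st]; rewrite -!(symp_normb _ _ b) /symp.
rewrite ler_pM2l//; apply: apow_sum_monotone => //.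
by rewrite mulr_ge0//= ler_wpM2l.
Qed.

Lemma dsymp_ge0 p y b t : 2 < p -> 0 <= t -> 0 <= dsymp p y b t.
Proof.
move=> p2; rewrite le_eqVlt => /predU1P[<-|t0]; first by rewrite dsymp0.
have [c _] := MVT_line (fun x => is_derive_dsymp y b x p2) t0.
rewrite dsymp0 !subr0 => ->.
rewrite mulr_ge0 ?(ltW t0)// mulr_ge0 ?symp_ge0// mulr_ge0 ?sqr_ge0//.
by apply: mulr_ge0; lra.
Qed.

(** The derivative of [dsymp] is a multiple of [symp (p - 2)], nondecreasing on the half-line once
    [p - 2 >= 1]. So [dsymp] is convex there and vanishes at 0, and its slope from the origin
    increases; the two mean values on [[0, s]] and [[s, t]] make this explicit. *)
Lemma dsymp_ratio p y b s t : 3 <= p -> 0 < s -> s <= t ->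
  dsymp p y b s * t <= dsymp p y b t * s.
Proof.
move=> p3 s0; rewrite le_eqVlt => /predU1P[->//|st].
have p2 : 2 < p by lra.
have [c /andP[c0 cs]] := MVT_line (fun x => is_derive_dsymp y b x p2) s0.
have [d /andP[sd dt]] := MVT_line (fun x => is_derive_dsymp y b x p2) st.
rewrite dsymp0 !subr0 => E1 E2.
set k := p * (p - 1) * b ^+ 2 in E1 E2.
have k0 : 0 <= k by rewrite mulr_ge0 ?sqr_ge0// mulr_ge0; lra.
have : k * symp (p - 2) y b c <= k * symp (p - 2) y b d.
  by apply: ler_wpM2l => //; apply: symp_monotone; lra.
have -> : dsymp p y b t = dsymp p y b s + k * symp (p - 2) y b d * (t - s).
  by rewrite -E1; ring.
rewrite E2; set u := _ * symp _ _ _ c; set v := _ * symp _ _ _ d => uv.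
by rewrite -subr_ge0 (_ : _ - _ = (v - u) * (s * (t - s))); [apply: mulr_ge0; [|apply: mulr_ge0]; lra|ring].
Qed.

(** Mean value theorem on [[0, 1]], with [symp (p - 2)] at least its value at 0. This bounds the
    discrete derivative that arises in [rad_avg_by_parts]. *)
Lemma dsymp1_ge p y b : 3 <= p ->
  p * (p - 1) * b ^+ 2 * apow (p - 2) y <= dsymp p y b 1.
Proof.
move=> p3; have p2 : 2 < p by lra.
have [c /andP[c0 cs]] := MVT_line (fun x => is_derive_dsymp y b x p2) ltr01.
rewrite dsymp0 !subr0 mulr1 => ->.
rewrite ler_wpM2l//; first by rewrite mulr_ge0 ?sqr_ge0// mulr_ge0; lra.
by rewrite -(symp0 _ _ b) symp_monotone; lra.
Qed.

End symmetrized_powers.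

(** * Averages over symmetrized laws *)

Section symmetrized_averages.
Context {R : realType}.
Implicit Types (mu nu : probability R R) (f g : R -> \bar R) (b c y : R).
Local Open Scope ereal_scope.

(* The mean of [f (y + e * b * Z)] where [Z] has law [mu] and [e] is an
   independent random sign. *)
Definition sym_avg mu b f y : \bar R :=
  \int[mu]_t ((2^-1)%:E * (f (y + b * t)%R + f (y - b * t)%R)).

Lemma measurable_addM y b : measurable_fun [set: R] (fun t : R => (y + b * t)%R).
Proof. by apply: measurable_funD => //; exact: measurable_funM. Qed.

Lemma measurable_subM y b : measurable_fun [set: R] (fun t : R => (y - b * t)%R).
Proof. by apply: measurable_funB => //; exact: measurable_funM. Qed.

Lemma measurable_addM2 b :
  measurable_fun [set: R * R] (fun z : R * R => (z.1 + b * z.2)%R).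
Proof. by apply: measurable_funD => //; exact: measurable_funM. Qed.

Lemma measurable_subM2 b :
  measurable_fun [set: R * R] (fun z : R * R => (z.1 - b * z.2)%R).
Proof. by apply: measurable_funB => //; exact: measurable_funM. Qed.

Lemma measurable_sym_avg_integrand f b y : measurable_fun [set: R] f ->
  measurable_fun [set: R]
    (fun t : R => (2^-1)%:E * (f (y + b * t)%R + f (y - b * t)%R)).
Proof.
move=> mf; apply: emeasurable_funM => //; apply: emeasurable_funD.
  by apply: measurableT_comp => //; exact: measurable_addM.
by apply: measurableT_comp => //; exact: measurable_subM.
Qed.

Lemma sym_avg_integrand_ge0 f b y t : (forall z, 0 <= f z) ->
  0 <= (2^-1)%:E * (f (y + b * t)%R + f (y - b * t)%R).
Proof. by move=> f0; rewrite mule_ge0 ?adde_ge0// lee_fin. Qed.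

Lemma sym_avg_ge0 mu b f : (forall z, 0 <= f z) -> forall y, 0 <= sym_avg mu b f y.
Proof.
by move=> f0 y; apply: integral_ge0 => t _; exact: sym_avg_integrand_ge0.
Qed.

Lemma measurable_sym_avg mu b f : (forall z, 0 <= f z) ->
  measurable_fun [set: R] f -> measurable_fun [set: R] (sym_avg mu b f).
Proof.
move=> f0 mf.
apply: (@measurable_fun_fubini_tonelli_F _ _ _ _ _ mu
  (fun z : R * R => (2^-1)%:E * (f (z.1 + b * z.2)%R + f (z.1 - b * z.2)%R))).
- apply: emeasurable_funM => //; apply: emeasurable_funD.
    by apply: measurableT_comp => //; exact: measurable_addM2.
  by apply: measurableT_comp => //; exact: measurable_subM2.
- by move=> z; exact: sym_avg_integrand_ge0.
Qed.

Lemma le_sym_avg mu b f g : (forall z, 0 <= f z) ->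
  measurable_fun [set: R] f -> measurable_fun [set: R] g ->
  (forall z, f z <= g z) -> forall y, sym_avg mu b f y <= sym_avg mu b g y.
Proof.
move=> f0 mf mg fg y; apply: ge0_le_integral => //.
- by move=> t _; exact: sym_avg_integrand_ge0.
- exact: measurable_sym_avg_integrand.
- exact: measurable_sym_avg_integrand.
- by move=> t _; rewrite lee_pmul2l// leeD.
Qed.

Lemma eq_sym_avg mu b f g : f =1 g -> sym_avg mu b f =1 sym_avg mu b g.
Proof. by move=> /funext ->. Qed.

Lemma sym_avgD mu b f g : (forall z, 0 <= f z) -> (forall z, 0 <= g z) ->
  measurable_fun [set: R] f -> measurable_fun [set: R] g ->
  forall y, sym_avg mu b (f \+ g) y = sym_avg mu b f y + sym_avg mu b g y.
Proof.
move=> f0 g0 mf mg y; rewrite -ge0_integralD//.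
- by apply: eq_integral => t _ /=; rewrite addeACA ge0_muleDr// adde_ge0.
- by move=> t _; exact: sym_avg_integrand_ge0.
- exact: measurable_sym_avg_integrand.
- by move=> t _; exact: sym_avg_integrand_ge0.
- exact: measurable_sym_avg_integrand.
Qed.

Lemma sym_avgZ mu b (k : R) f : (0 <= k)%R -> (forall z, 0 <= f z) ->
  measurable_fun [set: R] f ->
  forall y, sym_avg mu b (fun z => k%:E * f z) y = k%:E * sym_avg mu b f y.
Proof.
move=> k0 f0 mf y; rewrite -ge0_integralZl//.
- by apply: eq_integral => t _ /=; rewrite -ge0_muleDr// muleCA.
- exact: measurable_sym_avg_integrand.
- by move=> t _; exact: sym_avg_integrand_ge0.
Qed.

(** Tonelli's theorem: in either order the integrand is the mean [F] of [f] over the same four sign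
    patterns. *)
Lemma sym_avgC mu nu b c f : (forall z, 0 <= f z) -> measurable_fun [set: R] f ->
  forall y, sym_avg mu b (sym_avg nu c f) y = sym_avg nu c (sym_avg mu b f) y.
Proof.
move=> f0 mf y.
pose F (z : R * R) := (4^-1)%:E *
  ((f (y + b * z.1 + c * z.2)%R + f (y + b * z.1 - c * z.2)%R) +
   (f (y - b * z.1 + c * z.2)%R + f (y - b * z.1 - c * z.2)%R)).
have avgE (la : probability R R) (k : R) (u v : R) :
    (2^-1)%:E * (sym_avg la k f u + sym_avg la k f v) =
    \int[la]_t ((4^-1)%:E * ((f (u + k * t)%R + f (u - k * t)%R) +
                             (f (v + k * t)%R + f (v - k * t)%R))).
  rewrite -ge0_integralD//; last 4 first.
  - by move=> t _; exact: sym_avg_integrand_ge0.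
  - exact: measurable_sym_avg_integrand.
  - by move=> t _; exact: sym_avg_integrand_ge0.
  - exact: measurable_sym_avg_integrand.
  rewrite -ge0_integralZl//; last 2 first.
  - by apply: emeasurable_funD; exact: measurable_sym_avg_integrand.
  - by move=> t _; rewrite adde_ge0// sym_avg_integrand_ge0.
  apply: eq_integral => t _; rewrite -ge0_muleDr ?adde_ge0// muleA -EFinM.
  by congr (_%:E * _); field.
have m1 : measurable_fun [set: R * R] (fun z : R * R => y + b * z.1)%R.
  by apply: measurable_funD => //; exact: measurable_funM.
have m1' : measurable_fun [set: R * R] (fun z : R * R => y - b * z.1)%R.
  by apply: measurable_funB => //; exact: measurable_funM.
have m2 : measurable_fun [set: R * R] (fun z : R * R => c * z.2)%R.
  by exact: measurable_funM.
have mF : measurable_fun [set: R * R] F.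
  apply: emeasurable_funM => //.
  apply: emeasurable_funD; apply: emeasurable_funD; apply: measurableT_comp => //;
    by [apply: measurable_funD | apply: measurable_funB].
have F0 z : 0 <= F z by rewrite /F mule_ge0 ?adde_ge0// lee_fin.
transitivity (\int[mu]_x \int[nu]_t F (x, t)).
  by apply: eq_integral => x _; rewrite avgE.
rewrite (fubini_tonelli F)//; apply: eq_integral => t _; rewrite avgE.
apply: eq_integral => x _; rewrite /F/= addeACA.
by congr (_ * (f _ + f _ + (f _ + f _))); ring.
Qed.

End symmetrized_averages.

(** * Averages over sums of several symmetrized terms *)

Section iterated_averages.
Context {R : realType} {I : eqType}.
Implicit Types (mu nu : I -> probability R R) (f g : R -> \bar R) (b c : I -> R).
Local Open Scope ereal_scope.

(** At [y] this is the mean of [f (y + S)] for a sum [S] of independent symmetrized terms. Nested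
    one-dimensional integrals replace a product space, so that single summands can be exchanged or
    moved inside. *)
Fixpoint iter_avg mu b (s : seq I) f : R -> \bar R :=
  if s is i :: s' then sym_avg (mu i) (b i) (iter_avg mu b s' f) else f.

Lemma iter_avg_cat mu b s1 s2 f :
  iter_avg mu b (s1 ++ s2) f = iter_avg mu b s1 (iter_avg mu b s2 f).
Proof. by elim: s1 => //= i s ->. Qed.

Lemma iter_avg_rcons mu b s i f :
  iter_avg mu b (rcons s i) f = iter_avg mu b s (sym_avg (mu i) (b i) f).
Proof. by rewrite -cats1 iter_avg_cat. Qed.

Lemma iter_avg_ge0_measurable mu b s f : (forall z, 0 <= f z) ->
  measurable_fun [set: R] f ->
  (forall z, 0 <= iter_avg mu b s f z) /\ measurable_fun [set: R] (iter_avg mu b s f).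
Proof.
move=> f0 mf; elim: s => [//|i s [h1 h2]] /=; split; first exact: sym_avg_ge0.
exact: measurable_sym_avg.
Qed.

Lemma iter_avg_ge0 mu b s f : (forall z, 0 <= f z) ->
  measurable_fun [set: R] f -> forall z, 0 <= iter_avg mu b s f z.
Proof. by move=> f0 mf; have [] := iter_avg_ge0_measurable mu b s f0 mf. Qed.

Lemma measurable_iter_avg mu b s f : (forall z, 0 <= f z) ->
  measurable_fun [set: R] f -> measurable_fun [set: R] (iter_avg mu b s f).
Proof. by move=> f0 mf; have [] := iter_avg_ge0_measurable mu b s f0 mf. Qed.

Lemma le_iter_avg mu b s f g : (forall z, 0 <= f z) ->
  measurable_fun [set: R] f -> measurable_fun [set: R] g ->
  (forall z, f z <= g z) -> forall y, iter_avg mu b s f y <= iter_avg mu b s g y.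
Proof.
move=> f0 mf mg fg; elim: s => [//|i s IH] /=.
have g0 z : 0 <= g z by rewrite (le_trans (f0 z)).
apply: le_sym_avg => //.
- exact: iter_avg_ge0.
- exact: measurable_iter_avg.
- exact: measurable_iter_avg.
Qed.

Lemma iter_avgD mu b s f g : (forall z, 0 <= f z) -> (forall z, 0 <= g z) ->
  measurable_fun [set: R] f -> measurable_fun [set: R] g ->
  forall y, iter_avg mu b s (f \+ g) y = iter_avg mu b s f y + iter_avg mu b s g y.
Proof.
move=> f0 g0 mf mg; elim: s => [//|i s IH] y /=.
rewrite (eq_sym_avg _ _ IH) sym_avgD//; first [exact: iter_avg_ge0|exact: measurable_iter_avg].
Qed.

Lemma iter_avgZ mu b s (k : R) f : (0 <= k)%R -> (forall z, 0 <= f z) ->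
  measurable_fun [set: R] f ->
  forall y, iter_avg mu b s (fun z => k%:E * f z) y = k%:E * iter_avg mu b s f y.
Proof.
move=> k0 f0 mf; elim: s => [//|i s IH] y /=.
rewrite (eq_sym_avg _ _ IH) sym_avgZ//; first [exact: iter_avg_ge0|exact: measurable_iter_avg].
Qed.

Lemma iter_avgC mu (nu : probability R R) b (c : R) s f : (forall z, 0 <= f z) ->
  measurable_fun [set: R] f ->
  forall y, sym_avg nu c (iter_avg mu b s f) y = iter_avg mu b s (sym_avg nu c f) y.
Proof.
move=> f0 mf; elim: s => [//|i s IH] y /=.
rewrite sym_avgC ?(eq_sym_avg _ _ IH)//; first exact: iter_avg_ge0.
exact: measurable_iter_avg.
Qed.

(* The summands are replaced one at a time, the averages being commuted past one
   another. *)
Lemma iter_avg_compare mu nu b c s f : (forall z, 0 <= f z) ->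
  measurable_fun [set: R] f ->
  (forall i y, i \in s -> sym_avg (mu i) (b i) f y <= sym_avg (nu i) (c i) f y) ->
  forall y, iter_avg mu b s f y <= iter_avg nu c s f y.
Proof.
move=> f0 mf; elim: s => [//|i s IH] h y /=.
have {}IH := IH (fun j y js => h j y (mem_behead (s := i :: s) js)).
apply: (@le_trans _ _ (sym_avg (mu i) (b i) (iter_avg nu c s f) y)).
  apply: le_sym_avg => //; first exact: iter_avg_ge0.
    exact: measurable_iter_avg.
  exact: measurable_iter_avg.
rewrite !iter_avgC//; apply: le_iter_avg => //.
- exact: sym_avg_ge0.
- exact: measurable_sym_avg.
- exact: measurable_sym_avg.
- by move=> z; rewrite h// mem_head.
Qed.

End iterated_averages.

(** * Independent symmetric variables *)

Section independent_sums.
Context d (T : measurableType d) (R : realType) (P : probability T R).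
Local Open Scope ereal_scope.

(** The law of [(U, V)] restricted to [C] and that law scaled by [P C] are finite measures agreeing
    on rectangles, a generating family closed under intersection. It lets independence pass from [U]
    and [V] to a combination of the two. *)
Lemma pair_independent_event (U V : T -> R) (C : set T) :
  measurable_fun [set: T] U -> measurable_fun [set: T] V -> measurable C ->
  (forall A B, measurable A -> measurable B ->
    P (U @^-1` A `&` V @^-1` B) = P (U @^-1` A) * P (V @^-1` B)) ->
  (forall A B, measurable A -> measurable B ->
    P (U @^-1` A `&` V @^-1` B `&` C) = P (U @^-1` A) * P (V @^-1` B) * P C) ->
  forall Z : set (R * R), measurable Z ->
    P ((fun w => (U w, V w)) @^-1` Z `&` C) =
    P ((fun w => (U w, V w)) @^-1` Z) * P C.
Proof.
move=> mU mV mC UV UVC Z mZ.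
have mUV : measurable_fun [set: T] (fun w => (U w, V w)).
  exact: measurable_fun_pair.
have PC0 : (0 <= fine (P C))%R by rewrite fine_ge0.
have PCE : P C = (fine (P C))%:E by rewrite fineK ?fin_num_measure.
pose m1 : {measure set _ -> \bar R} :=
  pushforward (mrestr P mC) (fun w => (U w, V w)).
pose m2 : {measure set _ -> \bar R} :=
  mscale (NngNum PC0) (pushforward P (fun w => (U w, V w))).
pose G : set (set (R * R)) :=
  [set A `*` B | A in [set A | measurable A] & B in [set B | measurable B]].
suff : m1 mUV Z = m2 mUV Z.
  by rewrite /m1 /m2/= /mscale/= /pushforward/= /mrestr -PCE muleC.
apply: (measure_unique G (fun=> setT)) => //.
- by rewrite measurable_prod_measurableType.
- move=> _ _ [A mA [B mB <-]] [A' mA' [B' mB' <-]].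
  exists (A `&` A'); first exact: measurableI.
  by exists (B `&` B'); [exact: measurableI|rewrite setXI].
- by move=> _; rewrite /G/=; exists setT => //; exists setT => //; rewrite setXTT.
- by rewrite bigcup_const//; exists 0%N.
- move=> _ [A mA [B mB <-]].
  rewrite /m1 /m2/= /mscale/= /pushforward/= /mrestr -PCE muleC.
  have -> : (fun w => (U w, V w)) @^-1` (A `*` B) = U @^-1` A `&` V @^-1` B by [].
  by rewrite UVC// UV.
- move=> _; rewrite /m1/= /pushforward/= /mrestr preimage_setT setTI.
  by rewrite ltey_eq fin_num_measure.
Qed.

Context (I : finType) (X : I -> {RV P >-> R}) (b : I -> R).
Hypothesis indepX : independent_RVs X.

Definition weighted_sum (s : seq I) (w : T) : R := (\sum_(i <- s) b i * X i w)%R.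

Lemma weighted_sum_cons i s w :
  weighted_sum (i :: s) w = (b i * X i w + weighted_sum s w)%R.
Proof. by rewrite /weighted_sum big_cons. Qed.

Lemma measurable_weighted_sum s : measurable_fun [set: T] (weighted_sum s).
Proof.
elim: s => [|i s IH].
  by rewrite (_ : weighted_sum _ = cst 0%R)//; apply/funext => w; rewrite /weighted_sum big_nil.
rewrite (_ : weighted_sum _ = (fun w => b i * X i w + weighted_sum s w)%R).
  by apply: measurable_funD => //; exact: measurable_funM.
by apply/funext => w; rewrite /weighted_sum big_cons.
Qed.

Let event (J : {set I}) (A : I -> set R) := \bigcap_(i in [set` J]) (X i @^-1` A i).

Let measurable_X i A : measurable A -> measurable (X i @^-1` A).
Proof. by move=> mA; rewrite -[X in measurable X]setTI; exact: measurable_funPT. Qed.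

Let measurable_event (J : {set I}) (A : I -> set R) :
  (forall i, i \in J -> measurable (A i)) -> measurable (event J A).
Proof.
move=> mA; apply: fin_bigcap_measurable; first exact: finite_finset.
by move=> i /= /mA; exact: measurable_X.
Qed.

(** Quantifying over all [J] disjoint from [s] makes the induction work: when [X i] is split off the
    sum, its event joins those of [J]. *)
Lemma weighted_sum_independent s (J : {set I}) (A : I -> set R) B : uniq s ->
  (forall i, i \in s -> i \notin J) -> measurable B ->
  (forall i, i \in J -> measurable (A i)) ->
  P (weighted_sum s @^-1` B `&` event J A) =
  P (weighted_sum s @^-1` B) * P (event J A).
Proof.
elim: s J A B => [|i s IH] J A B /=.
  move=> _ _ _ _; have -> : weighted_sum [::] = cst 0%R.
    by apply/funext => w; rewrite /weighted_sum big_nil.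
  rewrite preimage_cst; case: ifPn => _.
    by rewrite setTI probability_setT mul1e.
  by rewrite set0I measure0 mul0e.
move=> /andP[iNs us] sJ mB mA.
(* Rectangles for the pair (sum over [s], [X i]): the event on [X i] is absorbed into [i |: J'], to
   which the induction hypothesis applies. *)
have step (J' : {set I}) (A' : I -> set R) : i \notin J' ->
    (forall j, j \in s -> j \notin J') ->
    (forall j, j \in J' -> measurable (A' j)) ->
    forall B1 B2, measurable B1 -> measurable B2 ->
    P (weighted_sum s @^-1` B1 `&` X i @^-1` B2 `&` event J' A') =
    P (weighted_sum s @^-1` B1) * P (X i @^-1` B2) * P (event J' A').
  move=> iJ sJ' mA' B1 B2 mB1 mB2.
  pose A2 j := if j == i then B2 else A' j.
  have mA2 j : j \in i |: J' -> measurable (A2 j).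
    by rewrite /A2 in_setU1; case: eqP => //= _; exact: mA'.
  have EA2 : event (i |: J') A2 = X i @^-1` B2 `&` event J' A'.
    apply/seteqP; split => [w h|w [h1 h2] j /=].
      split; first by have := h i; rewrite /A2 eqxx/= setU11; exact.
      move=> j jJ; have := h j; rewrite /A2/= in_setU1 jJ orbT => /(_ isT).
      by case: eqP => // ji; move: iJ; rewrite -ji jJ.
    by rewrite in_setU1 /A2; case: eqP => [->//|_] /= jJ; exact: h2.
  rewrite -setIA -EA2 IH//.
    rewrite -muleA; congr (_ * _); rewrite indepX// big_setU1//= {1}/A2 eqxx.
    rewrite indepX//; congr (_ * _); apply: eq_bigr => j jJ.
    by rewrite /A2; case: eqP => // ji; move: iJ; rewrite -ji jJ.
  move=> j js; rewrite in_setU1 negb_or sJ' ?js// andbT.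
  by apply: contraNneq iNs => <-.
have h0 : event finset.set0 A = setT.
  by apply/seteqP; split => // w _ j; rewrite /= inE.
have E : weighted_sum (i :: s) @^-1` B = (fun w => (weighted_sum s w, X i w)) @^-1`
    ((fun z : R * R => z.1 + b i * z.2)%R @^-1` B).
  by apply/seteqP; split => w /=; rewrite weighted_sum_cons addrC.
rewrite E; apply: (@pair_independent_event _ _ (event J A)).
- exact: measurable_weighted_sum.
- exact: measurable_funPT.
- exact: measurable_event.
- move=> A1 B1 mA1 mB1.
  have := step finset.set0 A; rewrite h0 probability_setT => /(_ _ _ _ A1 B1).
  rewrite setIT mule1; apply=> //; by [rewrite inE|move=> ?; rewrite inE|move=> ? _; rewrite inE].
- apply: step => //; first by apply: sJ; rewrite mem_head.
  by move=> j js; apply: sJ; rewrite inE js orbT.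
- rewrite -[X in measurable X]setTI; exact: measurable_addM2.
Qed.

Hypothesis symX : forall i, symmetric_RV (X i).

Lemma symmetric_integral i (g : R -> \bar R) : (forall z, 0 <= g z) ->
  measurable_fun [set: R] g ->
  \int[distribution P (X i)]_x g (- x)%R = \int[distribution P (X i)]_x g x.
Proof.
move=> g0 mg.
have mN : measurable_fun [set: T] (fun w => (- X i w)%R) by exact: measurableT_comp.
pose N : {RV P >-> R} := mfun_Sub (mem_set mN).
transitivity (\int[distribution P N]_x g x).
  by rewrite !ge0_integral_distribution//; exact: measurableT_comp.
apply: eq_measure_integral => A mA _.
exact: (esym (symX i mA)).
Qed.

(** The bridge from random variables to iterated averages. Independence makes the joint law of the
    partial sum and [X i] a product; symmetry of [X i] allows its mean to be replaced by the mean
    over both signs. *)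
Lemma ge0_expectation_weighted_sum s (f : R -> \bar R) y : uniq s ->
  (forall z, 0 <= f z) -> measurable_fun [set: R] f ->
  \int[P]_w f (y + weighted_sum s w)%R =
  iter_avg (fun i => distribution P (X i)) b s f y.
Proof.
move=> us f0 mf; elim: s us y => [_ y|i s IH /=/andP[iNs us] y].
  under eq_integral do rewrite /weighted_sum big_nil addr0.
  by rewrite integral_cst// -[RHS]mule1 -(probability_setT P).
pose S : {RV P >-> R} := mfun_Sub (mem_set (measurable_weighted_sum s)).
have mS : measurable_fun [set: T] (fun w => (S w, X i w)).
  exact: measurable_fun_pair.
pose g (z : R * R) := f (y + b i * z.2 + z.1)%R.
have mg : measurable_fun [set: R * R] g.
  apply: measurableT_comp => //; apply: measurable_funD => //.
  by apply: measurable_funD => //; exact: measurable_funM.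
pose SX : {RV P >-> (R * R)%type} := mfun_Sub (mem_set mS).
transitivity (\int[distribution P SX]_z g z).
  rewrite ge0_integral_distribution//; last by move=> z; exact: f0.
  apply: eq_integral => w _; rewrite weighted_sum_cons addrA.
  exact: erefl.
rewrite (eq_measure_integral (distribution P S \x distribution P (X i))%E); last first.
  move=> Z mZ _; symmetry; apply: product_measure_unique => // A B mA mB.
  transitivity (P (weighted_sum s @^-1` A `&` X i @^-1` B)) => //.
  pose A2 (j : I) := B.
  have EA2 : event (finset.set1 i) A2 = X i @^-1` B.
    apply/seteqP; split => [w /(_ i)/=|w h j /=]; first by rewrite inE eqxx; exact.
    by rewrite inE => /eqP ->.
  rewrite -EA2 weighted_sum_independent//; first by rewrite EA2.
  by move=> j js; rewrite inE; apply: contraNneq iNs => <-.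
rewrite fubini_tonelli2//; last by move=> z; exact: f0.
have h0 := iter_avg_ge0 (fun i => distribution P (X i)) b s f0 mf.
have mh := measurable_iter_avg (fun i => distribution P (X i)) b s f0 mf.
transitivity (\int[distribution P (X i)]_x
    iter_avg (fun i => distribution P (X i)) b s f (y + b i * x)%R).
  apply: eq_integral => x _; rewrite -IH// /fubini_G/= ge0_integral_distribution//.
    by apply: measurableT_comp => //; exact: measurable_funD.
  by move=> z; exact: f0.
set h := iter_avg _ _ _ _.
pose k x := h (y + b i * x)%R.
have mk : measurable_fun [set: R] k by apply: measurableT_comp => //; exact: measurable_addM.
have mk' : measurable_fun [set: R] (fun x => k (- x)%R) by exact: measurableT_comp.
have k0 x : 0 <= k x by exact: h0.
rewrite /sym_avg ge0_integralZl//; last 2 first.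
- apply: emeasurable_funD; apply: measurableT_comp => //; [exact: measurable_addM|exact: measurable_subM].
- by move=> t _; rewrite adde_ge0.
rewrite (_ : \int[_]_x (_ + _) = \int[distribution P (X i)]_x (k x + k (- x)%R)); last first.
  by apply: eq_integral => x _; rewrite /k mulrN.
rewrite ge0_integralD// symmetric_integral// -mule2n -mule_natl muleA -EFinM.
by rewrite mulVf// mul1e.
Qed.

End independent_sums.

(** * Comparison of laws through their tails *)

Section laws_on_the_line.
Context {R : realType}.
Local Open Scope ereal_scope.
Local Notation leb := (@lebesgue_measure R).

Lemma measurable_idR : measurable_fun [set: measurableTypeR R] (fun x => x : R).
Proof. by move=> _ A mA; rewrite setTI. Qed.

Lemma measurable_onR d (T : measurableType d) (f : R -> T) :
  measurable_fun [set: R] f -> measurable_fun [set: measurableTypeR R] (f : measurableTypeR R -> T).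
Proof. by move=> mf; exact: (measurableT_comp mf measurable_idR). Qed.

(* [normal_prob] and [exponential_prob] live on [measurableTypeR R], which has
   the same measurable sets as [R] but another display. *)
Definition borel_law (nu : probability (measurableTypeR R) R) : probability R R :=
  distribution nu (mfun_Sub (mem_set measurable_idR) : {RV nu >-> R}).

Lemma ge0_integral_borel_law nu (f : R -> \bar R) : (forall x, 0 <= f x) ->
  measurable_fun [set: R] f -> \int[borel_law nu]_x f x = \int[nu]_x f x.
Proof. by move=> f0 mf; rewrite ge0_integral_distribution. Qed.

(** Change of variables holds for the Radon-Nikodym derivative of [nu], which equals [g] almost
    everywhere because both have the same integral over every measurable set. *)
Lemma ge0_integral_density (nu : probability (measurableTypeR R) R) (g f : R -> R) :
  (forall x, 0 <= g x)%R -> measurable_fun [set: R] g ->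
  (forall A : set (measurableTypeR R), measurable A -> nu A = \int[leb]_(x in A) (g x)%:E) ->
  (forall x, 0 <= f x)%R -> measurable_fun [set: R] f ->
  \int[nu]_x (f x)%:E = \int[leb]_x (f x * g x)%:E.
Proof.
move=> g0 mg nuE f0 mf.
have mg' : measurable_fun [set: measurableTypeR R] (EFin \o g).
  by apply/measurable_EFinP; exact: measurable_onR.
have mf' : measurable_fun [set: measurableTypeR R] (EFin \o f).
  by apply/measurable_EFinP; exact: measurable_onR.
have numu : nu `<< leb.
  apply/null_content_dominatesP => A mA muA0; rewrite nuE//.
  apply: null_set_integral => //; exact: measurable_funTS.
pose h := Radon_Nikodym_SigmaFinite.f nu leb.
have hi : leb.-integrable [set: measurableTypeR R] h.
  exact: Radon_Nikodym_SigmaFinite.f_integrable.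
rewrite -(@Radon_Nikodym_SigmaFinite.change_of_variables _ _ _ nu leb numu (EFin \o f))//.
apply: ae_eq_integral => //.
- apply: emeasurable_funM => //; exact: measurable_int hi.
- exact: (emeasurable_funM mf' mg').
- rewrite (_ : (fun x => (f x * g x)%:E) = (EFin \o f) \* (EFin \o g))//.
  apply: ae_eqe_mul2l; apply: integral_ae_eq => // A _ mA.
  by rewrite -nuE// /h -Radon_Nikodym_SigmaFinite.f_integral.
Qed.

Lemma integral_derivative0 (F f : R -> R) (a : R) :
  (forall x : R, is_derive x 1%R F (f x)) -> continuous f -> (0 <= a)%R ->
  \int[leb]_(s in `[0%R, a]) (f s)%:E = (F a - F 0)%:E.
Proof.
move=> Ff cf; rewrite le_eqVlt => /predU1P[<-|a0].
  by rewrite set_itv1 integral_set1 subrr.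
have cF : continuous F.
  move=> x; apply/differentiable_continuous/derivable1_diffP.
  by have [] := Ff x.
rewrite (@continuous_FTC2 _ f F 0 a)//.
- exact: continuous_subspaceT.
- split.
  + by move=> x _; have [] := Ff x.
  + exact/cvg_at_right_filter/cF.
  + exact/cvg_at_left_filter/cF.
- by move=> x _; rewrite derive1E; exact: derive_val.
Qed.

(** Write [F |x| - F 0] as the integral of [f] over [0 <= s <= |x|] and exchange the two integrals
    by Tonelli's theorem. *)
Lemma layer_cake (mu : probability R R) (F f : R -> R) :
  (forall x : R, is_derive x 1%R F (f x)) -> continuous f ->
  (forall x, 0 <= x -> 0 <= f x)%R -> (0 <= F 0)%R ->
  \int[mu]_x (F `|x|%R)%:E =
  (F 0%R)%:E + \int[leb]_(s in `[0%R, +oo[) ((f s)%:E * mu [set x | (s <= `|x|)%R]).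
Proof.
move=> Ff cf f0 F0.
pose D : set R := `[0%R, +oo[%classic.
have mD : measurable D by exact: measurable_itv.
have DE s : (s \in D) = (0 <= s)%R by rewrite /D mem_setE in_itv/= andbT.
pose h (s : R) : R := (f s * \1_D s)%R.
have h0 s : (0 <= h s)%R.
  rewrite /h indicE DE; case: (boolP (0 <= s)%R) => [s0|_]; last by rewrite mulr0.
  by rewrite mulr1 f0.
have mf : measurable_fun [set: R] f by exact: continuous_measurable_fun.
have mh : measurable_fun [set: R] h by apply: measurable_funM.
pose E : set (R * measurableTypeR R) := [set z | (z.2 <= `|z.1|)%R].
have mE : measurable E.
  have -> : E = (fun z : R * measurableTypeR R => ((z.2 : R) <= `|z.1|)%R) @^-1` [set true].
    by apply/seteqP; split.
  rewrite -[X in measurable X]setTI; apply: measurable_fun_ler => //.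
  by apply: measurableT_comp => //; exact: measurable_idR.
have EE z : (z \in E) = (z.2 <= `|z.1|)%R by apply/idP/idP; rewrite inE.
pose g (z : R * measurableTypeR R) := (h z.2 * \1_E z)%R.
have g0 z : 0 <= (g z)%:E by rewrite lee_fin mulr_ge0.
have mg : measurable_fun [set: R * measurableTypeR R] (EFin \o g).
  apply/measurable_EFinP; apply: measurable_funM => //.
  by apply: measurableT_comp; [exact: measurable_onR|exact: measurable_snd].
have inner x : \int[leb]_s (g (x, s))%:E = (F `|x| - F 0)%:E.
  rewrite -(integral_derivative0 Ff cf (normr_ge0 x)) [RHS]integral_mkcond.
  apply: eq_integral => s _; rewrite patchE mem_setE in_itv/= /g /h/= !indicE.
  rewrite DE EE/=.
  by case: (0 <= s)%R; case: (s <= `|x|)%R; rewrite ?mulr1 ?mulr0.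
transitivity (\int[mu]_x ((F 0)%:E + \int[leb]_s (g (x, s))%:E)).
  by apply: eq_integral => x _; rewrite inner -EFinD addrC subrK.
rewrite ge0_integralD//; last 2 first.
- by move=> x _; apply: integral_ge0 => s _; exact: g0.
- exact: (measurable_fun_fubini_tonelli_F _ mg g0).
congr (_ + _); first by rewrite integral_cst// -[RHS]mule1 -(probability_setT mu).
rewrite (fubini_tonelli _ mg g0) [RHS]integral_mkcond.
apply: eq_integral => s _; rewrite patchE.
have -> : (s \in `[0%R, +oo[%classic) = (s \in D) by [].
rewrite /g /h/= indicE; case: ifPn => sD; last first.
  by under eq_integral do rewrite mulr0 mul0r; rewrite integral0.
have s0 : (0 <= s)%R by rewrite -DE.
have mC : measurable [set x : R | (s <= `|x|)%R].
  have -> : [set x : R | (s <= `|x|)%R] = (fun x : R => `|x|%R) @^-1` `[s, +oo[%classic.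
    by apply/seteqP; split => x /=; rewrite in_itv/= andbT.
  by rewrite -[X in measurable X]setTI; exact: normr_measurable.
transitivity (\int[mu]_x ((f s)%:E * (\1_[set x : R | (s <= `|x|)%R] x)%:E)).
  by apply: eq_integral => x _; rewrite mulr1 -EFinM !indicE EE mem_setE.
rewrite ge0_integralZl//; last by rewrite lee_fin f0.
- by rewrite integral_indic// setIT.
- by apply/measurable_EFinP; exact: measurable_indic.
Qed.

End laws_on_the_line.

(** * Laws whose tails cross once *)

Section tail_comparison.
Context {R : realType}.
Local Open Scope ereal_scope.
Local Notation leb := (@lebesgue_measure R).
Implicit Types (mu nu : probability R R) (p y b c s : R).

Definition abs_tail mu s := mu [set x | (s <= `|x|)%R].

Lemma measurable_abs_ge s : measurable [set x : R | (s <= `|x|)%R].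
Proof.
have -> : [set x : R | (s <= `|x|)%R] = (fun x : R => `|x|%R) @^-1` `[s, +oo[%classic.
  by apply/seteqP; split => x /=; rewrite in_itv/= andbT.
by rewrite -[X in measurable X]setTI; exact: normr_measurable.
Qed.

Lemma fin_num_abs_tail mu s : abs_tail mu s \is a fin_num.
Proof. by rewrite fin_num_measure//; exact: measurable_abs_ge. Qed.

Lemma le_abs_tail mu s t : (s <= t)%R -> abs_tail mu t <= abs_tail mu s.
Proof.
move=> st; apply: le_measure; rewrite ?inE; [exact: measurable_abs_ge..|].
by move=> x /=; exact: le_trans.
Qed.

Lemma measurable_abs_tail mu :
  measurable_fun [set: measurableTypeR R] (abs_tail mu : measurableTypeR R -> \bar R).
Proof.
rewrite (_ : abs_tail mu = EFin \o (fun s => - - fine (abs_tail mu s))%R); last first.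
  by apply/funext => s /=; rewrite opprK fineK// fin_num_abs_tail.
apply/measurable_EFinP; apply: measurable_onR; apply: measurableT_comp => //.
apply: nondecreasing_measurable => // s t st.
by rewrite lerN2 fine_le ?fin_num_abs_tail// le_abs_tail.
Qed.

Lemma measurable_symp p y b : measurable_fun [set: R] (symp p y b).
Proof.
apply: measurable_funM => //; apply: measurable_funD;
  apply: measurableT_comp (measurable_apow p) _.
- exact: measurable_addM.
- exact: measurable_subM.
Qed.

Lemma measurable_EFin_apow p : measurable_fun [set: R] (fun x => (apow p x)%:E).
Proof. by apply/measurable_EFinP; exact: measurable_apow. Qed.

Lemma sym_avg_apow mu p y b :
  sym_avg mu b (fun z => (apow p z)%:E) y = \int[mu]_t (symp p y b t)%:E.
Proof. by []. Qed.

Lemma layer_cake_symp mu p y b : (2 < p)%R ->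
  sym_avg mu b (fun z => (apow p z)%:E) y = (apow p y)%:E +
  \int[leb]_(s in `[0%R, +oo[) ((dsymp p y b s)%:E * abs_tail mu s).
Proof.
move=> p2; rewrite sym_avg_apow.
rewrite (_ : \int[mu]_t (symp p y b t)%:E = \int[mu]_t (symp p y b `|t|%R)%:E); last first.
  by apply: eq_integral => t _; rewrite symp_norm.
have p1 : (1 < p)%R by lra.
rewrite (layer_cake mu (fun x => is_derive_symp y b x p1)) ?symp0//.
- exact: continuous_dsymp.
- by move=> x; exact: dsymp_ge0.
- exact: apow_ge0.
Qed.

Lemma layer_cake_sqr mu : \int[mu]_x (x ^+ 2)%:E =
  \int[leb]_(s in `[0%R, +oo[) ((2 * s)%:E * abs_tail mu s).
Proof.
rewrite (_ : \int[mu]_x (x ^+ 2)%:E = \int[mu]_x (`|x| ^+ 2)%:E); last first.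
  by apply: eq_integral => t _; rewrite real_normK// num_real.
have dsqr (x : R) : is_derive x 1%R (fun x : R => x ^+ 2)%R (2 * x)%R.
  have := is_deriveX 2 (is_derive_id x (1%R : R)).
  by rewrite /GRing.scale/= mulr1 expr1.
rewrite (layer_cake mu dsqr) ?expr0n ?add0e//.
- by move=> x; apply: cvgM; [exact: cvg_cst|exact: cvg_id].
- by move=> x x0; rewrite mulr_ge0.
Qed.

(* If the tails cross once, the law whose mass is pushed outwards has the
   larger mean of t |-> |y + b t|^p, because dsymp(s) / s is monotone. *)
Lemma tail_crossing mu nu p y b c : (3 <= p)%R -> (0 <= c)%R ->
  (forall s, (0 < s < c)%R -> abs_tail nu s <= abs_tail mu s) ->
  (forall s, (c < s)%R -> abs_tail mu s <= abs_tail nu s) ->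
  \int[mu]_x (x ^+ 2)%:E <= \int[nu]_x (x ^+ 2)%:E ->
  \int[nu]_x (x ^+ 2)%:E < +oo ->
  sym_avg mu b (fun z => (apow p z)%:E) y <= sym_avg nu b (fun z => (apow p z)%:E) y.
Proof.
move=> p3 c0 lo hi m12 m2y; have p2 : (2 < p)%R by lra.
(* The line [2 * la * s] meets [dsymp] at [s = c], so by [dsymp_ratio] their difference has the sign
   of [s - c]. For [c = 0] division by zero gives [la = 0], which still works as [dsymp >= 0]. *)
pose la : R := (dsymp p y b c / (2 * c))%R.
have la0 : (0 <= la)%R.
  by rewrite /la divr_ge0 ?dsymp_ge0// mulr_ge0.
have lac : (0 < c)%R -> (2 * la * c = dsymp p y b c)%R.
  by move=> {}c0; rewrite /la; field; rewrite gt_eqF.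
have below s : (0 < s < c)%R -> (dsymp p y b s <= 2 * la * s)%R.
  move=> /andP[s0 sc]; have c1 : (0 < c)%R by rewrite (lt_trans s0).
  have := dsymp_ratio y b p3 s0 (ltW sc); rewrite -lac//.
  by rewrite [(2 * la * c * s)%R]mulrAC ler_pM2r.
have above s : (c < s)%R -> (2 * la * s <= dsymp p y b s)%R.
  move: c0; rewrite le_eqVlt => /predU1P[c_eq|c1] cs.
    have s0 : (0 <= s)%R by rewrite c_eq ltW.
    by rewrite /la -c_eq mulr0 invr0 !mulr0 mul0r dsymp_ge0.
  have := dsymp_ratio y b p3 c1 (ltW cs); rewrite -lac//.
  by rewrite [(2 * la * c * s)%R]mulrAC ler_pM2r.
rewrite !layer_cake_symp//; apply: leeD => //.
have mD : measurable (`[0%R, +oo[%classic : set (measurableTypeR R)) by exact: measurable_itv.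
have md : measurable_fun (`[0%R, +oo[%classic : set (measurableTypeR R)) (fun s => (dsymp p y b s)%:E).
  apply/measurable_EFinP; apply: measurable_funTS; apply: measurable_onR.
  by apply: continuous_measurable_fun; exact: continuous_dsymp.
have ml : measurable_fun (`[0%R, +oo[%classic : set (measurableTypeR R)) (fun s : measurableTypeR R => (2 * la * s)%:E).
  apply/measurable_EFinP; apply: measurable_funTS.
  by apply: (@measurable_onR R _ _ (fun s : R => 2 * la * s)%R); exact: measurable_funM.
have mt m := measurable_funTS (D := (`[0%R, +oo[%classic : set (measurableTypeR R))) (measurable_abs_tail m).
have d0 s : `[0%R, +oo[%classic s -> 0 <= (dsymp p y b s)%:E.
  by rewrite /= in_itv/= andbT => s0; rewrite lee_fin dsymp_ge0.
have l0 s : `[0%R, +oo[%classic s -> 0 <= (2 * la * s)%:E.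
  by rewrite /= in_itv/= andbT => s0; rewrite lee_fin mulr_ge0// mulr_ge0.
have t0 m s : 0 <= abs_tail m s by exact: measure_ge0.
have mom m : \int[leb]_(s in `[0%R, +oo[) ((2 * la * s)%:E * abs_tail m s) =
    la%:E * \int[m]_x (x ^+ 2)%:E.
  rewrite layer_cake_sqr -ge0_integralZl//.
  - by apply: eq_integral => s _; rewrite muleA -EFinM; congr (_%:E * _); ring.
  - apply: emeasurable_funM => //; apply/measurable_EFinP; apply: measurable_funTS.
    by apply: (@measurable_onR R _ _ (fun s : R => 2 * s)%R); exact: measurable_funM.
  - move=> s; rewrite /= in_itv/= andbT => s0.
    by rewrite mule_ge0// lee_fin mulr_ge0.
(* Integrated form of [(dsymp s - 2 * la * s) * (nu-tail - mu-tail) >= 0]. The negative terms are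
   moved across so that possibly infinite integrals are never subtracted. *)
have main : \int[leb]_(s in `[0%R, +oo[) ((dsymp p y b s)%:E * abs_tail mu s) +
      la%:E * \int[nu]_x (x ^+ 2)%:E <=
    \int[leb]_(s in `[0%R, +oo[) ((dsymp p y b s)%:E * abs_tail nu s) +
      la%:E * \int[mu]_x (x ^+ 2)%:E.
  rewrite -!mom -!ge0_integralD//; last 8 first.
  - by move=> s Ds; rewrite mule_ge0 ?d0.
  - exact: emeasurable_funM.
  - by move=> s Ds; rewrite mule_ge0 ?l0.
  - exact: emeasurable_funM.
  - by move=> s Ds; rewrite mule_ge0 ?d0.
  - exact: emeasurable_funM.
  - by move=> s Ds; rewrite mule_ge0 ?l0.
  - exact: emeasurable_funM.
  apply: ge0_le_integral => //.
  - by move=> s Ds; rewrite adde_ge0// mule_ge0 ?d0 ?l0.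
  - by apply: emeasurable_funD; exact: emeasurable_funM.
  - by apply: emeasurable_funD; exact: emeasurable_funM.
  - move=> s; rewrite /= in_itv/= andbT => s0.
    have fm := fin_num_abs_tail mu s; have fn := fin_num_abs_tail nu s.
    rewrite -(fineK fm) -(fineK fn) -!EFinM -!EFinD lee_fin.
    have lo' := lo s; have hi' := hi s.
    rewrite -(fineK fm) -(fineK fn) !lee_fin in lo' hi'.
    move: (fine (abs_tail mu s)) (fine (abs_tail nu s)) lo' hi' => t1 t2 lo' hi'.
    rewrite -subr_ge0.
    have -> : (dsymp p y b s * t2 + 2 * la * s * t1 - (dsymp p y b s * t1 + 2 * la * s * t2) =
      (dsymp p y b s - 2 * la * s) * (t2 - t1))%R by ring.
    move: s0; rewrite le_eqVlt => /predU1P[<-|s0].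
      by rewrite dsymp0 mulr0 subrr mul0r.
    have [sc|cs|sc] := ltgtP s c.
    + by rewrite mulr_le0// subr_le0; [apply: below; rewrite s0|apply: lo'; rewrite s0].
    + by rewrite mulr_ge0// subr_ge0; [exact: above|exact: hi'].
    + by rewrite sc lac -?sc// subrr mul0r.
(* Only the second moment is known to be finite, so it is the only term that gets cancelled. *)
have fm2 : la%:E * \int[nu]_x (x ^+ 2)%:E \is a fin_num.
  rewrite fin_numM// ge0_fin_numE//.
  by apply: integral_ge0 => x _; rewrite lee_fin sqr_ge0.
rewrite -(leeD2rE _ _ fm2); apply: (le_trans main).
by rewrite leeD2l// lee_wpmul2l// lee_fin.
Qed.

End tail_comparison.

(** * The two extremal laws: unit sign and exponential *)

Section exponential_comparison.
Context {R : realType}.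
Local Open Scope ereal_scope.
Local Notation leb := (@lebesgue_measure R).

Lemma abs_tail_dirac1 (s : R) : abs_tail (\d_(1%R : R)) s = (s <= 1)%R%:R%:E.
Proof.
transitivity (\d_(1%R : R) [set x : R | (s <= `|x|)%R] : \bar R) => //.
rewrite diracE; congr (_%:R%:E); congr nat_of_bool.
by apply/idP/idP; rewrite inE/= normr1.
Qed.

(** Under [sym_avg] the point mass at 1 is a random sign. Its tail is 1 up to 1 and 0 beyond, so
    every other tail crosses it at 1. *)
Lemma dirac_sym_avg_le (mu : probability R R) (p y b : R) : (3 <= p)%R ->
  \int[mu]_x (x ^+ 2)%:E = 1 ->
  sym_avg (\d_(1%R : R)) b (fun z => (apow p z)%:E) y <=
  sym_avg mu b (fun z => (apow p z)%:E) y.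
Proof.
move=> p3 m2; apply: (@tail_crossing _ _ _ _ _ _ 1%R) => //.
- move=> s /andP[s0 s1]; rewrite abs_tail_dirac1 (ltW s1).
  exact: (probability_le1 mu (measurable_abs_ge s)).
- move=> s s1; rewrite abs_tail_dirac1 [(s <= 1)%R]leNgt s1/=.
  exact: measure_ge0.
- rewrite m2 integral_dirac//; first by rewrite diracT expr1n mul1e.
  by apply/measurable_EFinP; exact: measurable_funX.
- by rewrite m2 ltry.
Qed.

(** As [sym_avg] supplies the sign, this one-sided law plays the role of a Laplace variable of
    variance [2 / t^2]. *)
Definition exponential_law (t : R) (t0 : (0 < t)%R) : probability R R.
Proof. refine (borel_law (exponential_prob t)); exact: t0. Defined.

Lemma integral_itvcy_FTC (F f : R -> R) (a l : R) :
  (forall x : R, is_derive x 1%R F (f x)) -> continuous f ->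
  (forall x, a <= x -> 0 <= f x)%R -> F x @[x --> +oo%R] --> l ->
  \int[leb]_(x in `[a, +oo[) (f x)%:E = (l - F a)%:E.
Proof.
move=> Ff cf f0 Fl; rewrite (@ge0_continuous_FTC2y _ f F a l)//.
- exact: continuous_subspaceT.
- suff cF : {for a, continuous F} by exact/cvg_at_right_filter/cF.
  apply/differentiable_continuous/derivable1_diffP.
  by have [] := Ff a.
- by move=> x _; rewrite derive1E; exact: derive_val.
Qed.

Lemma is_derive_expRN (t x : R) :
  is_derive x 1%R (fun x => expR (- t * x))%R (- t * expR (- t * x))%R.
Proof.
have h := is_derive_affine 0%R (- t)%R x; rewrite mulrC.
have E : (fun u => 0 + - t * u)%R = (fun u : R => - t * u)%R.
  by apply/funext => u; rewrite add0r.
rewrite E in h.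
exact: (@is_derive1_comp R expR (fun u => - t * u)%R x (expR (- t * x)) (- t)%R).
Qed.

Lemma continuous_expRN (t : R) : continuous (fun x => expR (- t * x))%R.
Proof.
move=> x; apply/differentiable_continuous/derivable1_diffP.
by have [] := is_derive_expRN t x.
Qed.

Lemma cvg_expRNy (t : R) : (0 < t)%R -> expR (- t * x)%R @[x --> +oo%R] --> (0 : R)%R.
Proof.
move=> t0; rewrite (_ : (fun x => _) = (fun z => expR (- z)) \o (fun z => t * z))%R.
  by apply: (@cvg_comp _ _ _ _ _ _ (pinfty_nbhs R)); [exact: gt0_cvgMry|exact: cvgr_expR].
by apply: eq_fun => x; rewrite mulNr.
Qed.

Lemma abs_tail_exponential (t : R) (t0 : (0 < t)%R) s : (0 <= s)%R ->
  abs_tail (exponential_law t0) s = (expR (- t * s))%:E.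
Proof.
move=> s0.
transitivity (\int[leb]_(x in `[s, +oo[) (t * expR (- t * x))%:E).
  transitivity (\int[leb]_(x in [set x : R | (s <= `|x|)%R]) (exponential_pdf t x)%:E) => //.
  rewrite [LHS]integral_mkcond [RHS]integral_mkcond; apply: eq_integral => x _.
  have E : (x \in [set x : measurableTypeR R | (s <= `|x : R|)%R]) = (s <= `|x : R|)%R.
    by apply/idP/idP; rewrite inE.
  rewrite !patchE E mem_setE in_itv/= andbT.
  have [x0|x0] := leP 0%R (x : R).
    by rewrite ger0_norm//; case: ifPn => // sx; rewrite exponential_pdfE.
  rewrite [(s <= x)%R]leNgt (lt_le_trans x0 s0)/= lt0_exponential_pdf//.
  by case: ifP.
have dF (x : R) : is_derive x 1%R (fun x => - expR (- t * x))%R (t * expR (- t * x))%R.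
  by have := is_deriveN (is_derive_expRN t x); rewrite mulNr opprK.
rewrite (@integral_itvcy_FTC _ _ _ 0%R dF).
- by rewrite sub0r opprK.
- by move=> x; apply: cvgM; [exact: cvg_cst|exact: continuous_expRN].
- by move=> x _; rewrite mulr_ge0 ?expR_ge0// ltW.
- by rewrite -[X in _ --> X]oppr0; apply: cvgN; exact: cvg_expRNy.
Qed.

Lemma ge0_integral_exponential (t : R) (t0 : (0 < t)%R) (f : R -> R) :
  (forall x, 0 <= f x)%R -> measurable_fun [set: R] f ->
  \int[exponential_law t0]_x (f x)%:E =
  \int[leb]_(x in `[0%R, +oo[) (f x * (t * expR (- t * x)))%:E.
Proof.
move=> f0 mf; rewrite ge0_integral_borel_law//; last exact/measurable_EFinP.
rewrite (@ge0_integral_density _ _ (exponential_pdf t))//.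
- rewrite [RHS]integral_mkcond; apply: eq_integral => x _.
  rewrite patchE mem_setE in_itv/= andbT; have [x0|x0] := leP 0%R x.
    by rewrite exponential_pdfE.
  by rewrite lt0_exponential_pdf// mulr0.
- by move=> x; rewrite exponential_pdf_ge0// ltW.
- exact: measurable_exponential_pdf.
Qed.

End exponential_comparison.

Section exponential_moments.
Context {R : realType}.
Local Open Scope ereal_scope.
Local Notation leb := (@lebesgue_measure R).

Lemma cvg_bounded_expRNy (t K : R) (f : R -> R) : (0 < t)%R ->
  (forall x, 0 <= x -> `|f x| <= K)%R -> (f x * expR (- t * x))%R @[x --> +oo%R] --> (0 : R)%R.
Proof.
move=> t0 fK; apply: norm_cvg0.
have h : (K * expR (- t * x))%R @[x --> +oo%R] --> (0 : R)%R.
  by rewrite -[X in _ --> X](mulr0 K); apply: cvgM; [exact: cvg_cst|exact: cvg_expRNy].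
apply: squeeze_cvgr (cvg_cst 0%R) h; near=> x.
rewrite normr_ge0/= normrM (ger0_norm (expR_ge0 _)) ler_wpM2r ?expR_ge0//.
by apply: fK; near: x; exact: nbhs_pinfty_ge.
Unshelve. all: by end_near. Qed.

Lemma cvg_id_expRNy (t : R) : (0 < t)%R ->
  (x * expR (- t * x))%R @[x --> +oo%R] --> (0 : R)%R.
Proof.
move=> t0; have t20 : (0 < t / 2)%R by rewrite divr_gt0.
(* Half of the exponential absorbs the factor [x]: [1 + z <= e^z] at [z = t x / 2] yields the bound
   [2 / t]. *)
have := @cvg_bounded_expRNy (t / 2) (2 / t)%R (fun x => x * expR (- (t / 2) * x))%R t20.
rewrite (_ : (fun x => _ * _ * _)%R = (fun x => x * expR (- t * x))%R); last first.
  by apply/funext => x; rewrite -mulrA -expRD; congr (_ * expR _)%R; field.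
apply => x x0; rewrite ger0_norm ?mulr_ge0 ?expR_ge0//.
rewrite mulNr expRN ler_pdivrMr ?expR_gt0//.
apply: (@le_trans _ _ (2 / t * (1 + t / 2 * x))%R).
  rewrite mulrDr mulr1 mulrA (_ : 2 / t * (t / 2) = 1)%R ?mul1r; last first.
    by field; rewrite gt_eqF.
  by rewrite lerDr divr_ge0// ltW.
by rewrite ler_wpM2l ?divr_ge0 ?(ltW t0)// expR_ge1Dx.
Qed.

Lemma exponential_sqr (t : R) (t0 : (0 < t)%R) :
  \int[exponential_law t0]_x (x ^+ 2)%:E = (2 / t ^+ 2)%:E.
Proof.
rewrite layer_cake_sqr.
have tn0 : t != 0%R by rewrite gt_eqF.
transitivity (\int[leb]_(s in `[0%R, +oo[) (2 * s * expR (- t * s))%:E).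
  apply: eq_integral => s; rewrite mem_setE in_itv andbT => s0.
  by rewrite (abs_tail_exponential t0 s0) EFinM.
pose F (s : R) : R := (- (2 / t) * (s * expR (- t * s)) + (- (2 / t ^+ 2)) * expR (- t * s))%R.
have dF (x : R) : is_derive x 1%R F (2 * x * expR (- t * x))%R.
  have d1 := is_derive_expRN t x.
  have d2 := is_deriveM (is_derive_id x (1%R : R)) d1.
  have := is_deriveD (is_deriveZ (- (2 / t))%R d2) (is_deriveZ (- (2 / t ^+ 2))%R d1).
  rewrite /GRing.scale/=; set d := (X in is_derive _ _ _ X).
  have -> // : d = (2 * x * expR (- t * x))%R.
  by rewrite /d; field.
rewrite (@integral_itvcy_FTC _ _ _ _ 0%R dF).
- by rewrite /F !mul0r mulr0 add0r mulr0 expR0 mulr1 sub0r opprK.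
- move=> x; apply: cvgM; last exact: continuous_expRN.
  by apply: cvgM; [exact: cvg_cst|exact: cvg_id].
- by move=> x x0; rewrite !mulr_ge0// expR_ge0.
- have : F x @[x --> +oo%R] --> (- (2 / t) * 0 + (- (2 / t ^+ 2)) * 0)%R.
    apply: cvgD; (apply: cvgM; first exact: cvg_cst).
      exact: cvg_id_expRNy.
    exact: cvg_expRNy.
  by rewrite !mulr0 addr0.
Qed.

Lemma measurable_cosM (c : R) : measurable_fun [set: R] (fun x => cos (c * x))%R.
Proof.
apply: continuous_measurable_fun => x.
apply: (@continuous_comp _ _ _ (fun x => c * x)%R cos).
  by apply: cvgM; [exact: cvg_cst|exact: cvg_id].
exact: continuous_cos.
Qed.

Lemma integrable_cosM (mu : probability R R) (c : R) :
  mu.-integrable [set: R] (fun x => (cos (c * x))%:E).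
Proof.
apply: (@le_integrable _ _ _ mu setT measurableT _ (EFin \o cst 1%R)).
- by apply/measurable_EFinP; exact: measurable_cosM.
- by move=> x _ /=; rewrite lee_fin normr1 ler_norml cos_geN1 cos_le1.
- by apply: finite_measure_integrable_cst.
Qed.

Lemma exponential_cos (t c : R) (t0 : (0 < t)%R) :
  \int[exponential_law t0]_x (cos (c * x))%:E = (t ^+ 2 / (t ^+ 2 + c ^+ 2))%:E.
Proof.
set mu := exponential_law t0.
have i1 : mu.-integrable [set: R] (cst 1 : R -> \bar R) by exact: finite_measure_integrable_cst.
have ic := integrable_cosM mu c.
have tc : (t ^+ 2 + c ^+ 2)%R != 0%R.
  by rewrite gt_eqF// ltr_pwDl ?sqr_ge0// exprn_gt0.
(* Adding 1 makes the integrand [1 + cos] nonnegative, as the fundamental theorem on the half-line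
   requires. *)
suff : 1 + \int[mu]_x (cos (c * x))%:E = 1 + (t ^+ 2 / (t ^+ 2 + c ^+ 2))%:E.
  by move/(congr1 (fun z => z - 1)); rewrite [1 + _]addeC [1 + _ in RHS]addeC !addeK.
have {1}-> : 1 = \int[mu]_x ((cst 1 : R -> \bar R) x).
  by rewrite integral_cst// -[LHS]mule1 -(probability_setT mu).
rewrite -integralD//.
transitivity (\int[mu]_x (1 + cos (c * x))%:E) => //.
rewrite ge0_integral_exponential; last 2 first.
- by move=> x; rewrite -lerBlDl sub0r cos_geN1.
- by apply: measurable_funD => //; exact: measurable_cosM.
pose F (x : R) : R := (- expR (- t * x) + t / (t ^+ 2 + c ^+ 2) *
   ((c * sin (c * x) - t * cos (c * x)) * expR (- t * x)))%R.
have dF (x : R) : is_derive x 1%R F ((1 + cos (c * x)) * (t * expR (- t * x)))%R.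
  have d1 := is_derive_expRN t x.
  have dc : is_derive x 1%R (fun x => c * x)%R c.
    have := is_derive_affine 0%R c x.
    by rewrite (_ : (fun u => 0 + c * u)%R = (fun u : R => c * u)%R)//; apply/funext => u; rewrite add0r.
  have d2 : is_derive x 1%R (fun x => sin (c * x))%R (cos (c * x) * c)%R.
    exact: (@is_derive1_comp R sin (fun x => c * x)%R x _ c).
  have d3 : is_derive x 1%R (fun x => cos (c * x))%R (- sin (c * x) * c)%R.
    exact: (@is_derive1_comp R cos (fun x => c * x)%R x _ c).
  have d4 := is_deriveM (is_deriveB (is_deriveZ c d2) (is_deriveZ t d3)) d1.
  have := is_deriveD (is_deriveN d1) (is_deriveZ (t / (t ^+ 2 + c ^+ 2))%R d4).
  rewrite /GRing.scale/=; set d := (X in is_derive _ _ _ X).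
  have -> // : d = ((1 + cos (c * x)) * (t * expR (- t * x)))%R.
  rewrite /d /GRing.scale/= (_ : (c \*: _ - _) x = (c * sin (c * x) - t * cos (c * x)))%R//.
  by field.
rewrite (@integral_itvcy_FTC _ _ _ _ 0%R dF).
- rewrite /F !mulr0 sin0 cos0 expR0 -EFinD; congr EFin; field.
  by [].
- move=> x; apply: cvgM.
    apply: cvgD; first exact: cvg_cst.
    apply: (@continuous_comp _ _ _ (fun x => c * x)%R cos).
      by apply: cvgM; [exact: cvg_cst|exact: cvg_id].
    exact: continuous_cos.
  by apply: cvgM; [exact: cvg_cst|exact: continuous_expRN].
- move=> x x0; apply: mulr_ge0.
    by rewrite -lerBlDl sub0r cos_geN1.
  by rewrite mulr_ge0 ?expR_ge0// ltW.
- have : F x @[x --> +oo%R] --> (- 0 + t / (t ^+ 2 + c ^+ 2) * 0)%R.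
    apply: cvgD; first by apply: cvgN; exact: cvg_expRNy.
    apply: cvgM; first exact: cvg_cst.
    apply: (@cvg_bounded_expRNy t (`|c| + `|t|)%R) => // x x0.
    rewrite (le_trans (ler_normB _ _))// lerD// normrM ler_piMr//.
      by rewrite ler_norml sin_geN1 sin_le1.
    by rewrite ler_norml cos_geN1 cos_le1.
  by rewrite mulr0 oppr0 addr0.
Qed.

End exponential_moments.

(** * Log-concave tails against an exponential tail *)

Section log_concave_comparison.
Context d (T : measurableType d) (R : realType) (P : probability T R).
Local Open Scope ereal_scope.
Local Notation leb := (@lebesgue_measure R).

(** The log-tail is concave and 0 at the origin; lying above the line [- th * t] at one point, it
    lies above that line all the way back to 0. *)
Lemma log_concave_tail_scale (X : {RV P >-> R}) (th s t : R) :
  log_concave_tails X -> (0 <= s <= t)%R ->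
  (expR (- th * t))%:E <= abs_tail (distribution P X) t ->
  (expR (- th * s))%:E <= abs_tail (distribution P X) s.
Proof.
move=> lcX /andP[s0 st] ht.
move: s0; rewrite le_eqVlt => /predU1P[<-|s0].
  rewrite mulr0 expR0 /abs_tail.
  have -> : [set x : R | (0 <= `|x|)%R] = setT by apply/seteqP; split => x //= _.
  by rewrite -(probability_setT (distribution P X)).
have t0 : (0 < t)%R by rewrite (lt_le_trans s0).
have l01 : (0 <= s / t <= 1)%R by rewrite divr_ge0 ?(ltW s0) ?(ltW t0)//= ler_pdivrMr// mul1r.
have := lcX t 0%R (s / t)%R (ltW t0) (lexx _) l01.
rewrite mulr0 addr0 divfK ?gt_eqF//.
have -> : log_tail X 0 = 0.
  rewrite /log_tail; have -> : [set w | (0 <= `|X w|)%R] = setT by apply/seteqP; split => x //= _.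
  by rewrite probability_setT lne1.
rewrite mule0 adde0.
have tailE u : abs_tail (distribution P X) u = P [set w | (u <= `|X w|)%R] by [].
rewrite /log_tail -!tailE.
have ft := fin_num_abs_tail (distribution P X) t.
have fs := fin_num_abs_tail (distribution P X) s.
have ps : 0 <= abs_tail (distribution P X) s by exact: measure_ge0.
move: ht ps; rewrite -(fineK ft) -(fineK fs).
move: (fine (abs_tail _ t)) (fine (abs_tail _ s)) => tt ts; rewrite !lee_fin => ht ps.
have tt0 : (0 < tt)%R by rewrite (lt_le_trans _ ht)// expR_gt0.
(* A zero tail at [s] would have logarithm [-oo], yet concavity bounds it below by a finite
   number. *)
move: ps; rewrite le_eqVlt => /predU1P[<-|ts0].
  by rewrite lne_EFin// (@le0_lneNy _ 0%:E)// -EFinM leeNy_eq.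
rewrite !lne_EFin// -EFinM lee_fin => h.
rewrite -[ts]lnK ?posrE// ler_expR (le_trans _ h)//.
have h2 : (- th * t <= ln tt)%R by rewrite -ler_expR lnK.
have -> : (- th * s = s / t * (- th * t))%R by field; rewrite gt_eqF.
by rewrite ler_pM2l// divr_gt0.
Qed.

(** By [log_concave_tail_scale] the set [D] where the tail of [X] dominates [exp (- th * s)] is an
    interval starting at 0, so the tails cross once, at its supremum. *)
Lemma log_concave_sym_avg_le (X : {RV P >-> R}) (th p y b : R) (th0 : (0 < th)%R) :
  (3 <= p)%R -> (th ^+ 2 < 2)%R -> log_concave_tails X ->
  \int[distribution P X]_x (x ^+ 2)%:E = 1 ->
  sym_avg (distribution P X) b (fun z => (apow p z)%:E) y <=
  sym_avg (exponential_law th0) b (fun z => (apow p z)%:E) y.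
Proof.
move=> p3 th2 lcX m2.
set mu := distribution P X.
have m2e : 1 < \int[exponential_law th0]_x (x ^+ 2)%:E.
  by rewrite exponential_sqr lte_fin ltr_pdivlMr ?mul1r// exprn_gt0.
pose D := [set s : R | (0 <= s)%R /\ (expR (- th * s))%:E <= abs_tail mu s].
have D0 : D 0%R.
  split => //; rewrite mulr0 expR0 /abs_tail.
  have -> : [set x : R | (0 <= `|x|)%R] = setT by apply/seteqP; split => x //= _.
  by rewrite -(probability_setT mu).
(* If [D] were the whole half-line, the second moment of [X] would be at least [2 / th^2 > 1]. This
   is where [th^2 < 2] has to be strict. *)
have [allD|/existsNP[t1 /not_implyP[t10 t1D]]] := pselect (forall s, (0 <= s)%R -> D s).
  exfalso; move: m2e; rewrite -m2 !layer_cake_sqr; apply/negP; rewrite -leNgt.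
  have mD : measurable (`[0%R, +oo[%classic : set (measurableTypeR R)) by exact: measurable_itv.
  apply: ge0_le_integral => //.
  - move=> s; rewrite /= in_itv/= andbT => s0.
    by rewrite mule_ge0 ?lee_fin ?mulr_ge0//; exact: measure_ge0.
  - apply: emeasurable_funM; last exact: measurable_funTS (measurable_abs_tail _).
    apply/measurable_EFinP; apply: measurable_funTS.
    by apply: (@measurable_onR R _ _ (fun s : R => 2 * s)%R); exact: measurable_funM.
  - apply: emeasurable_funM; last exact: measurable_funTS (measurable_abs_tail _).
    apply/measurable_EFinP; apply: measurable_funTS.
    by apply: (@measurable_onR R _ _ (fun s : R => 2 * s)%R); exact: measurable_funM.
  - move=> s Ds; have s0 : (0 <= s)%R by move: Ds; rewrite /= in_itv/= andbT.
    rewrite (abs_tail_exponential th0 s0) lee_wpmul2l ?lee_fin ?mulr_ge0//.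
    by have [] := allD s s0.
have ubD s : D s -> (s <= t1)%R.
  move=> [s0 Ds]; rewrite leNgt; apply/negP => t1s; apply: t1D; split => //.
  by apply: (log_concave_tail_scale lcX _ Ds); rewrite t10 ltW.
have supD : has_sup D by split; [exists 0%R|exists t1 => s; exact: ubD].
apply: (@tail_crossing _ _ _ _ _ _ (sup D)) => //.
- exact: sup_upper_bound.
- move=> s /andP[s0 sc]; have e0 : (0 < sup D - s)%R by rewrite subr_gt0.
  have [u [u0 Du] su] := sup_adherent e0 supD.
  rewrite subKr in su; rewrite (abs_tail_exponential th0 (ltW s0)).
  by apply: (log_concave_tail_scale lcX _ Du); rewrite (ltW s0) (ltW su).
- move=> s cs; have s0 : (0 <= s)%R.
    by rewrite (le_trans _ (ltW cs))//; exact: sup_upper_bound.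
  rewrite (abs_tail_exponential th0 s0) leNgt; apply/negP => h.
  have Ds : D s by split => //; exact: ltW.
  by have := sup_upper_bound supD Ds; rewrite leNgt cs.
- by rewrite m2 ltW.
- by rewrite exponential_sqr ltry.
Qed.

End log_concave_comparison.

(** * Comparison of laws through their characteristic functions *)

Section elementary_inequalities.
Context {R : realType}.
Implicit Types x y z : R.

(** The Taylor bounds for [sin], [cos] and [expR] follow from this one order at a time: the
    derivative of each difference is the preceding bound. *)
Lemma ge0_derive_ge (f df : R -> R) : (forall x : R, is_derive x 1 f (df x)) ->
  (forall x, 0 <= x -> 0 <= df x) -> forall x, 0 <= x -> f 0 <= f x.
Proof.
move=> fdf df0 x; rewrite le_eqVlt => /predU1P[<-//|x0].
have [c /andP[c0 cx] E] := MVT_line fdf x0.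
by rewrite -subr_ge0 E mulr_ge0 ?df0 ?subr_ge0// ltW.
Qed.

Lemma is_derive_monomial (n : nat) (k x : R) :
  is_derive x 1 (fun x => k * x ^+ n.+1) (k * n.+1%:R * x ^+ n).
Proof.
have := is_deriveZ k (is_deriveX n.+1 (is_derive_id x (1 : R))).
rewrite /GRing.scale/= mulr1 mulrA.
by rewrite exprfctE.
Qed.

Lemma sin_le_id x : 0 <= x -> sin x <= x.
Proof.
move=> x0; rewrite -subr_ge0.
have D y : is_derive y (1 : R) (fun x => x - sin x) (1 - cos y).
  exact: (is_deriveB (is_derive_id y (1 : R)) (is_derive_sin y)).
have := ge0_derive_ge D _ x0; rewrite sin0 subrr; apply=> y _.
by rewrite subr_ge0 cos_le1.
Qed.

Lemma cos_ge1B x : 1 - x ^+ 2 / 2 <= cos x.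
Proof.
wlog x0 : x / 0 <= x.
  move=> h; have [/h//|/ltW x0] := leP 0 x.
  by rewrite -cosN -sqrrN h// oppr_ge0.
have D y : is_derive y (1 : R) (fun x => cos x + 2^-1 * x ^+ 2) (- sin y + y).
  have := is_deriveD (is_derive_cos y) (is_derive_monomial 1 2^-1 y).
  by rewrite mulVf// mul1r.
have := ge0_derive_ge D _ x0; rewrite cos0 expr0n mulr0 addr0 => h.
suff : 1 <= cos x + 2^-1 * x ^+ 2 by lra.
apply: h => y y0; by rewrite addrC subr_ge0 sin_le_id.
Qed.

Lemma sin_ge x : 0 <= x -> x - x ^+ 3 / 6 <= sin x.
Proof.
move=> x0.
have D y : is_derive y (1 : R) (fun x => sin x - x + 6^-1 * x ^+ 3)
    (cos y - 1 + 2^-1 * y ^+ 2).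
  have := is_deriveD (is_deriveB (is_derive_sin y) (is_derive_id y (1 : R)))
    (is_derive_monomial 2 6^-1 y).
  by rewrite (_ : 6^-1 * 3 = 2^-1)//; field.
have := ge0_derive_ge D _ x0; rewrite sin0 subrr expr0n mulr0 addr0 => h.
suff : 0 <= sin x - x + 6^-1 * x ^+ 3 by lra.
by apply: h => y _; have := cos_ge1B y; lra.
Qed.

Lemma cos_le1BD x : cos x <= 1 - x ^+ 2 / 2 + x ^+ 4 / 24.
Proof.
wlog x0 : x / 0 <= x.
  move=> h; have [/h//|/ltW x0] := leP 0 x.
  rewrite -cosN -(sqrrN x) (_ : x ^+ 4 = (- x) ^+ 4); last by ring.
  by rewrite h// oppr_ge0.
have D y : is_derive y (1 : R) (fun x => - cos x + (- 2^-1) * x ^+ 2 + 24^-1 * x ^+ 4)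
    (sin y - y + 6^-1 * y ^+ 3).
  have := is_deriveD (is_deriveD (is_deriveN (is_derive_cos y))
    (is_derive_monomial 1 (- 2^-1) y)) (is_derive_monomial 3 (24^-1) y).
  set d := (X in is_derive _ _ _ X).
  by rewrite (_ : d = sin y - y + 6^-1 * y ^+ 3)//; rewrite /d; field.
have := ge0_derive_ge D _ x0.
rewrite cos0 !expr0n !mulr0 !addr0 => h.
suff : - 1 <= - cos x + (- 2^-1) * x ^+ 2 + 24^-1 * x ^+ 4 by lra.
by apply: h => y y0; have := sin_ge y0; lra.
Qed.

Lemma is_derive_expRNid x : is_derive x 1 (fun x => expR (- x)) (- expR (- x)).
Proof.
have k : is_derive x 1 (fun z : R => - z) (-1) by apply: is_deriveNid.
by have := is_derive1_comp (is_derive_expR (- x)) k; rewrite mulrN1.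
Qed.

Lemma expRN_le x : 0 <= x -> expR (- x) <= 1 - x + x ^+ 2 / 2.
Proof.
move=> x0.
have D y : is_derive y (1 : R) (fun x => - expR (- x) + (- 1) * x ^+ 1 + 2^-1 * x ^+ 2)
    (expR (- y) - 1 + y).
  have := is_deriveD (is_deriveD (is_deriveN (is_derive_expRNid y))
    (is_derive_monomial 0 (- 1) y)) (is_derive_monomial 1 2^-1 y).
  set d := (X in is_derive _ _ _ X).
  by rewrite (_ : d = expR (- y) - 1 + y)//; rewrite /d; field.
have := ge0_derive_ge D _ x0.
rewrite oppr0 expR0 !expr0n !mulr0 !addr0 expr1 => h.
suff : - 1 <= - expR (- x) + -1 * x + 2^-1 * x ^+ 2 by lra.
by apply: h => y y0; have := expR_ge1Dx (- y); lra.
Qed.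

Lemma expRN_ge x : 0 <= x -> 1 - x + x ^+ 2 / 2 - x ^+ 3 / 6 <= expR (- x).
Proof.
move=> x0.
have D y : is_derive y (1 : R)
    (fun x => expR (- x) + 1 * x ^+ 1 + (- 2^-1) * x ^+ 2 + 6^-1 * x ^+ 3)
    (- expR (- y) + 1 - y + y ^+ 2 / 2).
  have := is_deriveD (is_deriveD (is_deriveD (is_derive_expRNid y)
    (is_derive_monomial 0 1 y)) (is_derive_monomial 1 (- 2^-1) y)) (is_derive_monomial 2 6^-1 y).
  set d := (X in is_derive _ _ _ X).
  by rewrite (_ : d = - expR (- y) + 1 - y + y ^+ 2 / 2)//; rewrite /d; field.
have := ge0_derive_ge D _ x0.
rewrite oppr0 expR0 !expr0n !mulr0 !addr0 expr1 => h.
suff : 1 <= expR (- x) + 1 * x + (- 2^-1) * x ^+ 2 + 6^-1 * x ^+ 3 by lra.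
by apply: h => y y0; have := expRN_le y0; lra.
Qed.

(** The two Taylor polynomials differ by [x^4 (4 - x^2) / 48], whence the range [x <= 2]. *)
Lemma cos_le_expR x : 0 <= x <= 2 -> cos x <= expR (- (x ^+ 2 / 2)).
Proof.
move=> /andP[x0 x2]; apply: le_trans (cos_le1BD x) _.
have y0 : 0 <= x ^+ 2 / 2 by rewrite divr_ge0 ?sqr_ge0.
apply: le_trans _ (expRN_ge y0).
have x4 : x ^+ 2 <= 4 by nra.
have : 0 <= x ^+ 4 * (4 - x ^+ 2).
  rewrite mulr_ge0 ?subr_ge0//.
  by rewrite (_ : x ^+ 4 = (x ^+ 2) ^+ 2) ?sqr_ge0//; ring.
lra.
Qed.

End elementary_inequalities.

(** * Powers as mixtures of cosines *)

Section fourier_representation.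
Context {R : realType}.
Local Open Scope ereal_scope.
Local Notation leb := (@lebesgue_measure R).
Implicit Types (mu : probability R R) (p y z b u v : R).

(** Functions [a + be z^2 + ga cos (t z)] are stable under symmetrized averages: the mixed terms
    cancel between the two signs, [z^2] gains the variance, and [cos (u + v) + cos (u - v) = 2 cos u
    cos v] produces the characteristic function as a factor. *)
Lemma sym_avg_trig mu b (m psi t a be ga : R) :
  \int[mu]_x (x ^+ 2)%:E = m%:E ->
  \int[mu]_x (cos (t * b * x))%:E = psi%:E -> forall y,
  sym_avg mu b (fun z => (a + be * z ^+ 2 + ga * cos (t * z))%:E) y =
  (a + be * (y ^+ 2 + m * b ^+ 2) + ga * psi * cos (t * y))%:E.
Proof.
move=> hm hpsi y.
have isq : mu.-integrable [set: R] (fun x => (x ^+ 2)%:E).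
  apply/integrableP; split.
    by apply/measurable_EFinP; exact: measurable_funX.
  rewrite (_ : \int[mu]_x `|_| = m%:E) ?ltry// -hm.
  by apply: eq_integral => x _ /=; rewrite ger0_norm// sqr_ge0.
have icos := integrable_cosM mu (t * b)%R.
have icst (k : R) : mu.-integrable [set: R] (cst k%:E) by exact: finite_measure_integrable_cst.
have i2 := integrableZl measurableT (be * b ^+ 2)%R isq.
have i3 := integrableZl measurableT (ga * cos (t * y))%R icos.
transitivity (\int[mu]_x ((cst (a + be * y ^+ 2)%:E x) +
    (((be * b ^+ 2)%:E * (x ^+ 2)%:E) + ((ga * cos (t * y))%:E * (cos (t * b * x))%:E)))).
  apply: eq_integral => x _; rewrite -EFinD -!EFinM -!EFinD; congr EFin.
  rewrite (_ : t * (y + b * x) = t * y + t * b * x)%R; last by ring.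
  rewrite (_ : t * (y - b * x) = t * y - t * b * x)%R; last by ring.
  by rewrite cosD cosB; field.
rewrite integralD//; last exact: integrableD.
rewrite integralD// !integralZl// hm hpsi integral_cst//.
transitivity ((a + be * y ^+ 2)%:E * 1 + ((be * b ^+ 2)%:E * m%:E + (ga * cos (t * y))%:E * psi%:E)).
  by congr (_ * _ + _); exact: probability_setT.
by rewrite mule1 -!EFinM -!EFinD; congr EFin; ring.
Qed.

Lemma iter_avg_trig {I : eqType} mu (b : I -> R) (s : seq I) (m t : R) (psi : R -> R)
    (a be ga : R) :
  \int[mu]_x (x ^+ 2)%:E = m%:E ->
  (forall c, \int[mu]_x (cos (c * x))%:E = (psi c)%:E) -> forall y,
  iter_avg (fun=> mu) b s (fun z => (a + be * z ^+ 2 + ga * cos (t * z))%:E) y =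
  (a + be * (y ^+ 2 + m * \sum_(i <- s) b i ^+ 2) +
    ga * \prod_(i <- s) psi (t * b i)%R * cos (t * y))%:E.
Proof.
move=> hm hpsi; elim: s a ga => [|i s IH] a ga y /=.
  by rewrite !big_nil mulr0 addr0 mulr1.
pose S := (\sum_(i <- s) b i ^+ 2)%R.
pose Q := (\prod_(i <- s) psi (t * b i))%R.
rewrite (eq_sym_avg _ _ (g := fun z => ((a + be * m * S) + be * z ^+ 2 + ga * Q * cos (t * z))%:E)).
  rewrite (sym_avg_trig _ _ _ hm (hpsi (t * b i)%R)) !big_cons -/S -/Q.
  by congr EFin; ring.
by move=> z; rewrite IH -/S -/Q; congr EFin; ring.
Qed.

(** The integrand [(cos (t z) - 1 + (t z)^2 / 2) t^(-p-1) dt] after the substitution [t = e^u]. On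
    the whole line, rescaling [z] becomes a translation of [u]. *)
Definition cos_kernel p z u : R :=
  ((cos (expR u * z) - 1 + (expR u * z) ^+ 2 / 2) * expR (- (p * u)))%R.

Lemma cos_kernel_ge0 p z u : (0 <= cos_kernel p z u)%R.
Proof.
rewrite /cos_kernel mulr_ge0 ?expR_ge0//.
by have := cos_ge1B (expR u * z); lra.
Qed.

Lemma measurable_cos_kernel p :
  measurable_fun [set: R * measurableTypeR R] (fun w => (cos_kernel p w.1 w.2)%:E).
Proof.
have m1 : measurable_fun [set: R * measurableTypeR R] (fun w => w.1 : R) by exact: measurable_fst.
have m2 : measurable_fun [set: R * measurableTypeR R] (fun w => w.2 : R).
  exact: (measurableT_comp measurable_idR measurable_snd).
have mz : measurable_fun [set: R * measurableTypeR R] (fun w => expR (w.2 : R) * w.1)%R.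
  by apply: measurable_funM => //; exact: measurableT_comp.
apply/measurable_EFinP; apply: measurable_funM.
  apply: measurable_funD.
    apply: measurable_funB => //.
    have mc : measurable_fun [set: R] (cos : R -> R).
      by apply: continuous_measurable_fun; exact: continuous_cos.
    exact: (measurableT_comp mc mz).
  by apply: measurable_funM => //; exact: measurable_funX.
apply: measurableT_comp => //; apply: measurableT_comp => //.
exact: measurable_funM.
Qed.

Lemma continuous_cos_kernel p z : continuous (cos_kernel p z).
Proof.
have c1 u : {for u, continuous (fun u => expR u * z)%R}.
  by apply: cvgM; [exact: continuous_expR|exact: cvg_cst].
move=> u; apply: cvgM.
  apply: cvgD.
    apply: cvgB; last exact: cvg_cst.
    by apply: (@continuous_comp _ _ _ (fun u => expR u * z)%R cos); [exact: c1|exact: continuous_cos].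
  by apply: cvgM; [apply: cvgM; exact: c1|exact: cvg_cst].
apply: (@continuous_comp _ _ _ (fun u => - (p * u))%R expR); last exact: continuous_expR.
by apply: cvgN; apply: cvgM; [exact: cvg_cst|exact: cvg_id].
Qed.

Definition cos_kernel_mass p : \bar R := \int[leb]_u (cos_kernel p 1 u)%:E.

(** Translating [u] by [ln |z|] turns the kernel at [z] into the kernel at 1 and brings out the
    factor [|z|^p]. *)
Lemma integral_cos_kernel p z : (0 < p)%R ->
  \int[leb]_u (cos_kernel p z u)%:E = (apow p z)%:E * cos_kernel_mass p.
Proof.
move=> p0; have [->|z0] := eqVneq z 0%R.
  rewrite /apow normr0 powR0 ?gt_eqF// mul0e.
  under eq_integral do rewrite /cos_kernel mulr0 cos0 subrr expr0n/= mul0r addr0 mul0r.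
  by rewrite integral0.
have z1 : (0 < `|z|)%R by rewrite normr_gt0.
pose v := ln `|z|%R.
have Ev : expR v = `|z|%R by rewrite lnK.
have D1 : (fun u : R => u + v)%R^`()%classic = cst 1%R.
  apply/funext => u; rewrite derive1E deriveD// derive_id derive_cst addr0//.
rewrite /cos_kernel_mass (@increasing_ge0_integration_by_substitutionT _ (fun u => u + v)%R (cos_kernel p 1%R)); first last.
- by move=> u; exact: cos_kernel_ge0.
- exact: continuous_cos_kernel.
- exact: cvg_addrr.
- exact: cvg_addrr_Ny.
- by move=> u; exact: derivableD.
- by rewrite D1; exact: is_cvg_cst.
- by rewrite D1; exact: is_cvg_cst.
- by rewrite D1 => u; exact: cvg_cst.
- by move=> a b ab; rewrite ltrD2r.
rewrite -ge0_integralZl//; last 3 first.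
- apply/measurable_EFinP; apply: measurable_onR; rewrite D1.
  apply: measurable_funM => //; apply: measurableT_comp; last exact: measurable_funD.
  by apply: continuous_measurable_fun; exact: continuous_cos_kernel.
- by move=> u _; rewrite D1/= mulr1 lee_fin cos_kernel_ge0.
- by rewrite lee_fin apow_ge0.
apply: eq_integral => u _; rewrite D1/= mulr1 -EFinM; congr EFin.
have -> : cos_kernel p z u = cos_kernel p `|z|%R u.
  have [z0'|z0'] := leP 0%R z; first by rewrite ger0_norm.
  by rewrite ltr0_norm// /cos_kernel mulrN cosN sqrrN.
rewrite /comp /cos_kernel mulr1 expRD Ev mulrCA.
have -> : (apow p z * expR (- (p * (u + v))) = expR (- (p * u)))%R.
  by rewrite /apow -Ev /powR gt_eqF ?expR_gt0// expRK -expRD; congr expR; ring.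
by congr (_ * _)%R; ring.
Qed.

End fourier_representation.

Section fourier_comparison.
Context {R : realType}.
Local Open Scope ereal_scope.
Local Notation leb := (@lebesgue_measure R).
Implicit Types (mu nu : probability R R) (p y z b u v : R).

Lemma cos_kernel1_le_pos p u : (cos_kernel p 1 u <= expR (- (p - 2) * u))%R.
Proof.
rewrite /cos_kernel mulr1; have c1 := cos_le1 (expR u).
apply: (@le_trans _ _ (expR u ^+ 2 * expR (- (p * u)))%R).
  by rewrite ler_wpM2r ?expR_ge0//; have := sqr_ge0 (expR u); lra.
by rewrite -expRM_natl -expRD ler_expR; lra.
Qed.

Lemma cos_kernel1_le_neg p u : (cos_kernel p 1 u <= expR ((4 - p) * u))%R.
Proof.
rewrite /cos_kernel mulr1; have c1 := cos_le1BD (expR u).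
apply: (@le_trans _ _ (expR u ^+ 4 * expR (- (p * u)))%R).
  rewrite ler_wpM2r ?expR_ge0//.
  have : (0 <= expR u ^+ 4)%R by rewrite exprn_ge0// expR_ge0.
  by lra.
by rewrite -expRM_natl -expRD ler_expR; lra.
Qed.

Lemma integral_expRN_lty (q : R) : (0 < q)%R ->
  \int[leb]_(u in `[0%R, +oo[) (expR (- q * u))%:E < +oo.
Proof.
move=> q0.
have dF (x : R) : is_derive x 1%R (fun x => - q^-1 * expR (- q * x))%R (expR (- q * x))%R.
  have := is_deriveZ (- q^-1)%R (is_derive_expRN q x).
  by rewrite /GRing.scale/= !mulNr mulrN opprK mulrA mulVf ?mul1r// gt_eqF.
rewrite (@integral_itvcy_FTC _ _ _ _ 0%R dF) ?ltry//.
- exact: continuous_expRN.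
- rewrite -[X in _ --> X](mulr0 (- q^-1)%R).
  by apply: cvgM; [exact: cvg_cst|exact: cvg_expRNy].
Qed.

Lemma measurable_cos_kernel1 p z :
  measurable_fun [set: R] (fun u : R => (cos_kernel p z u)%:E).
Proof.
by apply/measurable_EFinP; apply: continuous_measurable_fun; exact: continuous_cos_kernel.
Qed.

(** Towards [+oo] the kernel is at most [e^((2 - p) u)], because the bracket is quadratic; towards
    [-oo] at most [e^((4 - p) u)], because it vanishes to fourth order. *)
Lemma cos_kernel_mass_lty p : (2 < p < 4)%R -> cos_kernel_mass p < +oo.
Proof.
move=> /andP[p2 p4].
have mk := measurable_onR (measurable_cos_kernel1 p 1%R).
pose D : set (measurableTypeR R) := `[0%R, +oo[%classic.
have mD : measurable D by exact: measurable_itv.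
have k0 u : 0 <= (cos_kernel p 1 u)%:E by rewrite lee_fin cos_kernel_ge0.
have me (q : R) : measurable_fun (`[0%R, +oo[%classic : set (measurableTypeR R))
    (fun u : measurableTypeR R => (expR (- q * u))%:E).
  apply: measurable_funTS; apply/measurable_EFinP.
  apply: (@measurable_onR R _ _ (fun u : R => expR (- q * u))%R).
  by apply: continuous_measurable_fun; exact: continuous_expRN.
rewrite /cos_kernel_mass -(setUv D) ge0_integral_setU//=; last 3 first.
- exact: measurableC.
- by rewrite setUv.
- exact/disj_setPCl.
apply: lte_add_pinfty.
- apply: (@le_lt_trans _ _ (\int[leb]_(u in `[0%R, +oo[) (expR (- (p - 2) * u))%:E)).
    apply: ge0_le_integral => //.
    + exact: measurable_funTS.
    + by move=> u _; rewrite lee_fin cos_kernel1_le_pos.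
  by apply: integral_expRN_lty; lra.
- apply: (@le_lt_trans _ _ (\int[leb]_(u in `]-oo, 0%R]) (cos_kernel p 1 u)%:E)).
    apply: ge0_subset_integral => //.
    + exact: measurableC.
    + exact: measurable_funTS.
    + by move=> u; rewrite /D/= !in_itv/= andbT => /negP; rewrite -ltNge => /ltW.
  have mkN : measurable_fun [set: R] (fun u : R => (cos_kernel p 1 (- u))%:E).
    exact: (measurableT_comp (measurable_cos_kernel1 p 1%R) (@oppr_measurable R setT)).
  rewrite (_ : \int[leb]_(u in `]-oo, 0%R]) (cos_kernel p 1 u)%:E =
      \int[leb]_(u in `[0%R, +oo[) (cos_kernel p 1 (- u))%:E); last first.
    rewrite ge0_integration_by_substitution0//.
    by apply: eq_integral => u _; rewrite opprK.
  apply: (@le_lt_trans _ _ (\int[leb]_(u in `[0%R, +oo[) (expR (- (4 - p) * u))%:E)).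
    apply: ge0_le_integral => //.
    + by apply: measurable_funTS; exact: (measurable_onR mkN).
    + move=> u _; rewrite lee_fin (le_trans (cos_kernel1_le_neg _ _))//.
      by rewrite ler_expR; lra.
  by apply: integral_expRN_lty; lra.
Qed.

Lemma cos_kernel_mass_gt0 p : (0 < p)%R -> 0 < cos_kernel_mass p.
Proof.
move=> p0.
have mk := measurable_onR (measurable_cos_kernel1 p 1%R).
have k0 u : 0 <= (cos_kernel p 1 u)%:E by rewrite lee_fin cos_kernel_ge0.
have mI : measurable (`[2%R, 3%R]%classic : set (measurableTypeR R)) by exact: measurable_itv.
(* On [[2, 3]] one has [e^u >= 3], so the bracket is at least [- 1 - 1 + 9 / 2 >= 1] and the kernel
   at least [e^(-3 p)]. *)
apply: (@lt_le_trans _ _ (\int[leb]_(u in `[2%R, 3%R]) (expR (- (p * 3)))%:E)).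
  rewrite integral_cst//; apply: mule_gt0; first by rewrite lte_fin expR_gt0.
  change (0 < lebesgue_measure (`[2%R, 3%R]%classic : set R)).
  by rewrite lebesgue_measure_itv/= lte_fin ltr_nat/= -EFinB lte_fin; lra.
apply: (@le_trans _ _ (\int[leb]_(u in `[2%R, 3%R]) (cos_kernel p 1 u)%:E)).
  apply: ge0_le_integral => //.
  - exact: measurable_funTS.
  - move=> u; rewrite /= in_itv/= => /andP[u2 u3]; rewrite lee_fin /cos_kernel mulr1.
    have E3 : (3 <= expR u)%R.
      by apply: le_trans (expR_ge1Dx u); rewrite -lerBlDl; apply: le_trans u2; lra.
    have cN := cos_geN1 (expR u).
    have E9 : (3 * 3 <= expR u * expR u)%R by apply: ler_pM.
    apply: (@le_trans _ _ (1 * expR (- (p * u)))%R).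
      by rewrite mul1r ler_expR lerN2 ler_wpM2l// ltW.
    by rewrite ler_wpM2r ?expR_ge0// expr2; lra.
exact: ge0_subset_integral.
Qed.

Lemma measurable_sym_avg_param mu b (g : R * measurableTypeR R -> \bar R) :
  (forall w, 0 <= g w) -> measurable_fun [set: R * measurableTypeR R] g ->
  measurable_fun [set: R * measurableTypeR R]
    (fun w => sym_avg mu b (fun z => g (z, w.2)) w.1).
Proof.
move=> g0 mg.
pose h (w : (R * measurableTypeR R) * R) :=
  (2^-1)%:E * (g (w.1.1 + b * w.2, w.1.2)%R + g (w.1.1 - b * w.2, w.1.2)%R).
have h0 w : 0 <= h w by rewrite mule_ge0 ?adde_ge0// lee_fin.
have mh : measurable_fun [set: (R * measurableTypeR R) * R] h.
  apply: emeasurable_funM => //; apply: emeasurable_funD;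
    apply: (measurableT_comp mg); apply: measurable_fun_pair.
  - apply: measurable_funD; last exact: measurable_funM.
    exact: (measurableT_comp measurable_fst measurable_fst).
  - exact: (measurableT_comp measurable_snd measurable_fst).
  - apply: measurable_funB; last exact: measurable_funM.
    exact: (measurableT_comp measurable_fst measurable_fst).
  - exact: (measurableT_comp measurable_snd measurable_fst).
exact: (measurable_fun_fubini_tonelli_F (m2 := mu) h mh h0).
Qed.

Lemma measurable_iter_avg_param {I : eqType} mu (b : I -> R) (s : seq I)
    (g : R * measurableTypeR R -> \bar R) y :
  (forall w, 0 <= g w) -> measurable_fun [set: R * measurableTypeR R] g ->
  measurable_fun [set: measurableTypeR R]
    (fun u => iter_avg (fun=> mu) b s (fun z => g (z, u)) y).
Proof.
elim/last_ind: s g => [|s i IH] g g0 mg.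
  by apply: (measurableT_comp mg); apply: measurable_fun_pair.
under eq_fun do rewrite iter_avg_rcons.
apply: (IH (fun w => sym_avg mu (b i) (fun z => g (z, w.2)) w.1)).
  by move=> w; exact: sym_avg_ge0.
exact: measurable_sym_avg_param.
Qed.

Lemma sym_avg_integral mu b (g : R * measurableTypeR R -> \bar R) :
  (forall w, 0 <= g w) -> measurable_fun [set: R * measurableTypeR R] g -> forall y,
  sym_avg mu b (fun z => \int[leb]_u g (z, u)) y =
  \int[leb]_u sym_avg mu b (fun z => g (z, u)) y.
Proof.
move=> g0 mg y.
pose k (w : R * measurableTypeR R) :=
  (2^-1)%:E * (g (y + b * w.1, w.2)%R + g (y - b * w.1, w.2)%R).
have k0 w : 0 <= k w by rewrite mule_ge0 ?adde_ge0// lee_fin.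
have mk : measurable_fun [set: R * measurableTypeR R] k.
  apply: emeasurable_funM => //; apply: emeasurable_funD;
    apply: (measurableT_comp mg); apply: measurable_fun_pair => //.
  - by apply: measurable_funD => //; exact: measurable_funM.
  - by apply: measurable_funB => //; exact: measurable_funM.
have mgz x : measurable_fun [set: measurableTypeR R] (fun u => g (x, u)).
  by apply: (measurableT_comp mg); apply: measurable_fun_pair.
transitivity (\int[mu]_t \int[leb]_u k (t, u)).
  apply: eq_integral => t _; rewrite -ge0_integralD// -ge0_integralZl//.
  - by apply: emeasurable_funD.
  - by move=> u _; rewrite adde_ge0.
by rewrite (fubini_tonelli k mk k0).
Qed.

(** Induction from the end of [s]: the innermost average of [g] is again a function of the point and
    the parameter [u], so the hypothesis applies with a new [g]. *)
Lemma iter_avg_integral {I : eqType} mu (b : I -> R) (s : seq I)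
    (g : R * measurableTypeR R -> \bar R) :
  (forall w, 0 <= g w) -> measurable_fun [set: R * measurableTypeR R] g -> forall y,
  iter_avg (fun=> mu) b s (fun z => \int[leb]_u g (z, u)) y =
  \int[leb]_u iter_avg (fun=> mu) b s (fun z => g (z, u)) y.
Proof.
elim/last_ind: s g => [//|s i IH] g g0 mg y.
rewrite iter_avg_rcons; under [RHS]eq_integral do rewrite iter_avg_rcons.
rewrite -(IH (fun w => sym_avg mu (b i) (fun z => g (z, w.2)) w.1)).
- by congr (iter_avg _ _ _ _ y); apply/funext => z; exact: sym_avg_integral.
- by move=> w; exact: sym_avg_ge0.
- exact: measurable_sym_avg_param.
Qed.

Lemma iter_avg_cos_kernel {I : eqType} mu (b : I -> R) (s : seq I) (m : R)
    (psi : R -> R) p u :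
  \int[mu]_x (x ^+ 2)%:E = m%:E ->
  (forall c, \int[mu]_x (cos (c * x))%:E = (psi c)%:E) ->
  iter_avg (fun=> mu) b s (fun z => (cos_kernel p z u)%:E) 0%R =
  ((m * (\sum_(i <- s) b i ^+ 2) * expR u ^+ 2 / 2 +
    \prod_(i <- s) psi (expR u * b i) - 1) * expR (- (p * u)))%:E.
Proof.
move=> hm hpsi; pose e := expR (- (p * u)).
rewrite (_ : (fun z => (cos_kernel p z u)%:E) = (fun z =>
    (- e + (expR u ^+ 2 / 2 * e) * z ^+ 2 + e * cos (expR u * z))%:E)); last first.
  by apply/funext => z; congr EFin; rewrite /cos_kernel -/e; ring.
rewrite (iter_avg_trig _ _ _ _ _ _ hm hpsi) mulr0 cos0 expr0n/=.
by congr EFin; rewrite -/e; ring.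
Qed.

(* For 2 < p < 4, |z|^p is a positive mixture of the functions
   cos(t z) - 1 + (t z)^2 / 2, so p-th moments are compared through
   characteristic functions. *)
Lemma fourier_compare {I J : eqType} mu nu (b : I -> R) (c : J -> R) (s : seq I)
    (s' : seq J) (m m' : R) (psi psi' : R -> R) p : (2 < p < 4)%R ->
  \int[mu]_x (x ^+ 2)%:E = m%:E ->
  (forall c, \int[mu]_x (cos (c * x))%:E = (psi c)%:E) ->
  \int[nu]_x (x ^+ 2)%:E = m'%:E ->
  (forall c, \int[nu]_x (cos (c * x))%:E = (psi' c)%:E) ->
  (forall t, 0 < t ->
    m * (\sum_(i <- s) b i ^+ 2) * t ^+ 2 / 2 + \prod_(i <- s) psi (t * b i) <=
    m' * (\sum_(i <- s') c i ^+ 2) * t ^+ 2 / 2 + \prod_(i <- s') psi' (t * c i))%R ->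
  iter_avg (fun=> mu) b s (fun z => (apow p z)%:E) 0%R <=
  iter_avg (fun=> nu) c s' (fun z => (apow p z)%:E) 0%R.
Proof.
move=> p24 hm hpsi hm' hpsi' h.
have p0 : (0 < p)%R by case/andP: p24 => p2 _; lra.
have C0 := cos_kernel_mass_gt0 p0; have Cy := cos_kernel_mass_lty p24.
have Cfin : cos_kernel_mass p \is a fin_num by rewrite ge0_fin_numE// ltW.
have Cpos : (0 < fine (cos_kernel_mass p))%R by rewrite fine_gt0// C0.
have main (I' : eqType) (la : probability R R) (d : I' -> R) (r : seq I') :
    (fine (cos_kernel_mass p))%:E * iter_avg (fun=> la) d r (fun z => (apow p z)%:E) 0%R =
    \int[leb]_u iter_avg (fun=> la) d r (fun z => (cos_kernel p z u)%:E) 0%R.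
  rewrite -(iter_avg_integral la d r (g := fun w => (cos_kernel p w.1 w.2)%:E)); last 2 first.
  - by move=> w; rewrite lee_fin cos_kernel_ge0.
  - exact: measurable_cos_kernel.
  rewrite -iter_avgZ//; last 3 first.
  - exact: ltW.
  - by move=> z; rewrite lee_fin apow_ge0.
  - exact: measurable_EFin_apow.
  congr (iter_avg _ _ _ _ _); apply/funext => z.
  by rewrite (integral_cos_kernel z p0) muleC fineK.
rewrite -(@lee_pmul2l _ (fine (cos_kernel_mass p))%:E)// !main.
apply: ge0_le_integral => //.
- move=> u _; apply: iter_avg_ge0; first by move=> z; rewrite lee_fin cos_kernel_ge0.
  have mpair : measurable_fun [set: R] (fun z : R => (z, u) : R * measurableTypeR R).
    exact: measurable_fun_pair.
  exact: (measurableT_comp (measurable_cos_kernel p) mpair).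
- apply: (measurable_iter_avg_param mu b s (g := fun w => (cos_kernel p w.1 w.2)%:E)).
  + by move=> w; rewrite lee_fin cos_kernel_ge0.
  + exact: measurable_cos_kernel.
- apply: (measurable_iter_avg_param nu c s' (g := fun w => (cos_kernel p w.1 w.2)%:E)).
  + by move=> w; rewrite lee_fin cos_kernel_ge0.
  + exact: measurable_cos_kernel.
- move=> u _; rewrite (iter_avg_cos_kernel _ _ _ _ hm hpsi) (iter_avg_cos_kernel _ _ _ _ hm' hpsi').
  by rewrite lee_fin ler_wpM2r ?expR_ge0// lerB// h// expR_gt0.
Qed.

End fourier_comparison.

(** * Gaussian moments *)

Section gaussian_law.
Context {R : realType}.
Local Open Scope ereal_scope.
Local Notation leb := (@lebesgue_measure R).
Implicit Types (p x t : R).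

Definition gaussian_law : probability R R := borel_law (normal_prob (0 : R)%R 1%R).

Definition gaussian_pdf x : R := normal_pdf 0%R 1%R x.

Lemma gaussian_pdfE x : gaussian_pdf x = (normal_peak 1 * expR (- (x ^+ 2 / 2)))%R.
Proof.
rewrite /gaussian_pdf normal_pdfE ?oner_eq0// /normal_fun subr0 expr1n.
by rewrite mulNr.
Qed.

Lemma gaussian_pdf_ge0 x : (0 <= gaussian_pdf x)%R.
Proof. exact: normal_pdf_ge0. Qed.

Lemma gaussian_pdfN x : gaussian_pdf (- x) = gaussian_pdf x.
Proof. by rewrite !gaussian_pdfE sqrrN. Qed.

Lemma is_derive_gaussian_pdf x :
  is_derive x 1%R gaussian_pdf (- (x * gaussian_pdf x))%R.
Proof.
have -> : gaussian_pdf = (fun x => normal_peak 1 * expR (- (x ^+ 2 / 2)))%R.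
  by apply/funext => y; rewrite gaussian_pdfE.
have d1 := is_derive_monomial 1 (- 2^-1)%R x.
have d2 := @is_derive1_comp R expR (fun x => - 2^-1 * x ^+ 2)%R x _ _ (is_derive_expR _) d1.
have := is_deriveZ (normal_peak 1)%R d2.
rewrite /GRing.scale/=; set d := (X in is_derive _ _ _ X).
have -> : d = (- (x * (normal_peak 1 * expR (- (x ^+ 2 / 2)))))%R.
  rewrite /d (_ : - 2^-1 * x ^+ 2 = - (x ^+ 2 / 2))%R; first by field.
  by field.
move=> h; apply: is_derive_near h; near=> y.
by rewrite /GRing.scale/= (_ : - 2^-1 * y ^+ 2 = - (y ^+ 2 / 2))%R//; field.
Unshelve. all: by end_near. Qed.

Lemma continuous_gaussian_pdf : continuous gaussian_pdf.
Proof. by apply: continuous_normal_pdf; rewrite oner_eq0. Qed.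

Lemma measurable_gaussian_pdf : measurable_fun [set: R] gaussian_pdf.
Proof. exact: continuous_measurable_fun continuous_gaussian_pdf. Qed.

(** From [(x - 2)^2 >= 0]. The rate 2 leaves a decay [e^(-x)] after multiplication by the [e^x] of
    [powR_le_expR]. *)
Lemma gaussian_pdf_le x : (gaussian_pdf x <= normal_peak 1 * expR 2 * expR (- 2 * x))%R.
Proof.
rewrite gaussian_pdfE -mulrA ler_wpM2l ?normal_peak_ge0// -expRD ler_expR.
by have := sqr_ge0 (x - 2)%R; rewrite sqrrB; lra.
Qed.

Lemma powR_le_expR p x : (0 < p)%R -> (0 <= x)%R -> (x `^ p <= p `^ p * expR x)%R.
Proof.
move=> p0 x0; have xp : (0 <= x / p)%R by rewrite divr_ge0// ltW.
have E : (x = p * (x / p))%R by rewrite mulrC divfK// gt_eqF.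
rewrite {1}E powRM ?(ltW p0)// ler_wpM2l ?powR_ge0//.
have -> : (expR x = expR (x / p) `^ p)%R.
  by rewrite /powR gt_eqF ?expR_gt0// expRK mulrC divfK// gt_eqF.
apply: ge0_ler_powR; rewrite ?nnegrE ?expR_ge0 ?(ltW p0)//.
by rewrite (le_trans _ (expR_ge1Dx _))// lerDr.
Qed.

Lemma cvg_powR_gaussian p : (0 < p)%R ->
  (x `^ p * gaussian_pdf x)%R @[x --> +oo%R] --> (0 : R)%R.
Proof.
move=> p0; pose K := (p `^ p * (normal_peak 1 * expR 2))%R.
have h : (K * expR (- 1 * x))%R @[x --> +oo%R] --> (0 : R)%R.
  by rewrite -[X in _ --> X](mulr0 K); apply: cvgM; [exact: cvg_cst|exact: cvg_expRNy].
apply: squeeze_cvgr (cvg_cst 0%R) h; near=> x.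
have x0 : (0 <= x)%R by near: x; exact: nbhs_pinfty_ge.
rewrite mulr_ge0 ?powR_ge0 ?gaussian_pdf_ge0//=.
apply: (@le_trans _ _ (p `^ p * expR x * (normal_peak 1 * expR 2 * expR (- 2 * x))))%R.
  by apply: ler_pM; rewrite ?powR_ge0 ?gaussian_pdf_ge0 ?powR_le_expR ?gaussian_pdf_le.
rewrite /K (_ : - 1 * x = x + - 2 * x)%R; last by ring.
by rewrite [expR (x + _)]expRD le_eqVlt; apply/orP; left; apply/eqP; ring.
Unshelve. all: by end_near. Qed.

Lemma ge0_integral_gaussian (f : R -> R) : (forall x, 0 <= f x)%R ->
  measurable_fun [set: R] f ->
  \int[gaussian_law]_x (f x)%:E = \int[leb]_x (f x * gaussian_pdf x)%:E.
Proof.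
move=> f0 mf; rewrite ge0_integral_borel_law//; last exact/measurable_EFinP.
apply: ge0_integral_density => //; first exact: gaussian_pdf_ge0.
exact: measurable_gaussian_pdf.
Qed.

Lemma even_integral_gaussian (f : R -> R) : (forall x, 0 <= f x)%R ->
  continuous f -> (forall x, f (- x) = f x)%R ->
  \int[gaussian_law]_x (f x)%:E =
  2%:E * \int[leb]_(x in `[0%R, +oo[) (f x * gaussian_pdf x)%:E.
Proof.
move=> f0 cf fN; rewrite ge0_integral_gaussian//; last exact: continuous_measurable_fun.
rewrite (ge0_symfun_integralT (f := fun x => f x * gaussian_pdf x)%R).
- by rewrite set_itvcy.
- by move=> x; rewrite mulr_ge0// gaussian_pdf_ge0.
- by move=> x; apply: cvgM; [exact: cf|exact: continuous_gaussian_pdf].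
- by move=> x /=; rewrite fN gaussian_pdfN.
Qed.

(* Both sides differ by the derivative of [- f * gaussian_pdf], whose sign
   changes only at [r]; cutting there keeps every integrand nonnegative. *)
Lemma gaussian_integration_by_parts (f df : R -> R) (r : R) : (0 <= r)%R ->
  (forall x : R, is_derive x 1%R f (df x)) -> continuous df -> f 0%R = 0%R ->
  (forall x, 0 <= x -> 0 <= f x)%R -> (forall x, 0 <= x -> 0 <= df x)%R ->
  (forall x, r <= x -> df x <= x * f x)%R ->
  (f x * gaussian_pdf x)%R @[x --> +oo%R] --> (0 : R)%R ->
  \int[leb]_(x in `[0%R, +oo[) (x * f x * gaussian_pdf x)%:E =
  \int[leb]_(x in `[0%R, +oo[) (df x * gaussian_pdf x)%:E.
Proof.
move=> r0 fdf cdf f00 f0 df0 hr flim.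
have cf : continuous f.
  move=> x; apply/differentiable_continuous/derivable1_diffP.
  by have [] := fdf x.
have cpdf := continuous_gaussian_pdf.
pose F x : R := (- (f x * gaussian_pdf x))%R.
have dF x : is_derive x 1%R F (x * f x * gaussian_pdf x - df x * gaussian_pdf x)%R.
  have := is_deriveN (is_deriveM (fdf x) (is_derive_gaussian_pdf x)).
  rewrite /GRing.scale/=; set d := (X in is_derive _ _ _ X).
  have -> // : d = (x * f x * gaussian_pdf x - df x * gaussian_pdf x)%R.
  by rewrite /d; ring.
have cA : continuous (fun x => x * f x * gaussian_pdf x)%R.
  by move=> x; apply: cvgM; [apply: cvgM; [exact: cvg_id|exact: cf]|exact: cpdf].
have cB : continuous (fun x => df x * gaussian_pdf x)%R.
  by move=> x; apply: cvgM; [exact: cdf|exact: cpdf].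
have cF' : continuous (fun x => x * f x * gaussian_pdf x - df x * gaussian_pdf x)%R.
  by move=> x; apply: cvgB; [exact: cA|exact: cB].
have mA := measurable_onR (continuous_measurable_fun cA).
have mB := measurable_onR (continuous_measurable_fun cB).
have A0 x : (0 <= x -> 0 <= x * f x * gaussian_pdf x)%R.
  by move=> x0; rewrite !mulr_ge0 ?gaussian_pdf_ge0 ?f0.
have B0 x : (0 <= x -> 0 <= df x * gaussian_pdf x)%R.
  by move=> x0; rewrite !mulr_ge0 ?gaussian_pdf_ge0 ?df0.
have mI (i : interval R) : measurable ([set` i] : set (measurableTypeR R)).
  exact: measurable_itv.
have F_le0 x : (0 <= x -> F x <= 0)%R.
  by move=> x0; rewrite /F oppr_le0 mulr_ge0 ?f0 ?gaussian_pdf_ge0.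
have Fr := F_le0 r r0.
have split_at (g : R -> R) : continuous g -> (forall x, 0 <= x -> 0 <= g x)%R ->
    \int[leb]_(x in `[0%R, +oo[) (g x)%:E =
    \int[leb]_(x in `[0%R, r]) (g x)%:E + \int[leb]_(x in `[r, +oo[) (g x)%:E.
  move=> cg g0.
  have mg := measurable_onR (continuous_measurable_fun cg).
  rewrite (@itv_bndbnd_setU _ _ (BLeft 0%R) (BRight r) (BInfty _ false)) ?bnd_simp//.
  rewrite ge0_integral_setU//=.
  - by congr (_ + _); apply: integral_itv_obnd_cbnd; apply/measurable_EFinP; exact: measurable_funTS.
  - by apply/measurable_EFinP; exact: measurable_funTS.
  - move=> x [|]; rewrite /= in_itv/= => /andP[h _]; rewrite lee_fin g0//.
    by rewrite (le_trans r0)// ltW.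
  - by apply/disj_setPS => x []/=; rewrite !in_itv/= andbT => /andP[_ xr]; rewrite ltNge xr.
have tail : \int[leb]_(x in `[r, +oo[) (x * f x * gaussian_pdf x)%:E =
    \int[leb]_(x in `[r, +oo[) (df x * gaussian_pdf x)%:E + (- F r)%:E.
  have := @integral_itvcy_FTC _ F _ r 0%R dF cF'.
  rewrite sub0r => <-.
  - rewrite -ge0_integralD//.
    + by apply: eq_integral => x _; rewrite -EFinD addrC subrK.
    + by move=> x; rewrite /= in_itv/= andbT => rx; rewrite lee_fin B0// (le_trans r0).
    + by apply/measurable_EFinP; exact: measurable_funTS.
    + move=> x; rewrite /= in_itv/= andbT => rx.
      by rewrite lee_fin subr_ge0 ler_wpM2r ?gaussian_pdf_ge0// hr.
    + apply/measurable_EFinP; apply: measurable_funTS.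
      exact: (measurable_onR (continuous_measurable_fun cF')).
  - move=> x rx.
    by rewrite subr_ge0 ler_wpM2r ?gaussian_pdf_ge0// hr.
  - by rewrite -[X in _ --> X]oppr0; apply: cvgN.
have iA : leb.-integrable `[0%R, r] (fun x => (x * f x * gaussian_pdf x)%:E).
  by apply: continuous_compact_integrable; [exact: segment_compact|exact: continuous_subspaceT].
have iB : leb.-integrable `[0%R, r] (fun x => (df x * gaussian_pdf x)%:E).
  by apply: continuous_compact_integrable; [exact: segment_compact|exact: continuous_subspaceT].
have head : \int[leb]_(x in `[0%R, r]) (x * f x * gaussian_pdf x)%:E =
    \int[leb]_(x in `[0%R, r]) (df x * gaussian_pdf x)%:E + (F r)%:E.
  have := integral_derivative0 dF cF' r0.
  rewrite {2}/F f00 mul0r oppr0 subr0 => <-.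
  have -> : \int[leb]_(x in `[0%R, r]) (x * f x * gaussian_pdf x - df x * gaussian_pdf x)%:E =
    \int[leb]_(x in `[0%R, r]) (x * f x * gaussian_pdf x)%:E -
    \int[leb]_(x in `[0%R, r]) (df x * gaussian_pdf x)%:E.
    by rewrite -integralB//; apply: eq_integral.
  by rewrite addeC subeK// integrable_fin_num.
(* The boundary terms at the cut, [F r] from the left piece and [- F r] from the right one,
   cancel. *)
rewrite !split_at// head tail addeACA -EFinD subrr adde0.
by [].
Qed.

End gaussian_law.

(** * Absolute moments of the Gaussian *)

Section gaussian_moments.
Context {R : realType}.
Local Open Scope ereal_scope.
Local Notation leb := (@lebesgue_measure R).
Local Notation G := (@gaussian_law R).
Implicit Types (p x c : R).

Lemma gaussian_sqr : \int[G]_x (x ^+ 2)%:E = 1.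
Proof.
rewrite even_integral_gaussian; first last.
- by move=> x; rewrite sqrrN.
- by move=> x; exact: exprn_continuous.
- by move=> x; exact: sqr_ge0.
rewrite (_ : \int[leb]_(x in _) _ = \int[leb]_(x in `[0%R, +oo[) (x * x * gaussian_pdf x)%:E)//.
rewrite (@gaussian_integration_by_parts _ (fun x => x) (fun=> 1%R) 1%R)//.
- rewrite -(@even_integral_gaussian _ (fun=> 1%R))//; last by move=> x; exact: cvg_cst.
  by rewrite integral_cst// -[RHS]mule1 -(probability_setT G).
- by move=> x; exact: cvg_cst.
- by move=> x x1; rewrite -[leLHS]mulr1 ler_pM.
- have := @cvg_powR_gaussian R 1%R ltr01.
  apply: cvg_trans; apply: near_eq_cvg; near=> x.
  by rewrite powRr1//; near: x; exact: nbhs_pinfty_ge.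
Unshelve. all: by end_near. Qed.

Definition gaussian_moment p : \bar R := \int[G]_x (apow p x)%:E.

Lemma gaussian_moment_ge0 p : 0 <= gaussian_moment p.
Proof. by apply: integral_ge0 => x _; rewrite lee_fin apow_ge0. Qed.

Lemma gaussian_moment2 : gaussian_moment 2 = 1.
Proof.
by rewrite -gaussian_sqr; apply: eq_integral => x _; rewrite apow2.
Qed.

Lemma gaussian_moment_rec p : (4 <= p)%R ->
  gaussian_moment p = (p - 1)%:E * gaussian_moment (p - 2).
Proof.
move=> p4; have p1 : (1 < p)%R by lra.
have p11 : (1 < p - 1)%R by lra.
have p21 : (1 < p - 2)%R by lra.
rewrite /gaussian_moment !even_integral_gaussian; first last.
- exact: apowN.
- exact: continuous_apow.
- exact: apow_ge0.
- exact: apowN.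
- exact: continuous_apow.
- exact: apow_ge0.
rewrite muleCA; congr (_ * _); rewrite -ge0_integralZl//; last 3 first.
- apply/measurable_EFinP; apply: measurable_funTS; apply: measurable_onR.
  by apply: measurable_funM; [exact: measurable_apow|exact: measurable_gaussian_pdf].
- by move=> x _; rewrite lee_fin mulr_ge0 ?apow_ge0 ?gaussian_pdf_ge0.
- by rewrite lee_fin; lra.
transitivity (\int[leb]_(x in `[0%R, +oo[) (x * spow (p - 1) x * gaussian_pdf x)%:E).
  by apply: eq_integral => x _; rewrite mulr_spow.
have D x : is_derive x 1%R (spow (p - 1)) ((p - 1) * apow (p - 2) x)%R.
  have := is_derive_spow x p11.
  by rewrite (_ : p - 1 - 1 = p - 2)%R//; ring.
(* The cut [sqrt (p - 1)] is where [(p - 1) x^(p-2)] and [x * x^(p-1)] change order. *)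
rewrite (gaussian_integration_by_parts (sqrtr_ge0 (p - 1)) D)//.
- by apply: eq_integral => x _; rewrite -mulrA EFinM.
- by move=> x; apply: cvgM; [exact: cvg_cst|exact: continuous_apow].
- by rewrite /spow sgr0 mul0r.
- move=> x x0; rewrite /spow mulr_ge0 ?powR_ge0//.
  by rewrite sgr_ge0.
- by move=> x x0; rewrite mulr_ge0 ?apow_ge0//; lra.
- move=> x rx; have s0 : (0 < Num.sqrt (p - 1))%R by rewrite sqrtr_gt0; lra.
  have x0 : (0 < x)%R by rewrite (lt_le_trans s0).
  have -> : (x * spow (p - 1) x = x ^+ 2 * apow (p - 2) x)%R.
    rewrite mulr_spow// -apow2 /apow -powRD; last by apply/implyP => _; rewrite normr_eq0 gt_eqF.
    by congr (_ `^ _)%R; ring.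
  rewrite ler_wpM2r ?apow_ge0// -(@sqr_sqrtr _ (p - 1)%R); last by lra.
  by rewrite ler_sqr ?nnegrE// ltW.
- have q0 : (0 < p - 1)%R by lra.
  have := @cvg_powR_gaussian R _ q0.
  apply: cvg_trans; apply: near_eq_cvg; near=> x.
  have x0 : (0 < x)%R by near: x; exact: nbhs_pinfty_gt.
  by rewrite /spow gtr0_sg// mul1r gtr0_norm.
Unshelve. all: by end_near. Qed.

Lemma gaussian_moment_lty p : (1 < p)%R -> gaussian_moment p < +oo.
Proof.
move=> p1; have p0 : (0 < p)%R by lra.
rewrite /gaussian_moment even_integral_gaussian; first last.
- exact: apowN.
- exact: continuous_apow.
- exact: apow_ge0.
pose K : R := (p `^ p * (normal_peak 1 * expR 2))%R.
have K0 : (0 <= K)%R by rewrite !mulr_ge0 ?powR_ge0 ?expR_ge0 ?normal_peak_ge0.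
have me : measurable_fun (`[0%R, +oo[%classic : set (measurableTypeR R))
    (fun u : measurableTypeR R => (expR (- 1 * u))%:E).
  apply: measurable_funTS; apply/measurable_EFinP.
  apply: (@measurable_onR R _ _ (fun u : R => expR (- 1 * u))%R).
  by apply: continuous_measurable_fun; exact: continuous_expRN.
apply: (@le_lt_trans _ _ (2%:E * (K%:E * \int[leb]_(x in `[0%R, +oo[) (expR (- 1 * x))%:E))).
  apply: lee_wpmul2l => //; rewrite -ge0_integralZl//.
  apply: ge0_le_integral => //.
  - by move=> x _; rewrite lee_fin mulr_ge0 ?apow_ge0 ?gaussian_pdf_ge0.
  - apply/measurable_EFinP; apply: measurable_funTS; apply: measurable_onR.
    by apply: measurable_funM; [exact: measurable_apow|exact: measurable_gaussian_pdf].
  - by apply: emeasurable_funM.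
  - move=> x; rewrite /= in_itv/= andbT => x0; rewrite -EFinM lee_fin /apow ger0_norm//.
    apply: (@le_trans _ _ (p `^ p * expR x * (normal_peak 1 * expR 2 * expR (- 2 * x))))%R.
      by apply: ler_pM; rewrite ?powR_ge0 ?gaussian_pdf_ge0 ?powR_le_expR ?gaussian_pdf_le.
    rewrite /K (_ : - 1 * x = x + - 2 * x)%R; last by ring.
    by rewrite [expR (x + _)]expRD le_eqVlt; apply/orP; left; apply/eqP; ring.
rewrite muleA -EFinM; apply: lte_mul_pinfty => //; first by rewrite lee_fin mulr_ge0.
exact: (integral_expRN_lty ltr01).
Qed.

End gaussian_moments.

(** * The Gaussian characteristic function *)

Section gaussian_characteristic_function.
Context {R : realType}.
Local Open Scope ereal_scope.
Local Notation leb := (@lebesgue_measure R).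
Local Notation G := (@gaussian_law R).
Implicit Types (x c : R).

(** Times the density, this is minus the derivative of [sin (c x) * gaussian_pdf x], so its integral
    over the half-line vanishes. *)
Let cfun c x : R := (x * sin (c * x) - c * cos (c * x))%R.

Let continuous_mul c : continuous (fun x : R => c * x)%R.
Proof. by move=> x; apply: cvgM; [exact: cvg_cst|exact: cvg_id]. Qed.

Let continuous_sinM c : continuous (fun x : R => sin (c * x))%R.
Proof.
move=> x; apply: (@continuous_comp _ _ _ (fun x => c * x)%R sin).
  exact: continuous_mul.
exact: continuous_sin.
Qed.

Let continuous_cosM c : continuous (fun x : R => cos (c * x))%R.
Proof.
move=> x; apply: (@continuous_comp _ _ _ (fun x => c * x)%R cos).
  exact: continuous_mul.
exact: continuous_cos.
Qed.

Let continuous_cfun c : continuous (cfun c).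
Proof.
move=> x; apply: cvgB.
  by apply: cvgM; [exact: cvg_id|exact: continuous_sinM].
by apply: cvgM; [exact: cvg_cst|exact: continuous_cosM].
Qed.

Let K c : R := ((1 + `|c|) * (normal_peak 1 * expR 2))%R.

Let K0 c : (0 <= K c)%R.
Proof. by rewrite /K !mulr_ge0 ?addr_ge0 ?expR_ge0 ?normal_peak_ge0. Qed.

Let norm_cfun_le c x : (0 <= x -> `|cfun c x * gaussian_pdf x| <= K c * expR (- 1 * x))%R.
Proof.
move=> x0; rewrite normrM (ger0_norm (gaussian_pdf_ge0 x)).
apply: (@le_trans _ _ ((1 + `|c|) * expR x * (normal_peak 1 * expR 2 * expR (- 2 * x))))%R.
  apply: ler_pM; rewrite ?gaussian_pdf_ge0 ?gaussian_pdf_le// /cfun.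
  have e1 : (1 <= expR x)%R by rewrite -expR0 ler_expR.
  have ex : (x <= expR x)%R by rewrite (le_trans _ (expR_ge1Dx x))// lerDr.
  rewrite (le_trans (ler_normB _ _))// !normrM mulrDl mul1r; apply: lerD.
    rewrite (ger0_norm x0) (le_trans _ ex)// ler_piMr//.
    by rewrite ler_norml sin_geN1 sin_le1.
  by rewrite ler_pM// (le_trans _ e1)// ler_norml cos_geN1 cos_le1.
rewrite /K (_ : - 1 * x = x + - 2 * x)%R; last by ring.
by rewrite [expR (x + _)]expRD le_eqVlt; apply/orP; left; apply/eqP; ring.
Qed.

Let integrable_exp (k : R) :
  leb.-integrable `[0%R, +oo[ (fun x => (k * expR (- 1 * x))%:E).
Proof.
have me : measurable_fun (`[0%R, +oo[%classic : set (measurableTypeR R))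
    (fun u : measurableTypeR R => (expR (- 1 * u))%:E).
  apply: measurable_funTS; apply/measurable_EFinP.
  apply: (@measurable_onR R _ _ (fun u : R => expR (- 1 * u))%R).
  by apply: continuous_measurable_fun; exact: continuous_expRN.
have i1 : leb.-integrable `[0%R, +oo[ (fun x => (expR (- 1 * x))%:E).
  apply/integrableP; split => //.
  under eq_integral do rewrite /= ger0_norm ?expR_ge0//.
  exact: (integral_expRN_lty ltr01).
rewrite (_ : (fun x => _) = (fun x => k%:E * (expR (- 1 * x))%:E)); last exact/funext.
exact: integrableZl.
Qed.

Let integral_exp (k : R) : (0 <= k)%R ->
  \int[leb]_(x in `[0%R, +oo[) (k * expR (- 1 * x))%:E = k%:E.
Proof.
move=> k0; have dF x : is_derive x 1%R (fun x => - k * expR (- 1 * x))%R (k * expR (- 1 * x))%R.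
  have := is_deriveZ (- k)%R (is_derive_expRN 1%R x).
  by rewrite /GRing.scale/= mulrA mulrNN mulr1.
rewrite (integral_itvcy_FTC dF (l := 0%R)).
- by rewrite mulr0 expR0 mulr1 sub0r opprK.
- by move=> x; apply: cvgM; [exact: cvg_cst|exact: continuous_expRN].
- by move=> x _; rewrite mulr_ge0// expR_ge0.
- rewrite -[X in _ --> X](mulr0 (- k)%R); apply: cvgM; first exact: cvg_cst.
  exact: cvg_expRNy.
Qed.

Let continuous_cfunpdf c : continuous (fun x => cfun c x * gaussian_pdf x)%R.
Proof.
by move=> x; apply: cvgM; [exact: continuous_cfun|exact: continuous_gaussian_pdf].
Qed.

Let integrable_cfun c :
  leb.-integrable `[0%R, +oo[ (fun x => (cfun c x * gaussian_pdf x)%:E).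
Proof.
apply: (@le_integrable _ _ _ leb _ (measurable_itv _) _ (fun x : measurableTypeR R => (K c * expR (- 1 * x))%:E)) => //.
- apply/measurable_EFinP; apply: measurable_funTS.
  by apply: measurable_onR; apply: continuous_measurable_fun; exact: continuous_cfunpdf.
- move=> x; rewrite /= in_itv/= andbT => x0; rewrite lee_fin.
  by rewrite (le_trans (norm_cfun_le c x0))// ler_norm.
Qed.

Let integral_cfun c :
  \int[leb]_(x in `[0%R, +oo[) (cfun c x * gaussian_pdf x)%:E = 0.
Proof.
have Ic := integrable_cfun c; have Ie := integrable_exp (K c).
(* [cfun] changes sign; adding [K c * e^(-x)], which dominates it and has integral [K c], gives a
   nonnegative integrand with an explicit antiderivative. *)
suff : \int[leb]_(x in `[0%R, +oo[) (cfun c x * gaussian_pdf x)%:E + (K c)%:E = (K c)%:E.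
  by move/(congr1 (fun z => z - (K c)%:E)); rewrite addeK// subee.
rewrite -{1}(integral_exp (K0 c)) -integralD//.
pose F x : R := (- (sin (c * x) * gaussian_pdf x) - K c * expR (- 1 * x))%R.
have dF x : is_derive x 1%R F (cfun c x * gaussian_pdf x + K c * expR (- 1 * x))%R.
  have dc : is_derive x 1%R (fun x => c * x)%R c.
    have := is_derive_affine 0%R c x.
    by rewrite (_ : (fun u => 0 + c * u)%R = (fun u : R => c * u)%R)//; apply/funext => u; rewrite add0r.
  have d2 : is_derive x 1%R (fun x => sin (c * x))%R (cos (c * x) * c)%R.
    exact: (@is_derive1_comp R sin (fun x => c * x)%R x _ c).
  have d3 := is_deriveN (is_deriveM d2 (is_derive_gaussian_pdf x)).
  have := is_deriveB d3 (is_deriveZ (K c) (is_derive_expRN 1%R x)).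
  rewrite /GRing.scale/=; set d := (X in is_derive _ _ _ X).
  have -> // : d = (cfun c x * gaussian_pdf x + K c * expR (- 1 * x))%R.
  by rewrite /d /cfun; ring.
transitivity (\int[leb]_(x in `[0%R, +oo[) (cfun c x * gaussian_pdf x + K c * expR (- 1 * x))%:E).
  by apply: eq_integral.
rewrite (integral_itvcy_FTC dF (l := 0%R)).
- by rewrite /F !mulr0 sin0 mul0r oppr0 expR0 mulr1 !sub0r opprK.
- move=> x; apply: cvgD; first exact: continuous_cfunpdf.
  by apply: cvgM; [exact: cvg_cst|exact: continuous_expRN].
- move=> x x0; have := norm_cfun_le c x0; rewrite ler_norml => /andP[h _].
  by rewrite -lerBlDr sub0r.
- have : F x @[x --> +oo%R] --> (- 0 - K c * 0)%R.
    apply: cvgB.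
      apply: cvgN; apply: norm_cvg0.
      have h := @cvg_powR_gaussian R 1%R ltr01.
      apply: squeeze_cvgr (cvg_cst 0%R) h; near=> x.
      have x1 : (1 <= x)%R by near: x; exact: nbhs_pinfty_ge.
      rewrite normr_ge0/= normrM (ger0_norm (gaussian_pdf_ge0 x)) ler_wpM2r ?gaussian_pdf_ge0//.
      rewrite powRr1; last by rewrite (le_trans _ x1).
      apply: le_trans x1.
      by rewrite ler_norml sin_geN1 sin_le1.
    by apply: cvgM; [exact: cvg_cst|exact: cvg_expRNy].
  by rewrite mulr0 !oppr0 addr0.
Unshelve. all: by end_near. Qed.

Let integrable_sqr : G.-integrable [set: R] (fun x => (x ^+ 2)%:E).
Proof.
apply/integrableP; split.
  by apply/measurable_EFinP; exact: measurable_funX.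
rewrite (_ : \int[G]_x `|_| = 1) ?ltry// -gaussian_sqr.
by apply: eq_integral => x _ /=; rewrite ger0_norm// sqr_ge0.
Qed.

Let integrable_sqrD1 (k : R) : G.-integrable [set: R] (fun x => (k * (x ^+ 2 + 1))%:E).
Proof.
have h : G.-integrable [set: R] (fun x => (x ^+ 2)%:E + cst 1%:E x).
  by apply: integrableD => //; exact: finite_measure_integrable_cst.
rewrite (_ : (fun x => _) = (fun x => k%:E * ((x ^+ 2)%:E + cst 1%:E x))); last exact/funext.
exact: integrableZl.
Qed.

Let measurable_xsin c : measurable_fun [set: R] (fun x => x * sin (c * x))%R.
Proof.
apply: measurable_funM => //; apply: continuous_measurable_fun.
exact: continuous_sinM.
Qed.

Let norm_xsin_le c x : (`|x * sin (c * x)| <= 1 * (x ^+ 2 + 1))%R.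
Proof.
rewrite normrM mul1r; apply: (@le_trans _ _ `|x|%R).
  by rewrite ler_piMr// ler_norml sin_geN1 sin_le1.
have := sqr_ge0 (`|x| - 1)%R; have := sqr_ge0 x; rewrite sqrrB real_normK ?num_real//.
by rewrite mulr1 expr1n; lra.
Qed.

Let integrable_xsin c : G.-integrable [set: R] (fun x => (x * sin (c * x))%:E).
Proof.
apply: (@le_integrable _ _ _ _ _ _ _ (fun x => (1 * (x ^+ 2 + 1))%:E)) => //.
- by apply/measurable_EFinP; exact: measurable_xsin.
- by move=> x _; rewrite lee_fin (le_trans (norm_xsin_le c x))// ler_norm.
Qed.

Let gaussian_xsin c :
  \int[G]_x (x * sin (c * x))%:E = c%:E * \int[G]_x (cos (c * x))%:E.
Proof.
have icos := integrable_cosM G c.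
(* An even integrable majorant of [|cfun c|]: after adding it, the lemma on nonnegative even
   integrands reduces the claim to the half-line. *)
pose M x : R := ((1 + `|c|) * (x ^+ 2 + 1))%R.
have iM : G.-integrable [set: R] (EFin \o M) := integrable_sqrD1 (1 + `|c|)%R.
have cM : continuous M.
  move=> x; apply: cvgM; first exact: cvg_cst.
  by apply: cvgD; [exact: exprn_continuous|exact: cvg_cst].
have M0 x : (0 <= M x)%R by rewrite mulr_ge0// addr_ge0// sqr_ge0.
have u0 x : (0 <= cfun c x + M x)%R.
  have h1 : (- (x ^+ 2 + 1) <= x * sin (c * x))%R.
    by have := norm_xsin_le c x; rewrite mul1r ler_norml => /andP[].
  have h2 : (c * cos (c * x) <= `|c|)%R.
    by rewrite (le_trans (ler_norm _))// normrM ler_piMr// ler_norml cos_geN1 cos_le1.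
  have h3 : (`|c| <= `|c| * (x ^+ 2 + 1))%R by rewrite ler_peMr// lerDr sqr_ge0.
  by rewrite /cfun /M mulrDl mul1r; lra.
have cu : continuous (fun x => cfun c x + M x)%R.
  by move=> x; apply: cvgD; [exact: continuous_cfun|exact: cM].
have cfunN x : cfun c (- x)%R = cfun c x.
  by rewrite /cfun mulrN sinN cosN mulrNN.
have MN x : M (- x)%R = M x by rewrite /M sqrrN.
have main : \int[G]_x (cfun c x + M x)%:E = \int[G]_x (M x)%:E.
  rewrite !even_integral_gaussian//; last first.
    by move=> x; rewrite cfunN MN.
  congr (_ * _).
  have iMb : leb.-integrable `[0%R, +oo[ (fun x => (M x * gaussian_pdf x)%:E).
    apply/integrableP; split.
      apply/measurable_EFinP; apply: measurable_funTS; apply: measurable_onR.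
      apply: measurable_funM; last exact: measurable_gaussian_pdf.
      exact: continuous_measurable_fun.
    rewrite (_ : \int[leb]_(x in _) `|_| =
        \int[leb]_(x in `[0%R, +oo[) (M x * gaussian_pdf x)%:E); last first.
      by apply: eq_integral => x _ /=; rewrite ger0_norm// mulr_ge0// gaussian_pdf_ge0.
    have := integrableP _ _ _ iM => -[_].
    rewrite (_ : \int[G]_x `|_| = \int[G]_x (M x)%:E); last first.
      by apply: eq_integral => x _ /=; rewrite ger0_norm.
    rewrite even_integral_gaussian//; apply: le_lt_trans.
    rewrite -[leLHS]mul1e; apply: lee_wpmul2r; last by rewrite lee_fin; lra.
    by apply: integral_ge0 => x _; rewrite lee_fin mulr_ge0// gaussian_pdf_ge0.
  transitivity (\int[leb]_(x in `[0%R, +oo[) ((cfun c x * gaussian_pdf x)%:E + (M x * gaussian_pdf x)%:E)).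
    by apply: eq_integral => x _; rewrite mulrDl EFinD.
  by rewrite integralD// ?integral_cfun ?add0e//; exact: integrable_cfun.
have icc : G.-integrable [set: R] (fun x => c%:E * (cos (c * x))%:E) by exact: integrableZl.
have ixs := integrable_xsin c.
have : \int[G]_x (cfun c x)%:E + \int[G]_x (M x)%:E = 0 + \int[G]_x (M x)%:E.
  rewrite add0e -[RHS]main -integralD//.
  exact: (integrableB measurableT ixs icc).
move/(congr1 (fun z => z - \int[G]_x (M x)%:E)); rewrite !addeK ?integrable_fin_num//.
rewrite (_ : \int[G]_x (cfun c x)%:E = \int[G]_x ((x * sin (c * x))%:E - c%:E * (cos (c * x))%:E))//.
have fa := integrable_fin_num measurableT ixs.
have fb := integrable_fin_num measurableT icc.
rewrite integralB// -integralZl//; move: fa fb.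
move=> /fineK <- /fineK <-; rewrite -EFinB => -[] /eqP.
by rewrite subr_eq0 => /eqP ->.
Qed.

(** Differentiating under the integral, dominated by [x^2 + 1], and applying [gaussian_xsin] gives
    [psi' c = - c * psi c]; hence [psi c * e^(c^2 / 2)] is constant. *)
Lemma gaussian_cos c : \int[G]_x (cos (c * x))%:E = (expR (- (c ^+ 2 / 2)))%:E.
Proof.
pose psi c : R := (\int[G]_x cos (c * x))%R.
have psiE c' : \int[G]_x (cos (c' * x))%:E = (psi c')%:E.
  by rewrite /psi /Rintegral fineK//; exact: integrable_fin_num (integrable_cosM G c').
have dcos (c' x : R) : is_derive c' 1%R (fun c => cos (c * x))%R (- (x * sin (c' * x)))%R.
  have dc : is_derive c' 1%R (fun c => c * x)%R x.
    have := is_derive_affine 0%R x c'.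
    by rewrite (_ : (fun u => 0 + x * u)%R = (fun u : R => u * x)%R)//; apply/funext => u; rewrite add0r mulrC.
  have := @is_derive1_comp R cos (fun c => c * x)%R c' _ x (is_derive_cos _) dc.
  by rewrite mulNr mulrC.
have hN (c' : R) : \int[G]_x (- (x * sin (c' * x)))%:E = (- (c' * psi c'))%:E.
  rewrite -mulN1r EFinM [(c' * _)%:E]EFinM -psiE -gaussian_xsin.
  rewrite -(integralZl measurableT (integrable_xsin c')).
  by apply: eq_integral => x _; rewrite -EFinM mulN1r.
have dpsi c' : is_derive c' 1%R psi (- (c' * psi c'))%R.
  have Ia : `](c' - 1)%R, (c' + 1)%R[%classic c' by rewrite /= in_itv/=; lra.
  have intf : forall x : R, `](c' - 1)%R, (c' + 1)%R[%classic x ->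
      G.-integrable [set: R] (EFin \o (fun c x => cos (c * x))%R x).
    by move=> x _; exact: integrable_cosM.
  have derf : forall (x y : R), `](c' - 1)%R, (c' + 1)%R[%classic x -> [set: R] y ->
      derivable (fun c => cos (c * y))%R x 1%R.
    by move=> x y _ _; have [] := dcos x y.
  have B0 (y : R) : (0 <= 1 * (y ^+ 2 + 1))%R by rewrite mul1r addr_ge0// sqr_ge0.
  have B (x y : R) : `](c' - 1)%R, (c' + 1)%R[%classic x -> [set: R] y ->
      (`|partial1of2 (fun c x => cos (c * x))%R x y| <= 1 * (y ^+ 2 + 1))%R.
    by move=> _ _; rewrite partial1of2E; have [_ ->] := dcos x y; rewrite normrN norm_xsin_le.
  split; first exact: (derivable_under_integral measurableT Ia intf derf B0 (integrable_sqrD1 1%R) B).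
  rewrite -derive1E (differentiation_under_integral measurableT Ia intf derf B0 (integrable_sqrD1 1%R) B).
  apply: (congr1 fine (y := (- (c' * psi c'))%:E)); rewrite -hN.
  by apply: eq_integral => x _; rewrite partial1of2E; have [_ ->] := dcos c' x.
have h0 : psi 0%R = 1%R.
  apply: EFin_inj; rewrite -psiE.
  under eq_integral do rewrite mul0r cos0.
  by rewrite integral_cst// -[RHS]mule1 -(probability_setT G).
pose q c : R := (psi c * expR (2^-1 * c ^+ 2))%R.
have dq (x : R) : is_derive x 1%R q 0%R.
  have d1 := is_derive_monomial 1 (2^-1)%R x.
  have d2 := @is_derive1_comp R expR (fun x => 2^-1 * x ^+ 2)%R x _ _ (is_derive_expR _) d1.
  have := is_deriveM (dpsi x) d2.
  rewrite /GRing.scale/=; set d := (X in is_derive _ _ _ X).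
  have -> // : d = 0%R.
  by rewrite /d; field.
have qc : q c = q 0%R by exact: is_derive_0_is_cst.
move: qc; rewrite /q h0 expr0n/= mulr0 expR0 mulr1 => qc.
have e0 : expR (2^-1 * c ^+ 2) != 0%R by rewrite gt_eqF ?expR_gt0.
rewrite psiE; congr EFin; rewrite expRN [(c ^+ 2 / 2)%R]mulrC.
by apply: (mulIf e0); rewrite qc mulVf.
Qed.

End gaussian_characteristic_function.

(** * Sums of random signs *)

Section rademacher_base.
Context {R : realType}.
Implicit Types (a b c p x z : R).

Lemma cos_norm x : cos `|x| = cos x.
Proof. by have [_|_] := ger0P x; rewrite ?cosN. Qed.

Lemma norm_cos_le1 x : `|cos x| <= 1.
Proof. by rewrite ler_norml cos_geN1 cos_le1. Qed.

Lemma norm_prod_cos_le1 (I : Type) (s : seq I) (f : I -> R) :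
  `|\prod_(i <- s) cos (f i)| <= 1.
Proof.
elim: s => [|i s IH]; first by rewrite big_nil normr1.
by rewrite big_cons normrM mulr_ile1// norm_cos_le1.
Qed.

Lemma powR_half_sqrt p (A : R) : 0 <= A -> A `^ (p / 2) = apow p (Num.sqrt A).
Proof.
move=> A0; rewrite /apow ger0_norm ?sqrtr_ge0// -powR12_sqrt// -powRrM.
by rewrite mulrC.
Qed.

Lemma expRN_mul_le z : z * expR (- z) <= 1 - expR (- z).
Proof.
have h := expR_ge1Dx z; have e0 := expR_gt0 (- z).
have : (1 + z) * expR (- z) <= 1.
  apply: (@le_trans _ _ (expR z * expR (- z))); first by rewrite ler_wpM2r// ltW.
  by rewrite expRN mulfV// gt_eqF ?expR_gt0.
by rewrite mulrDl mul1r; lra.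
Qed.

(** Induction on [s], the right-hand side not depending on [s]. For [a <= 2 <= pi] cosine decreases,
    so each factor satisfies [cos a <= cos (f i) <= exp (- f i ^ 2 / 2)]. *)
Lemma prod_cos_ge_pos (I : eqType) (s : seq I) (f : I -> R) a :
  0 <= a <= 2 -> 0 < cos a -> (forall i, i \in s -> `|f i| <= a) ->
  expR (- ((\sum_(i <- s) f i ^+ 2) / 2)) - cos a * \prod_(i <- s) cos (f i)
    <= 1 - cos a.
Proof.
move=> /andP[a0 a2] ca0; elim: s => [|i s IH] h.
  by rewrite !big_nil mul0r oppr0 expR0 mulr1.
have {}IH := IH (fun j js => h j (mem_behead (s := i :: s) js)).
have fia := h i (mem_head _ _).
rewrite !big_cons mulrDl opprD expRD.
set Q := expR (- (_ / 2)) in IH *; set C := \prod_(i <- s) _ in IH *.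
have Q1 : Q <= 1.
  by rewrite -expR0 ler_expR oppr_le0 divr_ge0// sumr_ge0// => j _; exact: sqr_ge0.
have cr : cos (f i) <= expR (- (f i ^+ 2 / 2)).
  rewrite -(cos_norm (f i)) -(real_normK (num_real (f i))); apply: cos_le_expR.
  by rewrite normr_ge0 (le_trans fia).
have ci : cos a <= cos (f i).
  rewrite -(cos_norm (f i)) leNgt; apply/negP => hlt.
  have pi2 := pi_ge2 R.
  have fi_pi : `|f i| \in `[0, pi] by rewrite in_itv/= normr_ge0/= (le_trans fia)// (le_trans a2).
  have a_pi : a \in `[0, pi] by rewrite in_itv/= a0 (le_trans a2).
  by move: hlt; rewrite (ltr_cos a_pi fi_pi) ltNge fia.
have c1 := cos_ge1B (f i); have c2 := cos_le1 (f i).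
have := expRN_mul_le (f i ^+ 2 / 2).
set r := expR (- (f i ^+ 2 / 2)) in cr *.
have z0 : 0 <= f i ^+ 2 / 2 by rewrite divr_ge0// sqr_ge0.
move: (f i ^+ 2 / 2) z0 c1 => z z0 c1 hz.
(* With [c = cos (f i)], split [r Q - cos a * c C] as [(r - c) Q + c (Q - cos a * C)]. The bounds
   [h3] and [h2] leave [cos a * (1 - c) <= 1 - r], which follows from [h1] and
   [z e^(-z) <= 1 - e^(-z)]. *)
have h1 : cos a * (1 - cos (f i)) <= r * z by apply: ler_pM; lra.
have h2 : cos (f i) * (Q - cos a * C) <= cos (f i) * (1 - cos a).
  by rewrite ler_wpM2l//; lra.
have h3 : (r - cos (f i)) * Q <= r - cos (f i) by rewrite ler_piMr//; lra.
nra.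
Qed.

(** The largest coefficient [a] is left out of the exponential at the price [a^2 / 2], exactly the
    amount its variance contributes in [fourier_compare]. If [cos a <= 0] or [|a| > 2], crude bounds
    suffice. *)
Lemma prod_cos_ge (I : eqType) (s : seq I) (f : I -> R) a :
  (forall i, i \in s -> `|f i| <= `|a|) ->
  expR (- ((\sum_(i <- s) f i ^+ 2) / 2)) - a ^+ 2 / 2 <=
    cos a * \prod_(i <- s) cos (f i).
Proof.
rewrite -(cos_norm a) -(real_normK (num_real a)).
move: `|a| (normr_ge0 a) => {}a a0 h.
have E1 : expR (- ((\sum_(i <- s) f i ^+ 2) / 2)) <= 1.
  by rewrite -expR0 ler_expR oppr_le0 divr_ge0// sumr_ge0// => j _; exact: sqr_ge0.
have C1 := norm_prod_cos_le1 s f; have ca := cos_ge1B a; have := norm_cos_le1 a.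
have [ca0|ca0] := leP (cos a) 0.
  rewrite ler0_norm// => ca1.
  have : cos a <= cos a * \prod_(i <- s) cos (f i).
    by move: C1; rewrite ler_norml => /andP[_ C1]; nra.
  lra.
move=> _; have [a2|a2] := leP a 2.
  have a02 : 0 <= a <= 2 by rewrite a0.
  by have := prod_cos_ge_pos a02 ca0 h; lra.
have : `|cos a * \prod_(i <- s) cos (f i)| <= 1.
  by rewrite normrM mulr_ile1// norm_cos_le1.
rewrite ler_norml => /andP[h1 _]; nra.
Qed.

End rademacher_base.

Section rademacher_gaussian.
Context {R : realType} {I : eqType}.
Local Open Scope ereal_scope.
Implicit Types (b : I -> R) (s : seq I) (p A : R).

Local Notation rad := (fun=> \d_(1%R : R) : probability R R).

Lemma dirac_sqr : \int[\d_(1%R : R)]_x (x ^+ 2)%:E = 1%R%:E.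
Proof.
by rewrite integral_dirac// ?diracT ?mul1e ?expr1n//; apply/measurable_EFinP; exact: measurable_funX.
Qed.

Lemma dirac_cos (c : R) : \int[\d_(1%R : R)]_x (cos (c * x))%:E = (cos c)%:E.
Proof.
rewrite integral_dirac// ?diracT ?mul1e ?mulr1//; apply/measurable_EFinP.
exact: measurable_cosM.
Qed.

Lemma iter_avg_apow2 (mu : probability R R) b s (m y : R) : \int[mu]_x (x ^+ 2)%:E = m%:E ->
  iter_avg (fun=> mu) b s (fun z => (apow 2 z)%:E) y =
    (y ^+ 2 + m * \sum_(i <- s) b i ^+ 2)%:E.
Proof.
move=> hm; pose psi (c : R) := fine (\int[mu]_x (cos (c * x))%:E).
have hpsi c : \int[mu]_x (cos (c * x))%:E = (psi c)%:E.
  by rewrite fineK//; exact: integrable_fin_num (integrable_cosM mu c).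
have := iter_avg_trig b s 0 0 1 0 hm hpsi y.
rewrite !mul0r add0r mul1r addr0 => <-; congr iter_avg; apply/funext => z.
by rewrite !mul0r add0r mul1r addr0 apow2.
Qed.

(** Presents a single Gaussian of variance [c^2] as an average over a one-element list, the form
    [fourier_compare] accepts. *)
Lemma iter_avg_gaussian1 p (c : R) : (1 < p)%R -> (0 <= c)%R ->
  iter_avg (fun=> gaussian_law) (fun=> c) [:: tt] (fun z => (apow p z)%:E) 0%R =
  gaussian_moment p * (apow p c)%:E.
Proof.
move=> p1 c0 /=; rewrite sym_avg_apow muleC -ge0_integralZl//.
- by apply: eq_integral => x _; rewrite /symp add0r sub0r apowN apowM -EFinM; congr EFin; field.
- exact: measurable_EFin_apow.
- by move=> x _; rewrite lee_fin apow_ge0.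
- by rewrite lee_fin apow_ge0.
Qed.

Lemma rademacher_base p A b s i0 : (2 < p < 4)%R -> i0 \in s -> uniq s ->
  (0 <= A <= \sum_(i <- s | i != i0) b i ^+ 2)%R ->
  (forall i, i \in s -> `|b i| <= `|b i0|)%R ->
  gaussian_moment p * (A `^ (p / 2))%:E <=
    iter_avg rad b s (fun z => (apow p z)%:E) 0%R.
Proof.
move=> p24 is0 us /andP[A0 AS] bmax; have /andP[p2 p4] := p24.
rewrite powR_half_sqrt//.
rewrite -iter_avg_gaussian1 ?sqrtr_ge0//; last by lra.
apply: (fourier_compare p24 gaussian_sqr gaussian_cos dirac_sqr dirac_cos) => t t0.
rewrite !big_seq1 exprMn sqr_sqrtr// !mul1r.
set S := (\sum_(i <- s | i != i0) b i ^+ 2)%R in AS *.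
have fmax i : i \in rem i0 s -> (`|t * b i| <= `|t * b i0|)%R.
  by move/mem_rem => is_; rewrite !normrM ler_wpM2l ?bmax.
have := prod_cos_ge fmax; rewrite exprMn.
have SE : (\sum_(i <- rem i0 s) (t * b i) ^+ 2 = t ^+ 2 * S)%R.
  rewrite rem_filter// big_filter /S mulr_sumr.
  by apply: eq_bigr => i _; rewrite exprMn.
have sE : (\sum_(i <- s) b i ^+ 2 = b i0 ^+ 2 + S)%R.
  by rewrite (perm_big _ (perm_to_rem is0)) big_cons rem_filter// big_filter.
have -> : (\prod_(i <- s) cos (t * b i) = cos (t * b i0) * \prod_(i <- rem i0 s) cos (t * b i))%R.
  by rewrite (perm_big _ (perm_to_rem is0)) big_cons.
rewrite SE sE.
have v0 : (0 <= t ^+ 2 / 2)%R by rewrite divr_ge0// sqr_ge0.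
(* [u + e^(-u)] is nondecreasing for [u >= 0]; this allows any [A] below the remaining variance
   [S]. *)
have hexp : (t ^+ 2 * A / 2 + expR (- (t ^+ 2 * A / 2)) <= t ^+ 2 * S / 2 + expR (- (t ^+ 2 * S / 2)))%R.
  have : (t ^+ 2 * A / 2 <= t ^+ 2 * S / 2)%R.
    by rewrite ler_pM2r// ler_wpM2l// sqr_ge0.
  have : (0 <= t ^+ 2 * A / 2)%R by rewrite divr_ge0// mulr_ge0// sqr_ge0.
  move: (t ^+ 2 * A / 2)%R (t ^+ 2 * S / 2)%R => u w u0 uw.
  have h := expRN_mul_le (w - u)%R.
  have -> : (- w = - u + - (w - u))%R by ring.
  rewrite expRD.
  have e1 : (expR (- u) <= 1)%R by rewrite -expR0 ler_expR oppr_le0.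
  have e2 : (1 - expR (- (w - u)) <= w - u)%R by have := expR_ge1Dx (- (w - u))%R; lra.
  have e3 : (0 <= 1 - expR (- (w - u)))%R.
    by rewrite subr_ge0 -expR0 ler_expR oppr_le0 subr_ge0.
  have : (expR (- u) * (1 - expR (- (w - u))) <= 1 * (w - u))%R.
    by apply: ler_pM => //; rewrite expR_ge0.
  by lra.
by lra.
Qed.

End rademacher_gaussian.

(** * Induction on the exponent for sign sums *)

Section sign_averages.
Context {R : realType} {I : eqType}.
Implicit Types (b : I -> R) (s : seq I) (p A y : R) (f g : R -> R).

Local Notation rad := (fun=> \d_(1%R : R) : probability R R).

(** The sign average with real values: integration by parts involves signed functions and
    differences, which [iter_avg] does not handle. *)
Fixpoint rad_avg b s f y : R :=
  if s is i :: s' then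
    2^-1 * (rad_avg b s' f (y + b i) + rad_avg b s' f (y - b i))
  else f y.

Lemma rad_avgE b s f : (forall z, 0 <= f z) -> measurable_fun [set: R] f ->
  iter_avg rad b s (fun z => (f z)%:E) = (fun y => (rad_avg b s f y)%:E).
Proof.
move=> f0 mf; elim: s => [//|i s IH] /=; apply/funext => y.
have F0 z : (0 <= (f z)%:E)%E by rewrite lee_fin.
have mF : measurable_fun [set: R] (fun z => (f z)%:E) by exact/measurable_EFinP.
have mI := measurable_iter_avg rad b s F0 mF.
rewrite /sym_avg integral_dirac//; last exact: measurable_sym_avg_integrand.
by rewrite IH diracT mul1e !mulr1 -EFinD -EFinM.
Qed.

Lemma le_rad_avg b s f g y : (forall z, f z <= g z) ->
  rad_avg b s f y <= rad_avg b s g y.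
Proof. by move=> fg; elim: s y => [//|i s IH] y /=; rewrite ler_pM2l// lerD. Qed.

Lemma rad_avg_shift b s f (c y : R) :
  rad_avg b s (fun z => f (z + c)) y = rad_avg b s f (y + c).
Proof.
by elim: s y => [//|i s IH] y /=; rewrite !IH [y + b i + c]addrAC [y - b i + c]addrAC.
Qed.

Lemma rad_avg_lin b s f g (k l y : R) :
  rad_avg b s (fun z => k * f z + l * g z) y = k * rad_avg b s f y + l * rad_avg b s g y.
Proof. by elim: s y => [//|i s IH] y /=; rewrite !IH; ring. Qed.

Lemma rad_avgZ b s f (k y : R) :
  rad_avg b s (fun z => k * f z) y = k * rad_avg b s f y.
Proof. by elim: s y => [//|i s IH] y /=; rewrite !IH; ring. Qed.

(* Integration by parts on the discrete cube. *)
Lemma rad_avg_by_parts b s f y : uniq s ->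
  rad_avg b s (fun z => z * f z) y = y * rad_avg b s f y +
    \sum_(i <- s) b i *
      rad_avg b (rem i s) (fun z => 2^-1 * f (z + b i) + (- 2^-1) * f (z - b i)) y.
Proof.
elim: s y => [|j s IH] y /=; first by rewrite big_nil addr0.
move=> /andP[js us]; rewrite !IH// big_cons eqxx rad_avg_lin.
rewrite (rad_avg_shift b s f (b j)) (rad_avg_shift b s f (- b j)).
have -> : \sum_(i <- s) b i * rad_avg b (if j == i then s else j :: rem i s)
    (fun z => 2^-1 * f (z + b i) + (- 2^-1) * f (z - b i)) y =
  2^-1 * (\sum_(i <- s) b i * rad_avg b (rem i s)
    (fun z => 2^-1 * f (z + b i) + (- 2^-1) * f (z - b i)) (y + b j) +
  \sum_(i <- s) b i * rad_avg b (rem i s)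
    (fun z => 2^-1 * f (z + b i) + (- 2^-1) * f (z - b i)) (y - b j)).
  rewrite -big_split mulr_sumr; apply: eq_big_seq => i is_ /=.
  have /negPf -> : j != i by apply: contraNneq js => ->.
  by rewrite /=; ring.
by ring.
Qed.

(** Write [|S|^p] as [S * spow (p - 1) S], integrate by parts, and bound each discrete derivative of
    [spow (p - 1)] by [dsymp1_ge]. *)
Lemma rad_avg_apow_ge b s p : 3 <= p -> uniq s ->
  (p - 1) * \sum_(i <- s) b i ^+ 2 * rad_avg b (rem i s) (apow (p - 2)) 0 <=
  rad_avg b s (apow p) 0.
Proof.
move=> p3 us; have p1 : 1 < p by lra.
have -> : apow p = (fun z => z * spow (p - 1) z) :> (R -> R).
  by apply/funext => z; rewrite mulr_spow.
rewrite rad_avg_by_parts// mul0r add0r mulr_sumr; apply: ler_sum => i _.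
rewrite -3!rad_avgZ; apply: le_rad_avg => z.
have p0 : 0 < p by lra.
rewrite -(ler_pM2l p0).
have := dsymp1_ge z (b i) p3; rewrite /dsymp !mulr1 => h.
apply: le_trans (le_trans h _); last by rewrite le_eqVlt; apply/orP; left; apply/eqP; field.
by rewrite le_eqVlt; apply/orP; left; apply/eqP; field.
Qed.

Lemma uniq_sum_rem b s (D : seq I) i (F : I -> R) : uniq s -> i \in s ->
  \sum_(j <- rem i s | j \notin D) F j = \sum_(j <- s | j \notin i :: D) F j.
Proof.
move=> us is_; rewrite rem_filter// big_filter_cond; apply: eq_bigl => j.
by rewrite in_cons negb_or.
Qed.

Local Open Scope ereal_scope.

(** The hypothesis on [A] allows any [k] indices to be deleted because the recursion deletes every
    [i] in turn; after one deletion it holds for [k - 1] and [p - 2]. *)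
Lemma rademacher_moment_ge b (k : nat) p A s : uniq s ->
  (2 <= p <= 2 * k.+1%:R)%R -> (0 <= A)%R ->
  (forall D : seq I, (size D <= k)%N -> (A <= \sum_(i <- s | i \notin D) b i ^+ 2)%R) ->
  gaussian_moment p * (A `^ (p / 2))%:E <=
    iter_avg rad b s (fun z => (apow p z)%:E) 0%R.
Proof.
elim: k p s => [|k IH] p s us /andP[p2 pk] A0 hA.
all: have AS : (A <= \sum_(i <- s) b i ^+ 2)%R by have := hA [::] isT; rewrite big_mkcond.
(* [p = 2] is treated apart: the cosine mixture needs [p > 2], and the recursion from [p = 4] lands
   here. *)
all: have base : p = 2%R -> gaussian_moment p * (A `^ (p / 2))%:E <=
    iter_avg rad b s (fun z => (apow p z)%:E) 0%R.
1,3: move=> ->; rewrite (iter_avg_apow2 _ _ _ (@dirac_sqr R)) gaussian_moment2 mul1e.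
1,2: by rewrite divff// powRr1// lee_fin expr0n/= add0r mul1r.
  by apply: base; lra.
have [/base//|pn2] := eqVneq p 2%R.
have {base} p2' : (2 < p)%R by rewrite lt_def pn2.
have [p4|p4] := ltP p 4%R.
  case: s us hA AS => [|i1 s] us hA AS.
    move: AS; rewrite big_nil => A0'.
    have -> : A = 0%R by apply/eqP; rewrite eq_le A0'.
    rewrite powR0 ?mule0 ?iter_avg_ge0//.
    - by move=> z; rewrite lee_fin apow_ge0.
    - exact: measurable_EFin_apow.
    - by rewrite gt_eqF// divr_gt0//; lra.
  have [i0 i0s i0max] : exists2 i0, i0 \in i1 :: s &
      (forall i, i \in i1 :: s -> `|b i| <= `|b i0|)%R.
    elim: (s) i1 {us hA AS} => [|j r IHr] i1.
      by exists i1; rewrite ?mem_head// => i; rewrite inE => /eqP ->.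
    have [i0 i0r i0max] := IHr j.
    have [h|h] := leP `|b i0|%R `|b i1|%R.
      exists i1; first exact: mem_head.
      move=> i; rewrite inE => /predU1P[->//|ir].
      by rewrite (le_trans (i0max i ir)).
    exists i0; first by rewrite in_cons i0r orbT.
    by move=> i; rewrite in_cons => /predU1P[->|/i0max//]; exact: ltW.
  have p24 : (2 < p < 4)%R by rewrite p2'.
  apply: (rademacher_base p24 i0s us) => //; rewrite A0/=.
  have := hA [:: i0] (ltn0Sn _).
  by congr (_ <= _)%R; apply: eq_bigl => i; rewrite mem_seq1.
have mE i : iter_avg rad b (rem i s) (fun z => (apow (p - 2) z)%:E) 0%R =
    (rad_avg b (rem i s) (apow (p - 2)) 0)%:E.
  by rewrite rad_avgE//; [move=> z; exact: apow_ge0|exact: measurable_apow].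
have [p3 p1] : (3 <= p /\ 1 < p - 2)%R by split; lra.
have mfin : gaussian_moment (p - 2) \is a fin_num.
  by rewrite ge0_fin_numE ?gaussian_moment_ge0// gaussian_moment_lty.
rewrite rad_avgE; [|by move=> z; exact: apow_ge0|exact: measurable_apow].
apply: le_trans (_ : _ <= ((p - 1) * \sum_(i <- s) b i ^+ 2 * rad_avg b (rem i s) (apow (p - 2)) 0)%:E) _; last first.
  by rewrite lee_fin; exact: rad_avg_apow_ge.
rewrite gaussian_moment_rec//; move: mfin => /fineK mfin.
rewrite -mfin -!EFinM lee_fin -mulrA ler_pM2l; last by lra.
set m := fine _ in mfin *.
have m0 : (0 <= m)%R by rewrite fine_ge0// gaussian_moment_ge0.
have IHi i : i \in s -> (m * A `^ ((p - 2) / 2) <= rad_avg b (rem i s) (apow (p - 2)) 0)%R.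
  move=> is_; rewrite -lee_fin -mE EFinM mfin; apply: IH => //.
  - exact: rem_uniq.
  - by move: pk; rewrite -[k.+2%:R]natr1 => pk'; apply/andP; split; lra.
  - move=> D Dk; rewrite (uniq_sum_rem b D _ us is_); exact: hA.
(* The weights [b i ^ 2] sum to at least [A], which raises [A^((p-2)/2)] to [A^(p/2)]. *)
apply: (@le_trans _ _ (\sum_(i <- s) b i ^+ 2 * (m * A `^ ((p - 2) / 2)))%R).
  rewrite -mulr_suml mulrCA; apply: ler_wpM2l => //.
  have -> : (p / 2 = 1 + (p - 2) / 2)%R by field.
  rewrite powRD ?powRr1// ?ler_wpM2r ?powR_ge0//.
  by apply/implyP => /eqP; lra.
rewrite big_seq [leRHS]big_seq; apply: ler_sum => i is_.
by rewrite ler_wpM2l ?sqr_ge0// IHi.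
Qed.

End sign_averages.

(** * Sums of Laplace variables *)

Section exponential_upper.
Context {R : realType}.
Local Open Scope ereal_scope.
Local Notation leb := (@lebesgue_measure R).
Implicit Types (p x y b t : R).

(** On [[0, N]] the integrals of [u] and [v] differ by [F N - F 0 <= - F 0]; then [N] tends to
    infinity by monotone convergence. Only the sign of [F] enters, and either integral may be
    infinite. *)
Lemma ge0_integral_itvcy_le (F u v : R -> R) :
  (forall x : R, is_derive x 1%R F (u x - v x)%R) -> continuous u -> continuous v ->
  (forall x, 0 <= x -> 0 <= u x)%R -> (forall x, 0 <= x -> 0 <= v x)%R ->
  (forall x, 0 <= x -> F x <= 0)%R ->
  \int[leb]_(x in `[0%R, +oo[) (u x)%:E <=
    (- F 0)%:E + \int[leb]_(x in `[0%R, +oo[) (v x)%:E.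
Proof.
move=> dF cu cv u0 v0 F0.
have cont_int (f : R -> R) (N : R) : continuous f ->
    leb.-integrable `[0%R, N] (fun x => (f x)%:E).
  move=> cf; apply: continuous_compact_integrable; first exact: segment_compact.
  exact: continuous_subspaceT.
have mf (f : R -> R) (D : set (measurableTypeR R)) : continuous f -> measurable D ->
    measurable_fun D (fun x : measurableTypeR R => (f x)%:E).
  move=> cf mD; apply: measurable_funTS; apply/measurable_EFinP.
  by apply: measurable_onR; exact: continuous_measurable_fun.
have fin (N : nat) : \int[leb]_(x in `[0%R, N%:R]) (u x)%:E <=
    (- F 0)%:E + \int[leb]_(x in `[0%R, +oo[) (v x)%:E.
  case: N => [|N].
    rewrite set_itv1 integral_set1 adde_ge0//.
      by rewrite lee_fin oppr_ge0 F0.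
    by apply: integral_ge0 => x; rewrite /= in_itv/= andbT lee_fin => /v0.
  have N0 : (0 < N.+1%:R :> R)%R by [].
  have iu := cont_int u N.+1%:R cu; have iv := cont_int v N.+1%:R cv.
  have cF (x : R) : {for x, continuous F}.
    by apply/differentiable_continuous/derivable1_diffP; have [] := dF x.
  have E : \int[leb]_(x in `[0%R, N.+1%:R]) (u x - v x)%:E = (F N.+1%:R)%:E - (F 0)%:E.
    apply: continuous_FTC2 => //.
    - by apply: continuous_subspaceT => x; apply: cvgB; [exact: cu|exact: cv].
    - split.
      + by move=> x _; have [] := dF x.
      + exact/cvg_at_right_filter/cF.
      + exact/cvg_at_left_filter/cF.
    - by move=> x _; rewrite derive1E; exact: derive_val.
  have mI : measurable (`[0%R, N.+1%:R]%classic : set (measurableTypeR R)).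
    exact: measurable_itv.
  have fu := integrable_fin_num mI iu; have fv := integrable_fin_num mI iv.
  have vle : \int[leb]_(x in `[0%R, N.+1%:R]) (v x)%:E <= \int[leb]_(x in `[0%R, +oo[) (v x)%:E.
    apply: ge0_subset_integral => //.
    - by apply: mf.
    - by move=> x; rewrite /= in_itv/= andbT lee_fin => /v0.
    - by move=> x; rewrite /= !in_itv/= andbT => /andP[].
  apply: le_trans (leeD (lexx (- F 0)%:E) vle).
  have {}E : \int[leb]_(x in `[0%R, N.+1%:R]) (u x)%:E - \int[leb]_(x in `[0%R, N.+1%:R]) (v x)%:E =
      (F N.+1%:R)%:E - (F 0)%:E by rewrite -E -integralB.
  move: E; rewrite -(fineK fu) -(fineK fv).
  rewrite -!EFinB -EFinD => -[] E; rewrite lee_fin.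
  by have := F0 _ (ltW N0); lra.
have IE : \bigcup_(N : nat) `[0%R, N%:R : R]%classic = `[0%R, +oo[%classic.
  apply/seteqP; split => x /=; rewrite in_itv/= andbT.
    by move=> [N _] /=; rewrite in_itv/= => /andP[].
  move=> x0; exists (Num.trunc x).+1 => //=; rewrite in_itv/= x0/=.
  by rewrite ltW// truncnS_gt.
have ndI : nondecreasing_seq (fun N : nat => (`[0%R, N%:R : R]%classic : set (measurableTypeR R))).
  move=> m n mn; apply/subsetPset => x /=; rewrite !in_itv/= => /andP[-> xm]/=.
  by rewrite (le_trans xm)// ler_nat.
have mI (N : nat) : measurable (`[0%R, N%:R : R]%classic : set (measurableTypeR R)).
  exact: measurable_itv.
have uI (N : nat) (x : measurableTypeR R) : (`[0%R, N%:R : R]%classic x -> 0 <= (u x)%:E).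
  by rewrite /= in_itv/= => /andP[x0 _]; rewrite lee_fin u0.
have cvI := ge0_nondecreasing_set_cvg_integral (mu := leb) ndI mI (fun N => mf u _ cu (mI N)) uI.
rewrite IE in cvI; rewrite -(cvg_lim _ cvI)//; apply: lime_le; last first.
  by apply: nearW => N; exact: fin.
by apply/cvg_ex; eexists; exact: cvI.
Qed.

Let continuous_sym_kernel p y b t :
  (1 < p)%R -> continuous (fun x => symp p y b x * (t * expR (- t * x)))%R.
Proof.
move=> p1 x; apply: cvgM; first exact: continuous_symp.
by apply: cvgM; [exact: cvg_cst|exact: continuous_expRN].
Qed.

(* For a symmetrized exponential average K, K f = f + (b / t)^2 K f''; only one
   inequality is needed, which spares the growth estimate at infinity. *)
Lemma exponential_sym_avg_apow_le t (t0 : (0 < t)%R) b y p : (4 <= p)%R ->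
  sym_avg (exponential_law t0) b (fun z => (apow p z)%:E) y <=
  (apow p y)%:E + (p * (p - 1) * b ^+ 2 / t ^+ 2)%:E *
    sym_avg (exponential_law t0) b (fun z => (apow (p - 2) z)%:E) y.
Proof.
move=> p4; rewrite !sym_avg_apow.
have p1 : (1 < p)%R by lra. have p2 : (2 < p)%R by lra. have p12 : (1 < p - 2)%R by lra.
rewrite !ge0_integral_exponential//; try exact: measurable_symp; try by move=> x; exact: symp_ge0.
have tn0 : t != 0%R by rewrite gt_eqF.
pose k := (p * (p - 1) * b ^+ 2 / t ^+ 2)%R.
have k0 : (0 <= k)%R by rewrite divr_ge0 ?sqr_ge0// mulr_ge0 ?sqr_ge0// mulr_ge0; lra.
(* The boundary term of two integrations by parts against [t e^(-t x)], each moving one derivative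
   onto [symp]. *)
pose F x := (- expR (- t * x) * (symp p y b x + t^-1 * dsymp p y b x))%R.
have dF (x : R) : is_derive x 1%R F (symp p y b x * (t * expR (- t * x)) -
    k * (symp (p - 2) y b x * (t * expR (- t * x))))%R.
  have d1 := is_deriveN (is_derive_expRN t x).
  have d2 := is_deriveD (is_derive_symp y b x p1) (is_deriveZ t^-1%R (is_derive_dsymp y b x p2)).
  have := is_deriveM d1 d2; rewrite /GRing.scale/=; set d := (X in is_derive _ _ _ X).
  have -> // : d = (symp p y b x * (t * expR (- t * x)) -
    k * (symp (p - 2) y b x * (t * expR (- t * x))))%R.
  have alg (e f g h : R) : (- e * (g + t^-1 * (p * (p - 1) * b ^+ 2 * h)) +
      (f + t^-1 * g) * - (- t * e) = f * (t * e) - k * (h * (t * e)))%R.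
    by rewrite /k; field.
  exact: alg.
have := @ge0_integral_itvcy_le F _ _ dF.
rewrite {2}/F mulr0 expR0 symp0 dsymp0 mulr0 addr0 mulN1r opprK -/k => h.
rewrite -ge0_integralZl//; last 2 first.
- apply: measurable_funTS; apply/measurable_EFinP; apply: measurable_onR.
  by apply: continuous_measurable_fun; exact: continuous_sym_kernel.
- by move=> x _; rewrite lee_fin mulr_ge0 ?symp_ge0// mulr_ge0 ?expR_ge0// ltW.
have ker0 q x : (0 <= symp q y b x * (t * expR (- t * x)))%R.
  by rewrite mulr_ge0 ?symp_ge0// mulr_ge0 ?expR_ge0// ltW.
apply: h.
- exact: continuous_sym_kernel.
- by move=> x; apply: cvgM; [exact: cvg_cst|exact: continuous_sym_kernel].
- by move=> x _; exact: ker0.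
- by move=> x _; apply: mulr_ge0 => //; exact: ker0.
- move=> x x0; rewrite /F mulNr oppr_le0 mulr_ge0 ?expR_ge0// addr_ge0 ?symp_ge0//.
  by rewrite mulr_ge0 ?dsymp_ge0// invr_ge0 ltW.
Qed.

End exponential_upper.

(** * Induction on the exponent for Laplace sums *)

Section exponential_moment.
Context {R : realType} {I : eqType}.
Implicit Types (b x : I -> R) (s : seq I) (p t v M z : R).

Lemma expRN_mulB_le z : 0 <= z -> expR (- z) * (1 - expR (- z)) <= 1 - (1 + z)^-1.
Proof.
move=> z0; have z1 : 0 < 1 + z by lra.
have h : expR (- z) <= (1 + z)^-1 by rewrite expRN lef_pV2 ?posrE ?expR_gt0// expR_ge1Dx.
have h2 : 1 - expR (- z) <= z by have := expR_ge1Dx (- z); lra.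
apply: (@le_trans _ _ ((1 + z)^-1 * z)).
  by apply: ler_pM; rewrite ?expR_ge0// subr_ge0 -expR0 ler_expR oppr_le0.
by rewrite le_eqVlt; apply/orP; left; apply/eqP; field; lra.
Qed.

(** At [v = u^2 / 2] the factors are characteristic functions of Laplace variables of variance
    [x i]. Giving the Gaussian an extra variance [M] costs [M v], which the variance term of
    [fourier_compare] returns. The induction mirrors [prod_cos_ge_pos]. *)
Lemma prod_invD1_le x s M v : 0 <= M -> 0 <= v ->
  (forall i, i \in s -> 0 <= x i <= M) ->
  \prod_(i <- s) (1 + x i * v)^-1 <= expR (- ((\sum_(i <- s) x i + M) * v)) + M * v.
Proof.
move=> M0 v0 h; have Mv0 : 0 <= M * v by rewrite mulr_ge0.
suff : \prod_(i <- s) (1 + x i * v)^-1 - expR (- (M * v)) * expR (- (\sum_(i <- s) x i * v))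
    <= 1 - expR (- (M * v)).
  rewrite -expRD -opprD -mulr_suml -mulrDl [M + _]addrC.
  by have := expR_ge1Dx (- (M * v)); lra.
elim: s h => [|i s IH] h; first by rewrite !big_nil oppr0 expR0 mulr1.
have {}IH := IH (fun j js => h j (mem_behead (s := i :: s) js)).
have /andP[xi0 xiM] := h i (mem_head _ _).
have S0 : 0 <= \sum_(j <- s) x j * v.
  rewrite big_seq; apply: sumr_ge0 => j js; rewrite mulr_ge0//.
  by have /andP[] := h j (mem_behead (s := i :: s) js).
rewrite !big_cons opprD expRD.
set C := \prod_(j <- s) _ in IH *; set Q := expR (- \sum_(j <- s) _) in IH *.
have Q1 : Q <= 1 by rewrite -expR0 ler_expR oppr_le0.
set r := expR (- (M * v)) in IH *.
have z0 : 0 <= x i * v by rewrite mulr_ge0.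
have rr : r <= expR (- (x i * v)) by rewrite ler_expR lerN2 ler_wpM2r.
have r0 : 0 <= r by exact: expR_ge0.
have h1 := expRN_mulB_le z0.
have h2 : expR (- (x i * v)) <= (1 + x i * v)^-1.
  by rewrite expRN lef_pV2 ?posrE ?expR_gt0 ?expR_ge1Dx//; lra.
have h3 : expR (- (x i * v)) <= 1 by rewrite -expR0 ler_expR oppr_le0.
have h4 : 0 <= (1 + x i * v)^-1 by rewrite invr_ge0; lra.
move: (expR (- (x i * v))) ((1 + x i * v)^-1) rr h1 h2 h3 h4 => e rho rr h1 h2 h3 h4.
(* Split [rho C - r e Q] as [rho (C - r Q) + r (rho - e) Q]; what remains is [r (1 - e) <= 1 - rho],
   true by [r <= e] and [expRN_mulB_le]. *)
have k1 : rho * (C - r * Q) <= rho * (1 - r) by rewrite ler_wpM2l.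
have k2 : r * (rho - e) * Q <= r * (rho - e).
  by rewrite ler_piMr// mulr_ge0//; lra.
have k3 : r * (1 - e) <= e * (1 - e) by rewrite ler_wpM2r//; lra.
lra.
Qed.

Local Open Scope ereal_scope.

Lemma exponential_base t (t0 : (0 < t)%R) b s p M : (2 < p < 4)%R ->
  (0 <= M)%R -> (forall i, i \in s -> 2 * b i ^+ 2 / t ^+ 2 <= M)%R ->
  iter_avg (fun=> exponential_law t0) b s (fun z => (apow p z)%:E) 0%R <=
  gaussian_moment p * ((\sum_(i <- s) 2 * b i ^+ 2 / t ^+ 2 + M) `^ (p / 2))%:E.
Proof.
move=> p24 M0 bM; have /andP[p2 p4] := p24.
have x0 i : (0 <= 2 * b i ^+ 2 / t ^+ 2)%R by rewrite divr_ge0 ?sqr_ge0// mulr_ge0// sqr_ge0.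
have SM0 : (0 <= \sum_(i <- s) 2 * b i ^+ 2 / t ^+ 2 + M)%R by rewrite addr_ge0// sumr_ge0.
rewrite powR_half_sqrt//.
rewrite -iter_avg_gaussian1 ?sqrtr_ge0//; last by lra.
have hc c := exponential_cos c t0.
apply: (fourier_compare p24 (exponential_sqr t0) hc gaussian_sqr gaussian_cos) => u u0.
rewrite !big_seq1 exprMn sqr_sqrtr// mul1r.
have v0 : (0 <= u ^+ 2 / 2)%R by rewrite divr_ge0// sqr_ge0.
have hx i : i \in s -> (0 <= 2 * b i ^+ 2 / t ^+ 2 <= M)%R by move=> /bM ->; rewrite x0.
have := prod_invD1_le M0 v0 hx.
have -> : (\prod_(i <- s) (1 + 2 * b i ^+ 2 / t ^+ 2 * (u ^+ 2 / 2))^-1 =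
    \prod_(i <- s) (t ^+ 2 / (t ^+ 2 + (u * b i) ^+ 2)))%R.
  apply: eq_bigr => i _.
  have t20 : (0 < t ^+ 2)%R by rewrite exprn_gt0.
  have := sqr_ge0 (u * b i)%R; rewrite exprMn => ub0.
  by field; rewrite ?gt_eqF//=; lra.
have -> : (2 / t ^+ 2 * (\sum_(i <- s) b i ^+ 2) = \sum_(i <- s) 2 * b i ^+ 2 / t ^+ 2)%R.
  by rewrite mulr_sumr; apply: eq_bigr => i _; rewrite mulrAC.
move: (\sum_(i <- s) 2 * b i ^+ 2 / t ^+ 2)%R => S.
have -> : (u ^+ 2 * (S + M) / 2 = (S + M) * (u ^+ 2 / 2))%R by rewrite mulrAC mulrC mulrA.
lra.
Qed.

(** Mean value theorem between [S - x] and [S], the intermediate point lying above [w]. It absorbs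
    the error term of the Laplace recursion. *)
Lemma powR_increment q (S x w : R) : (2 <= q)%R -> (0 < x)%R -> (0 <= w)%R -> (w + x <= S)%R ->
  ((S - x) `^ q + q * x * w `^ (q - 1) <= S `^ q)%R.
Proof.
move=> q2 x0 w0 wS; have q1 : (1 < q)%R by lra.
have ltS : (S - x < S)%R by lra.
have [c /andP[c1 c2] E] := MVT_line (fun z => is_derive_apow z q1) ltS.
have aE z : (0 <= z)%R -> apow q z = (z `^ q)%R by move=> z0; rewrite /apow ger0_norm.
rewrite !aE in E; [|lra|lra].
have c0 : (0 < c)%R by lra.
have sE : spow (q - 1) c = (c `^ (q - 1))%R by rewrite /spow gtr0_sg// mul1r gtr0_norm.
rewrite sE in E.
have hw : (w `^ (q - 1) <= c `^ (q - 1))%R by rewrite ge0_ler_powR ?nnegrE//; lra.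
have : (q * x * w `^ (q - 1) <= q * x * c `^ (q - 1))%R.
  by rewrite ler_wpM2l// mulr_ge0//; lra.
have Sx : (S - (S - x) = x)%R by ring.
by rewrite Sx in E; lra.
Qed.

(** Outer induction on [N], lowering [p] by 2, and inner induction on [s]. Each descent needs one
    more [M] so that [powR_increment] has room for the full variance of the summand just added. *)
Lemma exponential_moment_le t (t0 : (0 < t)%R) b (N : nat) s p M :
  (2 <= p < 2 * N%:R + 4)%R ->
  (0 <= M)%R -> (forall i, i \in s -> 2 * b i ^+ 2 / t ^+ 2 <= M)%R ->
  iter_avg (fun=> exponential_law t0) b s (fun z => (apow p z)%:E) 0%R <=
  gaussian_moment p *
    ((\sum_(i <- s) 2 * b i ^+ 2 / t ^+ 2 + N.+1%:R * M) `^ (p / 2))%:E.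
Proof.
have x0 i : (0 <= 2 * b i ^+ 2 / t ^+ 2)%R by rewrite divr_ge0 ?sqr_ge0// mulr_ge0// sqr_ge0.
have S0 r : (0 <= \sum_(i <- r) 2 * b i ^+ 2 / t ^+ 2)%R by rewrite sumr_ge0.
elim: N p s => [|N IH] p s /andP[p2 pN] M0 hM.
all: have NM0 (n : nat) : (0 <= n%:R * M)%R by rewrite mulr_ge0.
all: have base : (p < 4)%R -> iter_avg (fun=> exponential_law t0) b s (fun z => (apow p z)%:E) 0%R <=
  gaussian_moment p *
    ((\sum_(i <- s) 2 * b i ^+ 2 / t ^+ 2 + 1 * M) `^ (p / 2))%:E.
1,3: move=> p4; rewrite mul1r; have [->|pn2] := eqVneq p 2%R;
  last by apply: exponential_base => //; rewrite lt_def pn2 p2.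
1,2: rewrite (iter_avg_apow2 _ _ _ (exponential_sqr t0)) gaussian_moment2 mul1e;
  rewrite divff// powRr1 ?addr_ge0// lee_fin expr0n/= add0r mulr_sumr;
  under [leLHS]eq_bigr do rewrite mulrAC; by rewrite lerDl.
  by apply: base; lra.
have [/base h|p4] := ltP p 4%R.
  apply: (le_trans h); rewrite lee_wpmul2l ?gaussian_moment_ge0// lee_fin.
  rewrite ge0_ler_powR ?nnegrE ?addr_ge0 ?NM0 ?mul1r//; first by lra.
  by rewrite lerD2l ler_peMl// ler1n.
clear base; elim/last_ind: s hM => [|s i IHs] hM.
  by rewrite /= /apow normr0 powR0 ?mule_ge0 ?gaussian_moment_ge0 ?lee_fin ?powR_ge0// gt_eqF//; lra.
have hMs j : j \in s -> (2 * b j ^+ 2 / t ^+ 2 <= M)%R.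
  by move=> js; apply: hM; rewrite mem_rcons in_cons js orbT.
have him : (2 * b i ^+ 2 / t ^+ 2 <= M)%R by apply: hM; rewrite mem_rcons mem_head.
(* A zero coefficient changes neither side, whereas [powR_increment] needs a positive increment. *)
have [b0|bn0] := eqVneq (b i) 0%R.
  rewrite iter_avg_rcons b0 -cats1 big_cat big_seq1/= b0 expr0n/= mulr0 mul0r addr0.
  rewrite (_ : sym_avg _ _ _ = (fun z => (apow p z)%:E)); first exact: IHs.
  apply/funext => z; rewrite sym_avg_apow.
  rewrite (eq_integral (cst (apow p z)%:E)); last first.
    by move=> u _; rewrite /symp mul0r addr0 subr0; congr EFin; field.
  by rewrite integral_cst// -[RHS]mule1 -(probability_setT (exponential_law t0)).
have xi0 : (0 < 2 * b i ^+ 2 / t ^+ 2)%R.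
  by rewrite divr_gt0 ?exprn_gt0// mulr_gt0// lt_def sqr_ge0 sqrf_eq0 bn0.
set xi := (2 * b i ^+ 2 / t ^+ 2)%R in him xi0.
have p12 : (1 < p - 2)%R by lra.
have IHp : iter_avg (fun=> exponential_law t0) b (rcons s i) (fun z => (apow (p - 2) z)%:E) 0%R <=
    gaussian_moment (p - 2) *
    ((\sum_(i <- rcons s i) 2 * b i ^+ 2 / t ^+ 2 + N.+1%:R * M) `^ ((p - 2) / 2))%:E.
  apply: IH => //; move: pN; rewrite -natr1 => pN'; apply/andP; split; lra.
have {}IHs := IHs hMs.
have k0 : (0 <= p * (p - 1) * b i ^+ 2 / t ^+ 2)%R.
  by rewrite divr_ge0 ?sqr_ge0// mulr_ge0 ?sqr_ge0// mulr_ge0; lra.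
have a0 q z : 0 <= (apow q z)%:E by rewrite lee_fin apow_ge0.
have ma q : measurable_fun [set: R] (fun z => (apow q z)%:E) by exact: measurable_EFin_apow.
have step : iter_avg (fun=> exponential_law t0) b (rcons s i) (fun z => (apow p z)%:E) 0%R <=
    iter_avg (fun=> exponential_law t0) b s (fun z => (apow p z)%:E) 0%R +
    (p * (p - 1) * b i ^+ 2 / t ^+ 2)%:E *
    iter_avg (fun=> exponential_law t0) b (rcons s i) (fun z => (apow (p - 2) z)%:E) 0%R.
  rewrite !iter_avg_rcons -iter_avgZ//; last 2 first.
  - by move=> z; exact: sym_avg_ge0.
  - exact: measurable_sym_avg.
  rewrite -iter_avgD//; last 2 first.
  - by move=> z; rewrite mule_ge0 ?lee_fin// sym_avg_ge0.
  - by apply: measurable_funeM; exact: measurable_sym_avg.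
  apply: le_iter_avg.
  - by move=> z; exact: sym_avg_ge0.
  - exact: measurable_sym_avg.
  - by apply: emeasurable_funD => //; apply: measurable_funeM; exact: measurable_sym_avg.
  - by move=> z; exact: exponential_sym_avg_apow_le.
apply: (le_trans step); apply: le_trans (leeD IHs (lee_wpmul2l _ IHp)) _; first by rewrite lee_fin.
rewrite gaussian_moment_rec//.
have mfin : gaussian_moment (p - 2) \is a fin_num.
  by rewrite ge0_fin_numE ?gaussian_moment_ge0// gaussian_moment_lty.
have m0 : (0 <= fine (gaussian_moment (p - 2)))%R by rewrite fine_ge0// gaussian_moment_ge0.
rewrite -(fineK mfin); move: (fine _) m0 => m m0.
rewrite -!EFinM -EFinD lee_fin -cats1 big_cat big_seq1/= -/xi.
set S := (\sum_(j <- s) _)%R.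
(* [powR_increment] is applied with [q = p / 2] and [x = xi]: the factor [p - 1] comes from
   [gaussian_moment_rec], and [p b_i^2 / t^2] equals [q * xi]. *)
have wS : (S + xi + N.+1%:R * M + xi <= S + xi + N.+2%:R * M)%R.
  by rewrite -natr1 mulrDl mul1r; lra.
have w0 : (0 <= S + xi + N.+1%:R * M)%R.
  by have := S0 s; have := NM0 N.+1; rewrite -/S; lra.
have q2 : (2 <= p / 2)%R by lra.
have pm0 : (0 <= (p - 1) * m)%R by rewrite mulr_ge0//; lra.
have := ler_wpM2l pm0 (powR_increment q2 xi0 w0 wS).
rewrite (_ : S + xi + N.+2%:R * M - xi = S + N.+2%:R * M)%R; last by ring.
rewrite (_ : p / 2 - 1 = (p - 2) / 2)%R; last by field.
apply: le_trans; rewrite le_eqVlt; apply/orP; left; apply/eqP.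
rewrite /xi; field; rewrite gt_eqF//.
Qed.

End exponential_moment.

(** * Ordered coefficients and norms *)

Section ordered_sums.
Context {R : realType} (n : nat) (x : 'I_n -> R).
Hypotheses (x0 : forall i, 0 <= x i)
  (xdec : forall i j : 'I_n, (i <= j)%N -> x j <= x i).

Lemma card_ord_lt k : (k <= n)%N -> #|[set i : 'I_n | (i < k)%N]%SET| = k.
Proof.
move=> kn; rewrite -sum1_card (eq_bigl (fun i : 'I_n => (i < k)%N)); last first.
  by move=> i; rewrite !inE.
by rewrite -(big_ord_widen n (fun=> 1%N) kn) sum1_card card_ord.
Qed.

(** Deleting the first [k] terms removes most. Outside the common part, tail terms in [D] are at
    most [x_k], initial terms not in [D] are at least [x_k], and since [D] has at most [k] elements
    the latter are no fewer. *)
Lemma sum_tail_le_sum_notin (k : nat) (D : seq 'I_n) : (size D <= k)%N ->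
  \sum_(i < n | (k <= i)%N) x i <= \sum_(i < n | i \notin D) x i.
Proof.
move=> Dk; rewrite (bigID (mem D)) [leRHS](bigID (fun i : 'I_n => (k <= i)%N))/=.
rewrite addrC; apply: lerD.
  by under eq_bigl do rewrite andbC.
have [nk|kn] := leqP n k.
  rewrite big_pred0 ?sumr_ge0// => i.
  by rewrite leqNgt (leq_trans (ltn_ord i) nk).
pose m := x (Ordinal kn).
apply: (@le_trans _ _ (\sum_(i < n | (k <= i)%N && (i \in D)) m)).
  by apply: ler_sum => i /andP[ki _]; exact: xdec.
apply: (@le_trans _ _ (\sum_(i < n | (i \notin D) && ~~ (k <= i)%N) m)); last first.
  by apply: ler_sum => i /andP[_]; rewrite -ltnNge => ik; apply: xdec; exact: ltnW.
rewrite !sumr_const; apply: ler_wpMn2l; first exact: x0.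
pose E := [set i : 'I_n | (i < k)%N]%SET; pose F := [set i in D]%SET.
have EE := card_ord_lt (ltnW kn).
have FD : (#|F| <= k)%N by rewrite cardsE (leq_trans (card_size D)).
have -> : #|[pred i : 'I_n | (k <= i)%N & i \in D]| = #|F :\: E|.
  by apply: eq_card => i; rewrite !inE -leqNgt.
have -> : #|[pred i : 'I_n | i \notin D & ~~ (k <= i)%N]| = #|E :\: F|.
  by apply: eq_card => i; rewrite !inE -ltnNge.
by rewrite !cardsD EE finset.setIC leq_sub2r.
Qed.

Lemma sum_tail_addn_le (k K : nat) (Kn : (K < n)%N) : (k <= K)%N ->
  \sum_(i < n | (K <= i)%N) x i + (K - k)%:R * x (Ordinal Kn) <=
  \sum_(i < n | (k <= i)%N) x i.
Proof.
move=> kK; rewrite [leRHS](bigID (fun i : 'I_n => (K <= i)%N))/=; apply: lerD.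
  rewrite le_eqVlt; apply/orP; left; apply/eqP; apply: eq_bigl => i.
  by apply/idP/andP => [Ki|[]//]; rewrite Ki (leq_trans kK).
apply: (@le_trans _ _ (\sum_(i < n | (k <= i)%N && ~~ (K <= i)%N) x (Ordinal Kn))); last first.
  by apply: ler_sum => i /andP[_]; rewrite -ltnNge => iK; apply: xdec; exact: ltnW.
rewrite sumr_const mulr_natl; apply: ler_wpMn2l; first exact: x0.
have KE := card_ord_lt (ltnW Kn); have kE := card_ord_lt (leq_trans kK (ltnW Kn)).
rewrite -{1}KE -{1}kE.
have -> : #|[pred i : 'I_n | (k <= i)%N & ~~ (K <= i)%N]| =
    #|[set i : 'I_n | (i < K)%N]%SET :\: [set i : 'I_n | (i < k)%N]%SET|.
  by apply: eq_card => i; rewrite !inE -leqNgt -ltnNge.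
rewrite cardsD leq_sub2l//; apply: subset_leq_card.
by apply/fintype.subsetP => i; rewrite !inE => /andP[].
Qed.

End ordered_sums.

(** [k] is [ceil z - 1], the threshold for indices counted from 0. *)
Lemma nat_lt_le {R : realType} (z : R) : 0 < z -> exists k : nat, k%:R < z <= k.+1%:R.
Proof.
move=> z0; have /andP[h1 h2] := truncn_itv (ltW z0).
move: h1; rewrite le_eqVlt => /predU1P[zE|h]; last first.
  by exists (Num.truncn z); rewrite h ltW.
move: zE z0; case: (Num.truncn z) => [<-|k <-]; first by rewrite ltxx.
by move=> _; exists k; rewrite lexx ltr_nat ltnS leqnn.
Qed.

Lemma nat_le_succ {R : realType} (z : R) (k i : nat) : k%:R < z <= k.+1%:R ->
  (z <= i.+1%:R) = (k <= i)%N.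
Proof.
move=> /andP[kz zk]; apply/idP/idP => [zi|ki].
  by rewrite -ltnS -(ltr_nat R) (lt_le_trans kz).
by rewrite (le_trans zk)// ler_nat ltnS.
Qed.

Lemma Lnorm_apow d (T : measurableType d) (R : realType)
    (mu : {measure set T -> \bar R}) (f : T -> R) (p : R) :
  'N[mu]_p%:E[(fun w => (f w)%:E)]%E = ((\int[mu]_w (apow p (f w))%:E) `^ p^-1)%E.
Proof. by rewrite unlock. Qed.

Lemma gaussian_normE {R : realType} (p : R) :
  gaussian_norm p = (gaussian_moment p `^ p^-1)%E.
Proof.
rewrite /gaussian_norm Lnorm_apow; congr (_ `^ _)%E.
rewrite /gaussian_moment ge0_integral_borel_law//.
- by move=> z; rewrite lee_fin apow_ge0.
- exact: measurable_EFin_apow.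
Qed.

Lemma poweR_inv_mul {R : realType} (m : \bar R) (p A : R) : 0 < p -> 0 <= A ->
  (0 <= m)%E -> ((m * (A `^ (p / 2))%:E) `^ p^-1 = m `^ p^-1 * (Num.sqrt A)%:E)%E.
Proof.
move=> p0 A0 m0; rewrite poweRM ?lee_fin ?powR_ge0//; congr (_ * _)%E.
rewrite poweR_EFin -powRrM -powR12_sqrt//; congr (_ `^ _)%:E.
by field; rewrite gt_eqF.
Qed.

Section moment_comparison.
Context {R : realType}.
Local Open Scope ereal_scope.

(** Jensen's inequality one summand at a time, in the form that [symp] is smallest at 0. *)
Lemma apow_le_iter_avg {I : eqType} (mu : I -> probability R R) (b : I -> R) s (p : R) :
  (1 < p)%R -> forall y, (apow p y)%:E <= iter_avg mu b s (fun z => (apow p z)%:E) y.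
Proof.
move=> p1; elim: s => [//|i s IH] y /=.
have a0 z : 0 <= (apow p z)%:E by rewrite lee_fin apow_ge0.
apply: (@le_trans _ _ (sym_avg (mu i) (b i) (fun z => (apow p z)%:E) y)); last first.
  apply: le_sym_avg => //; first exact: measurable_EFin_apow.
  by apply: measurable_iter_avg => //; exact: measurable_EFin_apow.
rewrite sym_avg_apow -[leLHS]mule1 -(probability_setT (mu i)) -integral_cst//.
apply: ge0_le_integral => //.
- by move=> t _; exact: a0.
- by apply/measurable_EFinP; apply: measurable_symp.
- move=> t _; rewrite lee_fin -(symp0 p y (b i)) -(symp_norm _ _ _ t).
  by apply: symp_monotone; rewrite ?lexx ?normr_ge0//; lra.
Qed.

Lemma exponential_limit_le (m E : \bar R) (q A : R) : (0 < q)%R -> (0 <= A)%R ->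
  m \is a fin_num -> 0 <= m ->
  (forall t : R, (0 < t)%R -> (t ^+ 2 < 2)%R -> E <= m * ((2 / t ^+ 2 * A) `^ q)%:E) ->
  E <= m * (A `^ q)%:E.
Proof.
move=> q0 A0 /fineK <-; move: (fine m) => {}m; rewrite lee_fin => m0 h.
rewrite -EFinM; set c := (m * A `^ q)%R.
have c0 : (0 <= c)%R by rewrite mulr_ge0 ?powR_ge0.
apply/lee_addgt0Pr => e e0.
(* [u = 2 / t^2] is chosen with [u^q = 1 + de], so the bound becomes [(1 + de) c], which is at most
   [c + e]; the [+ 1] guards against [c = 0]. *)
pose de := (e / (c + 1))%R; have de0 : (0 < de)%R by rewrite divr_gt0//; lra.
pose u := ((1 + de) `^ q^-1)%R.
have u1 : (1 < u)%R.
  apply: (@le_lt_trans _ _ ((1 : R) `^ q^-1)%R); first by rewrite powR1.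
  by apply: gt0_ltr_powR; rewrite ?invr_gt0 ?nnegrE//; lra.
have u0 : (0 < u)%R by lra.
pose t := Num.sqrt (2 / u)%R.
have tu : (t ^+ 2 = 2 / u)%R by rewrite sqr_sqrtr// divr_ge0// ltW.
have t0 : (0 < t)%R by rewrite sqrtr_gt0 divr_gt0.
have t2 : (t ^+ 2 < 2)%R by rewrite tu ltr_pdivrMr// ltr_pMr.
apply: (le_trans (h t t0 t2)).
have -> : (2 / t ^+ 2 = u)%R by rewrite tu invf_div mulrC divfK.
rewrite -EFinM -EFinD lee_fin.
rewrite powRM ?(ltW u0)// /u -powRrM mulVf ?gt_eqF// powRr1; last by lra.
rewrite mulrCA -/c mulrDl mul1r lerD2l.
rewrite /de mulrAC ler_pdivrMr; last by lra.
by rewrite ler_pM2l//; lra.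
Qed.

End moment_comparison.

Theorem theorem2 (d : measure_display) (T : measurableType d) (R : realType)
    (P : probability T R) (n : nat) (X : 'I_n -> {RV P >-> R})
    (a : 'I_n -> R) (p : R)
    (hindep : independent_RVs X)
    (hsym : forall i, symmetric_RV (X i))
    (hlc : forall i, log_concave_tails (X i))
    (hvar : forall i, ('E_P[(fun w => (X i w ^+ 2)%R)] = 1)%E)
    (ha : forall i j : 'I_n, (i <= j)%N -> `|a j| <= `|a i|)
    (hp : 3 <= p) :
  let gauss_part : \bar R :=
    (gaussian_norm p *
      (Num.sqrt (\sum_(i < n | Num.ceil (p / 2) <= (i.+1)%:Z) a i ^+ 2))%:E)%E in
  let head_part : \bar R :=
    'N[P]_p%:E[(fun w => (\sum_(i < n | (i.+1)%:R < p) a i * X i w)%R%:E)]%E in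
  let total : \bar R :=
    'N[P]_p%:E[(fun w => (\sum_(i < n) a i * X i w)%R%:E)]%E in
  (Order.max gauss_part head_part <= total)%E /\
  (total <= gauss_part + head_part)%E.
Proof.
move=> gauss_part head_part total.
have p0 : 0 < p by lra. have p1 : 1 < p by lra.
(* [k = ceil (p / 2) - 1] and [K = ceil p - 1]: in zero-based indices the Gaussian part is [k <= i]
   and the head is [i < K]. *)
have [k kp] := nat_lt_le (divr_gt0 p0 (ltr0Sn R 1)).
have [K Kp] := nat_lt_le p0.
have condk (i : 'I_n) : (Num.ceil (p / 2) <= (i.+1)%:Z) = (k <= i)%N.
  by rewrite ceil_le_int -(nat_le_succ i kp).
have condK (i : 'I_n) : ((i.+1)%:R < p) = ~~ (K <= i)%N.
  by rewrite ltNge (nat_le_succ i Kp).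
pose law i : probability R R := distribution P (X i).
pose f z : \bar R := (apow p z)%:E.
have f0 z : (0 <= f z)%E by rewrite lee_fin apow_ge0.
have mf : measurable_fun [set: R] f by exact: measurable_EFin_apow.
have var1 i : (\int[law i]_x (x ^+ 2)%:E = 1)%E.
  rewrite -(hvar i) unlock ge0_integral_distribution//.
  - by apply/measurable_EFinP; exact: measurable_funX.
  - by move=> z; rewrite lee_fin sqr_ge0.
pose moment s := iter_avg law a s f 0.
have momentE s : uniq s ->
    'N[P]_p%:E[(fun w => (weighted_sum X a s w)%:E)]%E = (moment s `^ p^-1)%E.
  move=> us; rewrite Lnorm_apow /moment -ge0_expectation_weighted_sum//.
  by congr (_ `^ _)%E; apply: eq_integral => w _; rewrite add0r.
have moment0 s : (0 <= moment s)%E by exact: iter_avg_ge0.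
pose s := index_enum 'I_n.
pose sh := [seq i : 'I_n <- s | ~~ (K <= i)%N]; pose st := [seq i : 'I_n <- s | (K <= i)%N].
have us : uniq s by exact: index_enum_uniq.
have ush : uniq sh by exact: filter_uniq.
have ust : uniq st by exact: filter_uniq.
have totalE : total = (moment s `^ p^-1)%E by rewrite -momentE.
have headE : head_part = (moment sh `^ p^-1)%E.
  rewrite -momentE// /head_part; congr Lnorm; apply/funext => w; congr EFin.
  by rewrite /weighted_sum big_filter; apply: eq_bigl => i; rewrite condK.
have pV0 : 0 <= p^-1 by rewrite invr_ge0 ltW.
pose A := \sum_(i < n | (k <= i)%N) a i ^+ 2.
have A0 : 0 <= A by apply: sumr_ge0 => i _; exact: sqr_ge0.
have a2dec (i j : 'I_n) : (i <= j)%N -> a j ^+ 2 <= a i ^+ 2.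
  by move=> /ha; rewrite -!(real_normK (num_real (a _))) ler_sqr ?nnegrE.
have gaussE : gauss_part = ((gaussian_moment p * (A `^ (p / 2))%:E) `^ p^-1)%E.
  rewrite poweR_inv_mul ?gaussian_moment_ge0// /gauss_part gaussian_normE.
  by congr (_ * (Num.sqrt _)%:E)%E; apply: eq_bigl => i; rewrite condk.
have gm0 : (0 <= gaussian_moment p * (A `^ (p / 2))%:E)%E.
  by rewrite mule_ge0 ?gaussian_moment_ge0// lee_fin powR_ge0.
have le_root (u v : \bar R) : (0 <= u -> u <= v -> u `^ p^-1 <= v `^ p^-1)%E.
  by move=> u0 uv; apply: gt0_ler_poweR; rewrite ?in_itv/= ?leey ?andbT// (le_trans u0).
split.
  rewrite ge_max; apply/andP; split.
    rewrite gaussE totalE; apply: le_root => //.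
    apply: (@le_trans _ _ (iter_avg (fun=> \d_(1 : R)) a s f 0)).
      apply: (rademacher_moment_ge (k := k)) => //.
        by move: kp => /andP[_]; rewrite ler_pdivrMr// mulrC => ->; rewrite andbT; lra.
      by move=> D Dk; apply: sum_tail_le_sum_notin => // i; exact: sqr_ge0.
    by apply: iter_avg_compare => // i y _; exact: dirac_sym_avg_le.
  (* The indices are reordered so that the tail averages are innermost, where Jensen's inequality
     removes them. *)
  rewrite headE; have -> : total = (moment (sh ++ st) `^ p^-1)%E.
    rewrite -momentE; last first.
      rewrite cat_uniq ush ust andbT/=; apply/hasPn => i.
      by rewrite !mem_filter => /andP[-> _].
    rewrite /total; congr Lnorm; apply/funext => w; congr EFin.
    by rewrite /weighted_sum big_cat !big_filter [LHS](bigID (fun i : 'I_n => (K <= i)%N))/= addrC.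
  apply: le_root => //; rewrite /moment iter_avg_cat; apply: le_iter_avg => //.
    exact: measurable_iter_avg.
  by move=> z; exact: apow_le_iter_avg.
have mls r : measurable_fun [set: T] (weighted_sum X a r) by exact: measurable_weighted_sum.
apply: (@le_trans _ _ ('N[P]_p%:E[(fun w => (weighted_sum X a st w)%:E)] + head_part)%E).
  have -> : head_part = 'N[P]_p%:E[(EFin \o weighted_sum X a sh)]%E by rewrite headE -momentE.
  have -> : total = 'N[P]_p%:E[EFin \o (weighted_sum X a st \+ weighted_sum X a sh)%R]%E.
    rewrite /total; congr Lnorm; apply/funext => w; congr EFin.
    by rewrite /weighted_sum /= !big_filter (bigID (fun i : 'I_n => (K <= i)%N)).
  by apply: minkowski_EFin => //; exact: ltW.
apply: leeD => //; rewrite momentE// gaussE; apply: le_root => //.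
have [nK|Kn] := leqP n K.
  have -> : st = [::].
    apply/eqP; rewrite -size_eq0 size_filter -leqn0 leqNgt -has_count.
    by apply/hasPn => i _; rewrite -ltnNge (leq_trans (ltn_ord i)).
  by rewrite /moment/= /f /apow normr0 powR0// gt_eqF.
pose M0 := a (Ordinal Kn) ^+ 2.
(* Both sides of [2 k < p <= K + 1] are integers. *)
have kK2 : (2 * k <= K)%N.
  rewrite -ltnS -(ltr_nat R); case/andP: kp => kp _; case/andP: Kp => _ pK.
  by apply: lt_le_trans pK; rewrite natrM mulrC -ltr_pdivlMr.
(* Equality with [2 k <= K] would force [k = K = 0], hence [p <= 1]. Strictness makes the
   predecessor of [K - k] an honest one. *)
have kK : (k < K)%N.
  rewrite ltn_neqAle (leq_trans _ kK2) ?leq_pmull// andbT.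
  apply: contraTneq kK2 => kKE; rewrite -ltnNge -kKE ltn_Pmull// lt0n.
  apply: contraTneq Kp => k0; rewrite -kKE k0; lra.
have mfin : gaussian_moment p \is a fin_num.
  by rewrite ge0_fin_numE ?gaussian_moment_ge0// gaussian_moment_lty.
apply: exponential_limit_le => //; [by rewrite divr_gt0|exact: gaussian_moment_ge0|].
move=> t t0 t2.
apply: (@le_trans _ _ (iter_avg (fun=> exponential_law t0) a st f 0)).
  by apply: iter_avg_compare => // i y _; exact: (log_concave_sym_avg_le (X := X i) y (a i) t0 hp t2 (hlc i) (var1 i)).
have M00 : 0 <= 2 * M0 / t ^+ 2 by rewrite divr_ge0 ?sqr_ge0// mulr_ge0// sqr_ge0.
(* Admissible since [p <= K + 1 < 2 (K - k) + 2], by [2 k <= K]. It costs [K - k] copies of the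
   largest tail variance, one for each index [k <= i < K], whose coefficients are at least as
   large. *)
apply: le_trans (exponential_moment_le t0 (N := (K - k).-1) _ M00 _) _.
- case/andP: kp => kp1 kp2; case/andP: Kp => Kp1 Kp2.
  have E : (K - k).-1%:R + 1 = K%:R - k%:R :> R.
    by rewrite -natrB ?(ltnW kK)// natr1 prednK// subn_gt0.
  have : (2 * k)%:R <= K%:R :> R by rewrite ler_nat.
  by rewrite natrM -natr1 in Kp2 *; move=> h; apply/andP; split; lra.
- move=> i; rewrite mem_filter => /andP[Ki _].
  by rewrite ler_pM2r ?invr_gt0 ?exprn_gt0// ler_pM2l// a2dec.
apply: lee_wpmul2l; first exact: gaussian_moment_ge0.
rewrite lee_fin prednK ?subn_gt0//.
have -> : \sum_(i <- st) 2 * a i ^+ 2 / t ^+ 2 + (K - k)%:R * (2 * M0 / t ^+ 2) =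
    2 / t ^+ 2 * (\sum_(i < n | (K <= i)%N) a i ^+ 2 + (K - k)%:R * M0).
  rewrite mulrDr mulr_sumr big_filter; congr (_ + _); last by ring.
  by apply: eq_bigr => i _; rewrite mulrAC.
have tt0 : 0 <= 2 / t ^+ 2 by rewrite divr_ge0 ?sqr_ge0.
have S0 : 0 <= \sum_(i < n | (K <= i)%N) a i ^+ 2 + (K - k)%:R * M0.
  apply: addr_ge0; first by apply: sumr_ge0 => i _; exact: sqr_ge0.
  by rewrite mulr_ge0// sqr_ge0.
have SA : \sum_(i < n | (K <= i)%N) a i ^+ 2 + (K - k)%:R * M0 <= A.
  apply: (sum_tail_addn_le (x := fun i => a i ^+ 2)) => //; last exact: ltnW.
  by move=> i; exact: sqr_ge0.
have q0 : 0 <= p / 2 by rewrite divr_ge0// ltW.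
apply: ge0_ler_powR => //; first exact: mulr_ge0.
  exact: mulr_ge0.
exact: ler_wpM2l.
Qed.
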